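(* $\mathsf{ACA}_0$ proves: every complete separable metric space which is Atsuji is Lebesgue.
   Context: Systems. All theories are in the two-sorted language of second order arithmetic (number variables, set variables, $0,1,+,\cdot,=,<,\in$). $\mathsf{RCA}_0$ consists of the basic arithmetical axioms, induction for $\Sigma^0_1$ formulas and comprehension for $\Delta^0_1$ formulas. $\mathsf{ACA}_0$ is $\mathsf{RCA}_0$ plus comprehension for all arithmetical formulas. Spaces (definitions made in $\mathsf{RCA}_0$; reals are coded by rapidly converging Cauchy sequences of rationals). A (code for a) complete separable metric space $\widehat A$ is a set $A\subseteq\mathbb N$ together with $d:A\times A\to\mathbb R$ such that $d(a,a)=0$, $d(a,b)=d(b,a)\ge 0$, $d(a,b)\le d(a,c)+d(c,b)$ for all $a,b,c\in A$. A point of $\widehat A$ is a sequence $\langle a_n:n\in\mathbb N\rangle$ of elements of $A$ with $d(a_n,a_{n+1})<2^{-n}$ for all $n$; $d$ extends to points in the obvious way (also written $d_{\widehat A}$) and $x,y\in\widehat A$ are identified ($x=y$) when $d(x,y)=0$. $B(x,q)$ denotes the open ball $\{y\in\widehat A: d(x,y)<q\}$. An open set in $\widehat A$ is coded by a sequence $\langle (a_n,q_n):n\in\mathbb N\rangle$ of elements of $A\times\mathbb Q^+$ and means $\bigcup_n B(a_n,q_n)$. An open covering of $\widehat A$ is a sequence $\langle U_n:n\in\mathbb N\rangle$ of open sets such that every $x\in\widehat A$ belongs to some $U_n$. Lebesgue: $\widehat A$ is Lebesgue if for every open covering $\langle U_n:n\in\mathbb N\rangle$ of $\widehat A$ there is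 $q\in\mathbb R^+$ (a Lebesgue number for the covering) such that $\forall x\in\widehat A\,\exists n\ B(x,q)\subseteq U_n$. Continuous functions: a (code for a) continuous function from $\widehat A$ to $\widehat B$ is a set $\Phi\subseteq\mathbb N\times A\times\mathbb Q^+\times B\times\mathbb Q^+$ such that, writing $(a,r)\Phi(b,s)$ for $\exists n\,(n,a,r,b,s)\in\Phi$: (i) $(a,r)\Phi(b,s)\wedge(a,r)\Phi(b',s')\to d(b,b')<s+s'$; (ii) $(a,r)\Phi(b,s)\wedge d(b,b')+s\le s'\to(a,r)\Phi(b',s')$; (iii) $(a,r)\Phi(b,s)\wedge d(a,a')+r'\le r\to(a',r')\Phi(b,s)$; (iv) $\forall x\in\widehat A\,\forall q\in\mathbb Q^+\,\exists(a,r,b,s)\,((a,r)\Phi(b,s)\wedge d(x,a)<r\wedge s<q)$. For $x\in\widehat A$, $f(x)$ is the unique $y\in\widehat B$ with $d(y,b)<s$ whenever $d(x,a)<r$ and $(a,r)\Phi(b,s)$. The function $f$ is uniformly continuous if $\forall\varepsilon\in\mathbb R^+\,\exists\delta\in\mathbb R^+\,\forall x,y\in\widehat A\,(d_{\widehat A}(x,y)<\delta\to d_{\widehat B}(f(x),f(y))<\varepsilon)$. Atsuji: $\widehat A$ is Atsuji if every continuous function $f:\widehat A\to\widehat B$, with $\widehat B$ an arbitrary complete separable metric space, is uniformly continuous. *)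

(* Defs.v *)
From Stdlib Require Import List Arith.
Import ListNotations.

(** * The two-sorted language of second order arithmetic *)

(** Variables are de Bruijn indices, counted separately for the two sorts:
    [TVar n] is the n-th free number variable; a set variable is a bare [nat].
    Sets have no equality of their own, as usual: [X = Y] is extensional. *)

Inductive term : Type :=
| TVar (n : nat)
| TZero
| TOne
| TAdd (s t : term)
| TMul (s t : term).

Inductive form : Type :=
| FEq (s t : term)
| FLt (s t : term)
| FMem (t : term) (X : nat)
| Bot
| Imp (p q : form)
| ForallN (p : form)
| ForallS (p : form).

Definition Not p := Imp p Bot.
Definition And p q := Not (Imp p (Not q)).
Definition Or p q := Imp (Not p) q.
Definition Iff p q := And (Imp p q) (Imp q p).
Definition ExistsN p := Not (ForallN (Not p)).
Definition ExistsS p := Not (ForallS (Not p)).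

Definition scons {T : Type} (x : T) (f : nat -> T) (n : nat) : T :=
  match n with 0 => x | S n => f n end.

Fixpoint tsubst (sg : nat -> term) (t : term) : term :=
  match t with
  | TVar n => sg n
  | TZero => TZero
  | TOne => TOne
  | TAdd s t => TAdd (tsubst sg s) (tsubst sg t)
  | TMul s t => TMul (tsubst sg s) (tsubst sg t)
  end.

Definition tshift : term -> term := tsubst (fun n => TVar (S n)).

Definition upN (sg : nat -> term) : nat -> term :=
  scons (TVar 0) (fun n => tshift (sg n)).
Definition upS (rh : nat -> nat) : nat -> nat :=
  scons 0 (fun n => S (rh n)).

Fixpoint subst (sg : nat -> term) (rh : nat -> nat) (p : form) : form :=
  match p with
  | FEq s t => FEq (tsubst sg s) (tsubst sg t)
  | FLt s t => FLt (tsubst sg s) (tsubst sg t)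
  | FMem t X => FMem (tsubst sg t) (rh X)
  | Bot => Bot
  | Imp p q => Imp (subst sg rh p) (subst sg rh q)
  | ForallN p => ForallN (subst (upN sg) rh p)
  | ForallS p => ForallS (subst sg (upS rh) p)
  end.

Definition shiftN : form -> form := subst (fun n => TVar (S n)) (fun X => X).
Definition shiftS : form -> form := subst TVar S.
Definition instN (t : term) : form -> form := subst (scons t TVar) (fun X => X).
Definition instS (Y : nat) : form -> form := subst TVar (scons Y (fun X => X)).

(** * Provability: classical natural deduction with equality *)

(** A free variable of an axiom is read as universally quantified:
    [ForallN_I] and [ForallS_I] put no condition on the axioms used. *)
Inductive prv (T : form -> Prop) : list form -> form -> Prop :=
| Ax G p : T p -> prv T G p
| Hyp G p : In p G -> prv T G p
| Imp_I G p q : prv T (p :: G) q -> prv T G (Imp p q)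
| Imp_E G p q : prv T G (Imp p q) -> prv T G p -> prv T G q
| DN G p : prv T G (Not (Not p)) -> prv T G p
| ForallN_I G p : prv T (map shiftN G) p -> prv T G (ForallN p)
| ForallN_E G p t : prv T G (ForallN p) -> prv T G (instN t p)
| ForallS_I G p : prv T (map shiftS G) p -> prv T G (ForallS p)
| ForallS_E G p Y : prv T G (ForallS p) -> prv T G (instS Y p)
| Eq_I G t : prv T G (FEq t t)
| Eq_E G p s t : prv T G (FEq s t) -> prv T G (instN s p) -> prv T G (instN t p).

Definition proves (T : form -> Prop) (p : form) : Prop := prv T [] p.

(** * A binder-friendly syntax for formulas *)

(** A [fexp] yields a formula once it is told under how many number and set
    quantifiers it is placed.  The variable bound at depth [m] is, seen from
    depth [m'], the index [m' - 1 - m]; so the bodies of quantifiers can be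
    written as functions of the bound variable, with no shifting. *)
Definition nexp : Type := nat -> term.
Definition sexp : Type := nat -> nat.
Definition fexp : Type := nat -> nat -> form.

Definition closed (p : fexp) : form := p 0 0.

Definition allN (f : nexp -> fexp) : fexp :=
  fun m k => ForallN (f (fun m' => TVar (m' - S m)) (S m) k).
Definition exN (f : nexp -> fexp) : fexp :=
  fun m k => ExistsN (f (fun m' => TVar (m' - S m)) (S m) k).
Definition allS (f : sexp -> fexp) : fexp :=
  fun m k => ForallS (f (fun k' => k' - S k) m (S k)).
Definition exS (f : sexp -> fexp) : fexp :=
  fun m k => ExistsS (f (fun k' => k' - S k) m (S k)).

Definition zeroE : nexp := fun _ => TZero.
Definition oneE : nexp := fun _ => TOne.
Definition addE (s t : nexp) : nexp := fun m => TAdd (s m) (t m).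
Definition mulE (s t : nexp) : nexp := fun m => TMul (s m) (t m).
Definition eqE (s t : nexp) : fexp := fun m _ => FEq (s m) (t m).
Definition ltE (s t : nexp) : fexp := fun m _ => FLt (s m) (t m).
Definition memE (s : nexp) (X : sexp) : fexp := fun m k => FMem (s m) (X k).
Definition notE (p : fexp) : fexp := fun m k => Not (p m k).
Definition impE (p q : fexp) : fexp := fun m k => Imp (p m k) (q m k).
Definition andE (p q : fexp) : fexp := fun m k => And (p m k) (q m k).
Definition orE (p q : fexp) : fexp := fun m k => Or (p m k) (q m k).
Definition iffE (p q : fexp) : fexp := fun m k => Iff (p m k) (q m k).

Declare Scope so_scope.
Delimit Scope so_scope with so.
Bind Scope so_scope with nexp sexp fexp.

Notation "0" := zeroE : so_scope.
Notation "1" := oneE : so_scope.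
Notation "3" := (addE (addE oneE oneE) oneE) : so_scope.
Notation "s + t" := (addE s t) : so_scope.
Notation "s * t" := (mulE s t) : so_scope.
Notation "s = t" := (eqE s t) : so_scope.
Notation "s < t" := (ltE s t) : so_scope.
Notation "s '\in' X" := (memE s X) (at level 70) : so_scope.
Notation "~ p" := (notE p) : so_scope.
Notation "p /\ q" := (andE p q) : so_scope.
Notation "p \/ q" := (orE p q) : so_scope.
Notation "p <-> q" := (iffE p q) : so_scope.
Notation "p =>> q" := (impE p q) (at level 99, right associativity) : so_scope.
Notation "'ALL' x .. y , p" := (allN (fun x => .. (allN (fun y => p)) ..))
  (at level 200, x binder, y binder, right associativity) : so_scope.
Notation "'EX' x .. y , p" := (exN (fun x => .. (exN (fun y => p)) ..))
  (at level 200, x binder, y binder, right associativity) : so_scope.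
Notation "'ALLS' X .. Y , p" := (allS (fun X => .. (allS (fun Y => p)) ..))
  (at level 200, X binder, Y binder, right associativity) : so_scope.
Notation "'EXS' X .. Y , p" := (exS (fun X => .. (exS (fun Y => p)) ..))
  (at level 200, X binder, Y binder, right associativity) : so_scope.

Local Open Scope so_scope.

(** * The axioms of RCA0 and ACA0 *)

Definition basic_axioms : list form :=
  [ closed (ALL n, ~ n + 1 = 0);
    closed (ALL m n, m + 1 = n + 1 =>> m = n);
    closed (ALL m, m + 0 = m);
    closed (ALL m n, m + (n + 1) = (m + n) + 1);
    closed (ALL m, m * 0 = 0);
    closed (ALL m n, m * (n + 1) = m * n + m);
    closed (ALL m, ~ m < 0);
    closed (ALL m n, m < n + 1 <-> (m < n \/ m = n)) ].

(** Formulas with only bounded number quantifiers; the bound [t] does not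
    contain the quantified variable, hence [tshift]. *)
Inductive Delta00 : form -> Prop :=
| Delta00_Eq s t : Delta00 (FEq s t)
| Delta00_Lt s t : Delta00 (FLt s t)
| Delta00_Mem t X : Delta00 (FMem t X)
| Delta00_Bot : Delta00 Bot
| Delta00_Imp p q : Delta00 p -> Delta00 q -> Delta00 (Imp p q)
| Delta00_All t p : Delta00 p -> Delta00 (ForallN (Imp (FLt (TVar 0) (tshift t)) p))
| Delta00_Ex t p : Delta00 p -> Delta00 (ExistsN (And (FLt (TVar 0) (tshift t)) p)).

Inductive Sigma01 : form -> Prop :=
| Sigma01_Ex p : Delta00 p -> Sigma01 (ExistsN p).

Inductive Pi01 : form -> Prop :=
| Pi01_All p : Delta00 p -> Pi01 (ForallN p).

Fixpoint arithmetical (p : form) : Prop :=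
  match p with
  | Imp p q => arithmetical p /\ arithmetical q
  | ForallN p => arithmetical p
  | ForallS _ => False
  | _ => True
  end%type.

(** In the schemes below the distinguished number variable of [p] is [TVar 0];
    all other free variables are parameters. *)
Definition induction (p : form) : form :=
  Imp (And (instN TZero p)
           (ForallN (Imp p (subst (scons (TAdd (TVar 0) TOne) (fun n => TVar (S n)))
                               (fun X => X) p))))
      (ForallN p).

(** [EXS X, ALL n, n in X <-> p]; [shiftS] keeps [X] out of [p]. *)
Definition comprehension (p : form) : form :=
  ExistsS (ForallN (Iff (FMem (TVar 0) 0) (shiftS p))).

Inductive RCA0 : form -> Prop :=
| RCA0_basic p : In p basic_axioms -> RCA0 p
| RCA0_induction p : Sigma01 p -> RCA0 (induction p)
| RCA0_comprehension p q : Sigma01 p -> Pi01 q ->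
    RCA0 (Imp (ForallN (Iff p q)) (comprehension p)).

Inductive ACA0 : form -> Prop :=
| ACA0_RCA0 p : RCA0 p -> ACA0 p
| ACA0_comprehension p : arithmetical p -> ACA0 (comprehension p).

(** * Pairs, functions and powers of two *)

Definition npair (x y : nexp) : nexp := (x + y) * (x + y) + x.

Notation "<( x , y )>" := (npair x y) (at level 0) : so_scope.

Definition isN (_ : nexp) : fexp := 0 = 0.

(** [F] is (the graph of) a function from [P] to [Q]. *)
Definition isFun (F : sexp) (P Q : nexp -> fexp) : fexp :=
  (ALL z, z \in F =>> EX x y, P x /\ Q y /\ z = <(x, y)>) /\
  (ALL x, P x =>>
     EX y, <(x, y)> \in F /\ ALL y', <(x, y')> \in F =>> y' = y).

(** [2 ^ k = y], through the function defined by primitive recursion. *)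
Definition pow2 (k y : nexp) : fexp :=
  EXS E, isFun E isN isN /\ <(0, 1)> \in E /\
    (ALL n m, <(n, m)> \in E =>> <(n + 1, m + m)> \in E) /\
    <(k, y)> \in E.

(** * Rationals *)

(** [Rat p n d] stands for [(p - n) / d]; it is only used with [d > 0].  Codes
    are not required to be in lowest terms, so equality of rationals is [qeq],
    not equality of codes. *)
Record rat : Type := Rat { rpos : nexp; rneg : nexp; rden : nexp }.

Definition qcode (q : rat) : nexp := <( <(rpos q, rneg q)>, rden q )>.

Definition allQ (f : rat -> fexp) : fexp :=
  ALL p n d, 0 < d =>> f (Rat p n d).
Definition exQ (f : rat -> fexp) : fexp :=
  EX p n d, 0 < d /\ f (Rat p n d).

Definition qpos (q : rat) : fexp := rneg q < rpos q.

Definition allQp (f : rat -> fexp) : fexp := allQ (fun q => qpos q =>> f q).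
Definition exQp (f : rat -> fexp) : fexp := exQ (fun q => qpos q /\ f q).

Notation "'ALLQ' x .. y , p" := (allQ (fun x => .. (allQ (fun y => p)) ..))
  (at level 200, x binder, y binder, right associativity) : so_scope.
Notation "'EXQ' x .. y , p" := (exQ (fun x => .. (exQ (fun y => p)) ..))
  (at level 200, x binder, y binder, right associativity) : so_scope.
Notation "'ALLQp' x .. y , p" := (allQp (fun x => .. (allQp (fun y => p)) ..))
  (at level 200, x binder, y binder, right associativity) : so_scope.
Notation "'EXQp' x .. y , p" := (exQp (fun x => .. (exQp (fun y => p)) ..))
  (at level 200, x binder, y binder, right associativity) : so_scope.

Definition isQ (c : nexp) : fexp := EXQ q, c = qcode q.

Definition qadd (q r : rat) : rat :=
  Rat (rpos q * rden r + rpos r * rden q)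
      (rneg q * rden r + rneg r * rden q)
      (rden q * rden r).
Definition qlt (q r : rat) : fexp :=
  rpos q * rden r + rneg r * rden q < rpos r * rden q + rneg q * rden r.
Definition qeq (q r : rat) : fexp :=
  rpos q * rden r + rneg r * rden q = rpos r * rden q + rneg q * rden r.
Definition qle (q r : rat) : fexp := ~ qlt r q.

Definition q0 : rat := Rat 0 0 1.

(** [f (2 ^ -k)]. *)
Definition with_hpow (k : nexp) (f : rat -> fexp) : fexp :=
  EX y, pow2 k y /\ f (Rat 1 0 y).

(** * Reals *)

(** A real is given by its approximations: [x k q] says that [q] is the k-th
    rational of the sequence, which lies within [2 ^ -k] of [x].  Reals that
    are quantified over are sets, via [rset]; the others are expressions. *)
Definition real : Type := nexp -> rat -> fexp.

Definition rset (R : sexp) : real := fun k q => <(k, qcode q)> \in R.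
Definition rrat (r : rat) : real := fun _ q => qeq q r.
Definition rhpow (n : nexp) : real := fun _ q => with_hpow n (qeq q).
Definition radd (x y : real) : real := fun k q =>
  EXQ u v, x (k + 1) u /\ y (k + 1) v /\ qeq q (qadd u v).

Definition rlt (x y : real) : fexp :=
  EX k, EXQ q r, x k q /\ y k r /\
    with_hpow k (fun e => qlt (qadd q (qadd e e)) r).
Definition rle (x y : real) : fexp := ~ rlt y x.
Definition req (x y : real) : fexp := rle x y /\ rle y x.

Definition rapid (x : real) : fexp :=
  ALL k i, ALLQ q r, x k q /\ x (k + i) r =>>
    with_hpow k (fun e => qle q (qadd r e) /\ qle r (qadd q e)).

Definition isReal (R : sexp) : fexp := isFun R isN isQ /\ rapid (rset R).
Definition isRealPos (R : sexp) : fexp := isReal R /\ rlt (rrat q0) (rset R).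

(** * Complete separable metric spaces *)

(** [dist] codes [d : A * A -> R] as a function sending [((a, b), k)] to the
    k-th approximation of [d (a, b)]. *)
Record space : Type := Space { carrier : sexp; dist : sexp }.

Definition dA (M : space) (a b : nexp) : real := fun k q =>
  <( <( <(a, b)>, k )>, qcode q )> \in dist M.

Definition isSpace (M : space) : fexp :=
  isFun (dist M)
    (fun z => EX a b k, a \in carrier M /\ b \in carrier M /\
                z = <( <(a, b)>, k )>)
    isQ /\
  (ALL a b, a \in carrier M /\ b \in carrier M =>>
     rapid (dA M a b) /\
     req (dA M a a) (rrat q0) /\
     req (dA M a b) (dA M b a) /\
     rle (rrat q0) (dA M a b) /\
     ALL c, c \in carrier M =>>
       rle (dA M a b) (radd (dA M a c) (dA M c b))).

(** A point, as the predicate "the n-th term of the sequence is [a]". *)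
Definition point : Type := nexp -> nexp -> fexp.

Definition pset (X : sexp) : point := fun n a => <(n, a)> \in X.
Definition pconst (b : nexp) : point := fun _ a => a = b.

Definition isPoint (M : space) (X : sexp) : fexp :=
  isFun X isN (fun a => a \in carrier M) /\
  ALL n a b, <(n, a)> \in X /\ <(n + 1, b)> \in X =>>
    rlt (dA M a b) (rhpow n).

(** [d (x, y)] is the limit of [d (x_n, y_n)].  Since [d (x_n, x_(n+1))] and
    [d (y_n, y_(n+1))] are below [2 ^ -n], the n-th approximation of
    [d (x_n, y_n)] is within [2 ^ -n + 4 * 2 ^ -n] of the limit; reading
    it at [n = k + 3] makes the error, and the distance to any later term, less
    than [2 ^ -k]. *)
Definition dP (M : space) (x y : point) : real := fun k q =>
  EX a b, x (k + 3) a /\ y (k + 3) b /\ dA M a b (k + 3) q.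

Definition allP (M : space) (f : point -> fexp) : fexp :=
  ALLS X, isPoint M X =>> f (pset X).

(** * Open coverings and Lebesgue spaces *)

(** [U] codes a sequence of open sets: it sends [(n, m)] to the centre and
    radius [(a, q)] of the m-th ball of the n-th open set. *)
Definition isOpenSeq (M : space) (U : sexp) : fexp :=
  isFun U (fun z => EX n m, z = <(n, m)>)
    (fun w => EX a, EXQp q, a \in carrier M /\ w = <(a, qcode q)>).

Definition inOpen (M : space) (U : sexp) (n : nexp) (x : point) : fexp :=
  EX m a, EXQp q, <( <(n, m)>, <(a, qcode q)> )> \in U /\
    rlt (dP M x (pconst a)) (rrat q).

Definition isOpenCovering (M : space) (U : sexp) : fexp :=
  isOpenSeq M U /\ allP M (fun x => EX n, inOpen M U n x).

Definition Lebesgue (M : space) : fexp :=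
  ALLS U, isOpenCovering M U =>>
    EXS R, isRealPos R /\
      allP M (fun x => EX n, allP M (fun y =>
        rlt (dP M x y) (rset R) =>> inOpen M U n y)).

(** * Continuous functions and Atsuji spaces *)

Definition ftuple (n a : nexp) (r : rat) (b : nexp) (s : rat) : nexp :=
  <( n, <( <(a, qcode r)>, <(b, qcode s)> )> )>.

(** [(a, r) F (b, s)]. *)
Definition frel (F : sexp) (a : nexp) (r : rat) (b : nexp) (s : rat) : fexp :=
  EX n, ftuple n a r b s \in F.

Definition isContinuous (M N : space) (F : sexp) : fexp :=
  (ALL z, z \in F =>> EX n a, EXQp r, EX b, EXQp s,
     a \in carrier M /\ b \in carrier N /\ z = ftuple n a r b s) /\
  (ALL a, ALLQp r, ALL b, ALLQp s, ALL b', ALLQp s',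
     frel F a r b s /\ frel F a r b' s' =>>
     rlt (dA N b b') (rrat (qadd s s'))) /\
  (ALL a, ALLQp r, ALL b, ALLQp s, ALL b', ALLQp s',
     b' \in carrier N /\ frel F a r b s /\
     rle (radd (dA N b b') (rrat s)) (rrat s') =>> frel F a r b' s') /\
  (ALL a, ALLQp r, ALL b, ALLQp s, ALL a', ALLQp r',
     a' \in carrier M /\ frel F a r b s /\
     rle (radd (dA M a a') (rrat r')) (rrat r) =>> frel F a' r' b s) /\
  allP M (fun x => ALLQp q, EX a, EXQp r, EX b, EXQp s,
     frel F a r b s /\ rlt (dP M x (pconst a)) (rrat r) /\ qlt s q).

(** [f (x) = y] for the function [f] coded by [F]. *)
Definition isValue (M N : space) (F : sexp) (x y : point) : fexp :=
  ALL a, ALLQp r, ALL b, ALLQp s,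
    frel F a r b s /\ rlt (dP M x (pconst a)) (rrat r) =>>
    rlt (dP N y (pconst b)) (rrat s).

(** Values of [f] are quantified universally.  Some codes have a point [x] for
    which the conditions on [f (x)] hold only with [<=] in place of [<], so that
    no [f (x)] exists; a conclusion asserting its existence would make
    [Atsuji] fail because of such codes alone. *)
Definition isUniformlyContinuous (M N : space) (F : sexp) : fexp :=
  ALLS E, isRealPos E =>>
    EXS D, isRealPos D /\
      allP M (fun x => allP M (fun y =>
        rlt (dP M x y) (rset D) =>>
        allP N (fun u => allP N (fun v =>
          isValue M N F x u /\ isValue M N F y v =>>
          rlt (dP N u v) (rset E))))).

Definition Atsuji (M : space) : fexp :=
  ALLS B DB, isSpace (Space B DB) =>>
    ALLS F, isContinuous M (Space B DB) F =>>
      isUniformlyContinuous M (Space B DB) F.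

Definition Atsuji_implies_Lebesgue : form :=
  closed (ALLS A D, isSpace (Space A D) =>>
    Atsuji (Space A D) =>> Lebesgue (Space A D)).

(* Main.v *)
(** By completeness of the deductive system it is enough to argue in a model of
    ACA0, whose rationals form an ordered field.  Let the open sets [U_n] of a
    covering be unions of balls [B(a_nm, q_nm)], and put
      phi_n(x) = sup_m min(1, max(0, q_nm - d(x, a_nm))),   phi = sup_n phi_n,
      F_n = phi_n / phi,   d'(x, y) = sup_n |F_n(x) - F_n(y)|.
    The functions [phi_n] are 1-Lipschitz and [phi_n] is positive exactly on
    [U_n]; so [phi > 0], and near [x] the pseudo-metric [d'] is bounded by a
    multiple of [d].  Hence the identity of [A] codes a continuous function from
    the completion of [(A, d)] to that of [(A, d')].  Let [delta] witness its
    uniform continuity for [1/2].  As [sup_n F_n(x) = 1], some [n] has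
    [F_n(x) > 1/2 + 1/4]; if [d(x, y) < delta] then [F_n(y) > 0], that is,
    [y] lies in [U_n].  So [delta] is a Lebesgue number.  All this is
    arithmetical in the covering, as only the values of [d'] on [A] are used. *)

From mathcomp Require Import ssreflect ssrfun ssrbool.
From mathcomp Require Import boolp.
From Stdlib Require Import List PeanoNat Lia Ring Cantor.
Require Import Defs.

(** * Completeness *)

(** A model is preferred to explicit derivations because its rationals form an ordered field of
    Rocq, where [lra] applies. The price is that the model may be nonstandard: induction, least
    elements and set formation are available for arithmetical predicates only, so every use of them
    carries a certificate [Ar], [Af] or [tQ], found by the tactic [ar]. Nor is the field complete,
    and suprema such as [phi] need not exist in it. They are never formed: a supremum is given by
    its strict lower cut, which an existential quantifier over numbers defines, and an upper bound
    is the negation of that cut. Truncation at 1 keeps the supremum over [n] finite. The other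
    obstacle is strictness. A value of a coded function must satisfy strict inequalities, and
    uniform continuity speaks only of values that exist; for a careless code it could be empty at
    some points. The code of the identity is therefore built with room to spare, and the same room
    is what survives each passage from the terms of a sequence to its limit. *)

Lemma tsubst_comp sg sg' t :
  tsubst sg' (tsubst sg t) = tsubst (fun n => tsubst sg' (sg n)) t.
Proof. by elim: t => //= s -> t ->. Qed.

Lemma tsubst_id t : tsubst TVar t = t.
Proof. by elim: t => //= s -> t ->. Qed.

Lemma upN_comp sg sg' :
  (fun n => tsubst (upN sg') (upN sg n)) = upN (fun n => tsubst sg' (sg n)).
Proof. by apply: funext => -[|n] //=; rewrite /tshift !tsubst_comp. Qed.

Lemma upS_comp rh rh' : (fun n => upS rh' (upS rh n)) = upS (fun n => rh' (rh n)).
Proof. by apply: funext => -[|n]. Qed.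

Lemma upN_id : upN TVar = TVar.
Proof. by apply: funext => -[|n]. Qed.

Lemma upS_id : upS (fun X => X) = (fun X => X).
Proof. by apply: funext => -[|n]. Qed.

Lemma subst_comp p : forall sg rh sg' rh',
  subst sg' rh' (subst sg rh p) =
  subst (fun n => tsubst sg' (sg n)) (fun X => rh' (rh X)) p.
Proof.
elim: p => //=; intros; rewrite ?tsubst_comp ?H ?H0 //.
- by rewrite upN_comp.
- by rewrite upS_comp.
Qed.

Lemma subst_id p : subst TVar (fun X => X) p = p.
Proof. by elim: p => //=; intros; rewrite ?tsubst_id ?upN_id ?upS_id ?H ?H0. Qed.

Lemma subst_shiftN sg rh p :
  subst (upN sg) rh (shiftN p) = shiftN (subst sg rh p).
Proof. by rewrite /shiftN !subst_comp. Qed.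

Lemma subst_shiftS sg rh p :
  subst sg (upS rh) (shiftS p) = shiftS (subst sg rh p).
Proof. by rewrite /shiftS !subst_comp; congr subst; apply: funext => n; rewrite tsubst_id. Qed.

Lemma subst_instN sg rh t p :
  subst sg rh (instN t p) = instN (tsubst sg t) (subst (upN sg) rh p).
Proof.
rewrite /instN !subst_comp; congr subst; apply: funext => -[|n] //=.
by rewrite /tshift tsubst_comp tsubst_id.
Qed.

Lemma subst_instS sg rh Y p :
  subst sg rh (instS Y p) = instS (rh Y) (subst sg (upS rh) p).
Proof.
rewrite /instS !subst_comp; congr subst.
  by apply: funext => n /=; rewrite tsubst_id.
by apply: funext => -[|n].
Qed.

(** A derivation can be renamed only if its axioms can. Asking this of the theory allows axioms with
    free variables, such as the instances of schemes with parameters. *)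
Definition subst_closed (T : form -> Prop) :=
  forall p sg rh, T p -> T (subst sg rh p).

(** * Derivations and fresh variables *)

Section Henkin.
Variables (T : form -> Prop) (HT : subst_closed T).

Lemma prv_weak G p : prv T G p -> forall H, incl G H -> prv T H p.
Proof.
elim=> {G p}.
- by move=> *; apply: Ax.
- by move=> G p hp H hi; apply: Hyp; apply: hi.
- move=> G p q _ IH H hi; apply: Imp_I; apply: IH => r [->|hr]; first by left.
  by right; apply: hi.
- by move=> G p q _ IH1 _ IH2 H hi; apply: (Imp_E _ _ p); [apply: IH1|apply: IH2].
- by move=> G p _ IH H hi; apply: DN; apply: IH.
- by move=> G p _ IH H hi; apply: ForallN_I; apply: IH; apply: incl_map.
- by move=> G p t _ IH H hi; apply: ForallN_E; apply: IH.
- by move=> G p _ IH H hi; apply: ForallS_I; apply: IH; apply: incl_map.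
- by move=> G p Y _ IH H hi; apply: ForallS_E; apply: IH.
- by move=> *; apply: Eq_I.
- by move=> G p s t _ IH1 _ IH2 H hi; apply: (Eq_E _ _ _ s); [apply: IH1|apply: IH2].
Qed.

Lemma prv_subst G p : prv T G p ->
  forall sg rh, prv T (map (subst sg rh) G) (subst sg rh p).
Proof.
elim=> {G p}.
- by move=> G p hp sg rh; apply: Ax; apply: HT.
- by move=> G p hp sg rh; apply: Hyp; apply: in_map.
- by move=> G p q _ IH sg rh; apply: Imp_I; apply: IH.
- move=> G p q _ IH1 _ IH2 sg rh.
  by apply: (Imp_E _ _ (subst sg rh p)); [apply: IH1|apply: IH2].
- by move=> G p _ IH sg rh; apply: DN; apply: (IH sg rh).
- move=> G p _ IH sg rh; apply: ForallN_I; have := IH (upN sg) rh.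
  by rewrite !map_map; under map_ext do rewrite subst_shiftN.
- by move=> G p t _ IH sg rh; rewrite subst_instN; apply: ForallN_E; apply: IH.
- move=> G p _ IH sg rh; apply: ForallS_I; have := IH sg (upS rh).
  by rewrite !map_map; under map_ext do rewrite subst_shiftS.
- by move=> G p Y _ IH sg rh; rewrite subst_instS; apply: ForallS_E; apply: IH.
- by move=> *; apply: Eq_I.
- move=> G p s t _ IH1 _ IH2 sg rh; rewrite subst_instN.
  apply: (Eq_E _ _ _ (tsubst sg s)); first exact: (IH1 sg rh).
  by rewrite -subst_instN; apply: IH2.
Qed.

Lemma tsubst_finite t : exists n, forall sg sg',
  (forall i, i < n -> sg i = sg' i) -> tsubst sg t = tsubst sg' t.
Proof.
elim: t => /=.
- by move=> n; exists (S n) => sg sg' h; apply: h; lia.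
- by exists 0.
- by exists 0.
- move=> s [n hn] t [m hm]; exists (n + m) => sg sg' h.
  by rewrite (hn sg sg') ?(hm sg sg') // => i hi; apply: h; lia.
- move=> s [n hn] t [m hm]; exists (n + m) => sg sg' h.
  by rewrite (hn sg sg') ?(hm sg sg') // => i hi; apply: h; lia.
Qed.

(* Stating freshness through substitutions that agree below [n] avoids a
   definition of free variables. *)
Lemma subst_finite p : exists n, forall sg sg' rh rh',
  (forall i, i < n -> sg i = sg' i) -> (forall i, i < n -> rh i = rh' i) ->
  subst sg rh p = subst sg' rh' p.
Proof.
elim: p => /=.
- move=> s t; have [n hn] := tsubst_finite s; have [m hm] := tsubst_finite t.
  exists (n + m) => sg sg' rh rh' h _.
  by rewrite (hn sg sg') ?(hm sg sg') // => i hi; apply: h; lia.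
- move=> s t; have [n hn] := tsubst_finite s; have [m hm] := tsubst_finite t.
  exists (n + m) => sg sg' rh rh' h _.
  by rewrite (hn sg sg') ?(hm sg sg') // => i hi; apply: h; lia.
- move=> t X; have [n hn] := tsubst_finite t; exists (n + S X) => sg sg' rh rh' h h'.
  by rewrite (hn sg sg') ?h' // => [|i hi]; [lia|apply: h; lia].
- by exists 0.
- move=> p [n hn] q [m hm]; exists (n + m) => sg sg' rh rh' h h'.
  by rewrite (hn sg sg' rh rh') ?(hm sg sg' rh rh') // => i hi;
     (apply: h || apply: h'); lia.
- move=> p [n hn]; exists n => sg sg' rh rh' h h'.
  rewrite (hn (upN sg) (upN sg') rh rh') // => -[|i] //= hi.
  by rewrite h //; lia.
- move=> p [n hn]; exists n => sg sg' rh rh' h h'.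
  rewrite (hn sg sg' (upS rh) (upS rh')) // => -[|i] //= hi.
  by rewrite h' //; lia.
Qed.

Lemma subst_finite_ctx G : exists n, forall p, In p G -> forall sg sg' rh rh',
  (forall i, i < n -> sg i = sg' i) -> (forall i, i < n -> rh i = rh' i) ->
  subst sg rh p = subst sg' rh' p.
Proof.
elim: G => [|q G [n hn]]; first by exists 0.
have [m hm] := subst_finite q; exists (n + m) => p [<-|hp] sg sg' rh rh' h h'.
  by apply: hm => i hi; (apply: h || apply: h'); lia.
by apply: hn => // i hi; (apply: h || apply: h'); lia.
Qed.

Definition inconsistent G := prv T G Bot.

Lemma prv_hd G p : prv T (p :: G) p.
Proof. by apply: Hyp; left. Qed.

Lemma prv_wk G p q : prv T G p -> prv T (q :: G) p.
Proof. by move=> h; apply: prv_weak h _ _ => r; right. Qed.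

Lemma prv_bot G p : prv T G Bot -> prv T G p.
Proof. by move=> h; apply: DN; apply: Imp_I; apply: prv_wk. Qed.

(** For [x] fresh, refuting [Not (instN (TVar x) p)] from [G] proves [p] of an arbitrary number.
    Hence a consistent context containing [Not (ForallN p)] stays consistent when the counterexample
    [x] is added. *)
Lemma witnessN G p : exists x, inconsistent (Not (instN (TVar x) p) :: G) ->
  prv T G (ForallN p).
Proof.
have [n hn] := subst_finite_ctx (ForallN p :: G).
exists n => h.
have {h} h : prv T G (instN (TVar n) p) by apply: DN; apply: Imp_I.
apply: ForallN_I.
(* [sg] turns the fresh variable into the one to be bound and acts as the shift on the variables
   below [n], so it sends [G] to the context of [ForallN_I]. *)
pose sg i := if Nat.eqb i n then TVar 0 else TVar (S i).
have hsg i : i < n -> sg i = TVar (S i).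
  by move=> hi; rewrite /sg; case: Nat.eqb_spec => // e; lia.
have := prv_subst _ _ h sg (fun X => X).
rewrite subst_instN /= {2}/sg Nat.eqb_refl.
have -> : map (subst sg (fun X => X)) G = map shiftN G.
  by apply: map_ext_in => q hq; apply: hn => //; right.
(* Freshness was arranged for [ForallN p] as a whole; injectivity of the constructor hands it to the
   body. *)
have [->] : subst sg (fun X => X) (ForallN p) = subst (fun i => TVar (S i)) (fun X => X) (ForallN p).
  by apply: hn => //; left.
rewrite /instN subst_comp.
set s := fun _ => _; have -> : s = TVar by apply: funext => -[|i].
by rewrite subst_id.
Qed.

Lemma witnessS G p : exists Y, inconsistent (Not (instS Y p) :: G) ->
  prv T G (ForallS p).
Proof.
have [n hn] := subst_finite_ctx (ForallS p :: G).
exists n => h.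
have {h} h : prv T G (instS n p) by apply: DN; apply: Imp_I.
apply: ForallS_I.
pose rh i := if Nat.eqb i n then 0 else S i.
have hrh i : i < n -> rh i = S i.
  by move=> hi; rewrite /rh; case: Nat.eqb_spec => // e; lia.
have := prv_subst _ _ h TVar rh.
rewrite subst_instS /= {2}/rh Nat.eqb_refl.
have -> : map (subst TVar rh) G = map shiftS G.
  by apply: map_ext_in => q hq; apply: hn => //; right.
have [->] : subst TVar rh (ForallS p) = subst TVar S (ForallS p).
  by apply: hn => //; left.
rewrite /instS subst_comp (_ : subst _ _ p = p) // -[RHS]subst_id.
by congr subst; apply: funext => -[|i].
Qed.

(** * Numbering of formulas and the maximal Henkin theory *)

Lemma to_nat_inj a b c d : to_nat (a, b) = to_nat (c, d) -> a = c /\ b = d.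
Proof. by move/to_nat_inj => [-> ->]. Qed.

Fixpoint tcode t :=
  match t with
  | TVar n => to_nat (0, n)
  | TZero => to_nat (1, 0)
  | TOne => to_nat (2, 0)
  | TAdd s t => to_nat (3, to_nat (tcode s, tcode t))
  | TMul s t => to_nat (4, to_nat (tcode s, tcode t))
  end.

Fixpoint fcode p :=
  match p with
  | FEq s t => to_nat (0, to_nat (tcode s, tcode t))
  | FLt s t => to_nat (1, to_nat (tcode s, tcode t))
  | FMem t X => to_nat (2, to_nat (tcode t, X))
  | Bot => to_nat (3, 0)
  | Imp p q => to_nat (4, to_nat (fcode p, fcode q))
  | ForallN p => to_nat (5, fcode p)
  | ForallS p => to_nat (6, fcode p)
  end.

Lemma tcode_inj s : forall t, tcode s = tcode t -> s = t.
Proof.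
elim: s => [n|||s1 IH1 s2 IH2|s1 IH1 s2 IH2] [m|||t1 t2|t1 t2];
  cbn [tcode] => /to_nat_inj [e] //; first by move=> ->.
- by move=> /to_nat_inj [/IH1 -> /IH2 ->].
- by move=> /to_nat_inj [/IH1 -> /IH2 ->].
Qed.

Lemma fcode_inj p : forall q, fcode p = fcode q -> p = q.
Proof.
elim: p => [s t|s t|t X||p1 IH1 p2 IH2|p IH|p IH]
           [s' t'|s' t'|t' X'||q1 q2|q|q];
  cbn [fcode] => /to_nat_inj [e] //.
- by move=> /to_nat_inj [/tcode_inj -> /tcode_inj ->].
- by move=> /to_nat_inj [/tcode_inj -> /tcode_inj ->].
- by move=> /to_nat_inj [/tcode_inj -> ->].
- by move=> /to_nat_inj [/IH1 -> /IH2 ->].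
- by move=> /IH ->.
- by move=> /IH ->.
Qed.

Lemma form_enum : exists en : nat -> form, forall p, exists n, en n = p.
Proof.
have /choice [en hen] : forall n, exists p, (exists q, fcode q = n) -> fcode p = n.
  move=> n; have [[q hq]|h] := pselect (exists q, fcode q = n); first by exists q.
  by exists Bot.
by exists en => p; exists (fcode p); apply: fcode_inj; apply: hen; exists p.
Qed.

(** One stage of Henkin's construction. Free variables serve as the Henkin constants: contexts are
    finite lists, so a fresh variable always exists, and those of the axioms do not count, as
    generalisation puts no condition on axioms. *)
Definition henkin G H p := [/\ incl G H, ~ inconsistent H &
  (In p H \/ inconsistent (p :: G)) /\
  (In p H -> (forall q, p = Not (ForallN q) -> exists t, In (Not (instN t q)) H) /\
             (forall q, p = Not (ForallS q) -> exists Y, In (Not (instS Y q)) H))].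

Lemma henkin_step G p : ~ inconsistent G -> exists H, henkin G H p.
Proof.
move=> hG; have [hc|hc] := pselect (inconsistent (p :: G)).
  have [hp|hp] := pselect (In p G).
    by case: hG; apply: prv_weak hc _ _ => r [<-|].
  by exists G; split; [exact: incl_refl|exact: hG|split; [by right|by move=> /hp]].
have [[q hq]|hq] := pselect (exists q, p = Not (ForallN q)).
  have [x hx] := witnessN (p :: G) q; exists (Not (instN (TVar x) q) :: p :: G).
  split; first by move=> r h; right; right.
    move=> h; apply: hc; apply: (Imp_E _ _ _ _ _ (hx h)).
    by rewrite hq; apply: prv_hd.
  split; first by left; right; left.
  move=> _; split=> q'; rewrite hq // => -[<-]; exists (TVar x); by left.
have [[q' hq']|hq'] := pselect (exists q, p = Not (ForallS q)).
  have [x hx] := witnessS (p :: G) q'; exists (Not (instS x q') :: p :: G).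
  split; first by move=> r h; right; right.
    move=> h; apply: hc; apply: (Imp_E _ _ _ _ _ (hx h)).
    by rewrite hq'; apply: prv_hd.
  split; first by left; right; left.
  move=> _; split=> q; rewrite hq' // => -[<-]; exists x; by left.
exists (p :: G); split=> //; first by move=> r h; right.
split; first by left; left.
by move=> _; split=> q e; [case: hq; exists q | case: hq'; exists q].
Qed.

Section Completion.
Variables (G0 : list form) (hG0 : ~ inconsistent G0).

Lemma henkin_chain : exists (G : nat -> list form) (en : nat -> form),
  [/\ G 0 = G0, (forall p, exists n, en n = p), (forall n, ~ inconsistent (G n)) &
   forall n, henkin (G n) (G (S n)) (en n)].
Proof.
have [en hen] := form_enum.
have /choice [st hst] : forall Gn : list form * nat, exists H,
    ~ inconsistent Gn.1 -> henkin Gn.1 H (en Gn.2).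
  move=> [G n]; have [h|h] := pselect (inconsistent G); first by exists nil.
  by have [H hH] := henkin_step G (en n) h; exists H.
have [G [h0 hS]] : exists G, G 0 = G0 /\ forall n, G (S n) = st (G n, n).
  by exists (nat_rect _ G0 (fun n H => st (H, n))).
have hG n : ~ inconsistent (G n).
  by elim: n => [|n IH]; [rewrite h0 | rewrite hS; have [] := hst (G n, n) IH].
exists G, en; split=> // n; rewrite hS.
exact: hst (G n, n) (hG n).
Qed.

Lemma henkin_theory : exists Th : form -> Prop,
  [/\ (forall G p, prv T G p -> (forall q, In q G -> Th q) -> Th p),
      (forall p, In p G0 -> Th p), ~ Th Bot,
      (forall p, Th p \/ Th (Not p)) &
      (forall p, Th (Not (ForallN p)) -> exists t, Th (Not (instN t p))) /\
      (forall p, Th (Not (ForallS p)) -> exists Y, Th (Not (instS Y p)))].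
Proof.
have [G [en [hG00 hen hcons hst]]] := henkin_chain.
have mono n m : n <= m -> incl (G n) (G m).
  elim => [|{}m _ IH] p; first by [].
  by have [h _ _] := hst m => /IH /h.
pose Th p := exists n, prv T (G n) p.
(* A consequence of some stage is consistent with every stage, so it is not refuted at the stage
   that considers it and is added there. *)
have hTh p : Th p -> exists n, In p (G n).
  move=> [n hn]; have [m hm] := hen p.
  have [h hc [h2 _]] := hst m; rewrite hm in h2.
  case: h2 => h2; first by exists (S m).
  case: (hcons (n + m)); apply: (Imp_E _ _ p).
    by apply: prv_weak (Imp_I _ _ _ _ h2) _ _; apply: mono; lia.
  by apply: prv_weak hn _ _; apply: mono; lia.
have ded H p : prv T H p -> (forall q, In q H -> Th q) -> Th p.
  move=> hp hq; have [n hn] : exists n, incl H (G n).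
    elim: H hq {hp} => [|r H IH] hq; first by exists 0 => q [].
    have [|n hn] := IH; first by move=> q h; apply: hq; right.
    have [|m hm] := hTh r; first by apply: hq; left.
    exists (n + m) => q [<-|/hn h]; first by apply: (mono m) hm; lia.
    by apply: (mono n) h; lia.
  by exists n; apply: prv_weak hp _ hn.
(* Membership in some stage is not enough: a witness for [p] is supplied only at the stage that
   enumerates [p]. *)
have stage p : Th p -> exists n, en n = p /\ In p (G (S n)).
  move=> hp; have [m hm] := hen p; exists m; split=> //.
  have [h hc [h2 _]] := hst m; rewrite hm in h2; case: h2 => // h2.
  have [n hn] := hTh _ hp; case: (hcons (n + m)); apply: (Imp_E _ _ p).
    by apply: prv_weak (Imp_I _ _ _ _ h2) _ _; apply: mono; lia.
  by apply: Hyp; apply: (mono n) hn; lia.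
exists Th; split=> //.
- by move=> p hp; exists 0; apply: Hyp; rewrite hG00.
- by move=> [n]; apply: hcons.
- move=> p; have [m hm] := hen p; have [h hc [h2 _]] := hst m.
  rewrite hm in h2; case: h2 => h2.
    by left; exists (S m); apply: Hyp.
  by right; exists m; apply: Imp_I.
- split=> p /stage [n [e hn]]; have [_ _ [_ h]] := hst n; rewrite e in h.
    have [/(_ p erefl) [t ht] _] := h hn.
    by exists t; exists (S n); apply: Hyp.
  have [_ /(_ p erefl) [t ht]] := h hn.
  by exists t; exists (S n); apply: Hyp.
Qed.

End Completion.
End Henkin.

(** * Structures with an arbitrary sort of sets, and the term model *)

Record structure := Structure {
  num : Type; set : Type;
  zer : num; one : num;
  add : num -> num -> num; mul : num -> num -> num;
  lt : num -> num -> Prop; mem : num -> set -> Prop }.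

Fixpoint teval (M : structure) (e : nat -> num M) (t : term) : num M :=
  match t with
  | TVar n => e n
  | TZero => zer M
  | TOne => one M
  | TAdd s t => add M (teval M e s) (teval M e t)
  | TMul s t => mul M (teval M e s) (teval M e t)
  end.

Fixpoint eval (M : structure) (e : nat -> num M) (r : nat -> set M) (p : form) : Prop :=
  match p with
  | FEq s t => teval M e s = teval M e t
  | FLt s t => lt M (teval M e s) (teval M e t)
  | FMem t X => mem M (teval M e t) (r X)
  | Bot => False
  | Imp p q => eval M e r p -> eval M e r q
  | ForallN p => forall x, eval M (scons x e) r p
  | ForallS p => forall X, eval M e (scons X r) p
  end.

Definition model (T : form -> Prop) (M : structure) :=
  forall p e r, T p -> eval M e r p.

Section TermModel.
Variables (T : form -> Prop) (HT : subst_closed T).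
Variable Th : form -> Prop.
Hypothesis Th_ded : forall G p, prv T G p -> (forall q, In q G -> Th q) -> Th p.
Hypothesis Th_cons : ~ Th Bot.
Hypothesis Th_max : forall p, Th p \/ Th (Not p).
Hypothesis Th_witN : forall p, Th (Not (ForallN p)) -> exists t, Th (Not (instN t p)).
Hypothesis Th_witS : forall p, Th (Not (ForallS p)) -> exists Y, Th (Not (instS Y p)).

Lemma Th_prv p : prv T nil p -> Th p.
Proof. by move=> h; apply: Th_ded h _. Qed.

Lemma Th_mp p q : Th (Imp p q) -> Th p -> Th q.
Proof.
move=> h1 h2; apply: (Th_ded (Imp p q :: p :: nil)).
  by apply: (Imp_E _ _ p); apply: Hyp; [left|right; left].
by move=> r [<-|[<-|[]]].
Qed.

Lemma Th_not p : Th (Not p) <-> ~ Th p.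
Proof.
split=> [h1 h2|h]; first by apply: Th_cons; apply: Th_mp h1 h2.
by have [] := Th_max p.
Qed.

Lemma Th_imp p q : Th (Imp p q) <-> (Th p -> Th q).
Proof.
split; first exact: Th_mp.
move=> h; have [/h hq|/Th_not hp] := pselect (Th p).
  apply: (Th_ded (q :: nil)); last by move=> r [<-|[]].
  by apply: Imp_I; apply: Hyp; right; left.
apply: (Th_ded (Not p :: nil)); last by move=> r [<-|[]].
apply: Imp_I; apply: prv_bot; apply: (Imp_E _ _ p); apply: Hyp; first by right; left.
by left.
Qed.

Lemma Th_allN p : Th (ForallN p) <-> forall t, Th (instN t p).
Proof.
split=> [h t|h].
  apply: (Th_ded (ForallN p :: nil)); last by move=> r [<-|[]].
  by apply: ForallN_E; apply: Hyp; left.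
have [//|/Th_witN [t /Th_not]] := Th_max (ForallN p).
by have := h t.
Qed.

Lemma Th_allS p : Th (ForallS p) <-> forall Y, Th (instS Y p).
Proof.
split=> [h t|h].
  apply: (Th_ded (ForallS p :: nil)); last by move=> r [<-|[]].
  by apply: ForallS_E; apply: Hyp; left.
have [//|/Th_witS [t /Th_not]] := Th_max (ForallS p).
by have := h t.
Qed.

Lemma Th_eq_refl t : Th (FEq t t).
Proof. by apply: Th_prv; apply: Eq_I. Qed.

Lemma Th_rewrite p s t : Th (FEq s t) -> Th (instN s p) -> Th (instN t p).
Proof.
move=> h1 h2; apply: (Th_ded (FEq s t :: instN s p :: nil)).
  by apply: (Eq_E _ _ _ s); apply: Hyp; [left|right; left].
by move=> r [<-|[<-|[]]].
Qed.

Lemma instN_tshift s t : tsubst (scons s TVar) (tshift t) = t.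
Proof. by rewrite /tshift tsubst_comp tsubst_id. Qed.

Lemma Th_eq_sym s t : Th (FEq s t) -> Th (FEq t s).
Proof.
move=> h; have := Th_rewrite (FEq (TVar 0) (tshift s)) s t h.
by rewrite /instN /= !instN_tshift; apply; apply: Th_eq_refl.
Qed.

Lemma Th_eq_trans s t u : Th (FEq s t) -> Th (FEq t u) -> Th (FEq s u).
Proof.
move=> h h'; have := Th_rewrite (FEq (tshift s) (TVar 0)) t u h'.
by rewrite /instN /= !instN_tshift; apply.
Qed.

(** [eval] reads [FEq] as equality in Rocq, so terms that [Th] proves equal must become one number.
    A class is its predicate, and extensionality supplies the equations. The language has no
    equality of sets, so set variables stand for themselves. *)
Definition tclass t : term -> Prop := fun s => Th (FEq t s).

Lemma tclass_eq s t : tclass s = tclass t <-> Th (FEq s t).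
Proof.
split=> [h|h].
  have : tclass t t by exact: Th_eq_refl.
  by rewrite -h.
apply: funext => u; apply/propext; split=> h'.
  by apply: Th_eq_trans h'; apply: Th_eq_sym.
by apply: Th_eq_trans h'.
Qed.

Definition tnum := {c : term -> Prop | exists t, c = tclass t}.
Definition cls t : tnum := exist _ (tclass t) (ex_intro _ t erefl).
Definition rep (x : tnum) : term := sval (cid (svalP x)).

Lemma cls_rep x : cls (rep x) = x.
Proof.
rewrite /rep; case: cid => t /= ht; case: x ht => c hc /= ht.
by apply: eq_exist => /=.
Qed.

Lemma cls_eq s t : cls s = cls t <-> Th (FEq s t).
Proof.
rewrite -tclass_eq; split=> [[]//|h].
by apply: eq_exist.
Qed.

Lemma rep_cls t : Th (FEq (rep (cls t)) t).
Proof. by apply/cls_eq; rewrite cls_rep. Qed.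

Definition tmodel : structure := {|
  num := tnum; set := nat; zer := cls TZero; one := cls TOne;
  add := fun x y => cls (TAdd (rep x) (rep y));
  mul := fun x y => cls (TMul (rep x) (rep y));
  lt := fun x y => Th (FLt (rep x) (rep y));
  mem := fun x X => Th (FMem (rep x) X) |}.

Lemma Th_cong2 (c : term -> term -> form)
    (hc : forall s t sg, subst sg (fun X => X) (c s t) = c (tsubst sg s) (tsubst sg t)) s s' t t' :
  Th (FEq s s') -> Th (FEq t t') -> Th (c s t) -> Th (c s' t').
Proof.
move=> h1 h2 h.
have {}h : Th (c s' t).
  have := Th_rewrite (c (TVar 0) (tshift t)) s s' h1.
  by rewrite /instN !hc /= !instN_tshift; apply.
have := Th_rewrite (c (tshift s') (TVar 0)) t t' h2.
by rewrite /instN !hc /= !instN_tshift; apply.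
Qed.

Lemma teval_tmodel sg t : teval tmodel (fun n => cls (sg n)) t = cls (tsubst sg t).
Proof.
elim: t => //= s -> t ->; apply/cls_eq.
- set a := tsubst sg s; set b := tsubst sg t.
  apply: (Th_eq_trans _ (TAdd a (rep (cls b)))).
    have := Th_rewrite (FEq (TAdd (TVar 0) (tshift (rep (cls b)))) (tshift (TAdd a (rep (cls b)))))
       a (rep (cls a)).
    rewrite /instN /= !instN_tshift; apply; last exact: Th_eq_refl.
    by apply: Th_eq_sym; apply: rep_cls.
  have := Th_rewrite (FEq (TAdd (tshift a) (TVar 0)) (tshift (TAdd a b))) b (rep (cls b)).
  rewrite /instN /= !instN_tshift; apply; last exact: Th_eq_refl.
  by apply: Th_eq_sym; apply: rep_cls.
- set a := tsubst sg s; set b := tsubst sg t.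
  apply: (Th_eq_trans _ (TMul a (rep (cls b)))).
    have := Th_rewrite (FEq (TMul (TVar 0) (tshift (rep (cls b)))) (tshift (TMul a (rep (cls b)))))
       a (rep (cls a)).
    rewrite /instN /= !instN_tshift; apply; last exact: Th_eq_refl.
    by apply: Th_eq_sym; apply: rep_cls.
  have := Th_rewrite (FEq (TMul (tshift a) (TVar 0)) (tshift (TMul a b))) b (rep (cls b)).
  rewrite /instN /= !instN_tshift; apply; last exact: Th_eq_refl.
  by apply: Th_eq_sym; apply: rep_cls.
Qed.

Lemma scons_cls t (sg : nat -> term) : scons (cls t) (fun n => cls (sg n)) = fun n => cls (scons t sg n).
Proof. by apply: funext => -[|n]. Qed.

(** The truth lemma. It is stated for every substitution because a quantifier ranges over classes of
    terms, whose representatives are substituted for the bound variable. *)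
Lemma eval_tmodel p : forall sg rh,
  eval tmodel (fun n => cls (sg n)) rh p <-> Th (subst sg rh p).
Proof.
elim: p => [s t|s t|t X||p IHp q IHq|p IH|p IH] sg rh; cbn [eval subst];
  rewrite ?teval_tmodel.
- exact: cls_eq.
- split; apply: (Th_cong2 FLt) => //; try exact: rep_cls;
    by apply: Th_eq_sym; apply: rep_cls.
- split; apply: (Th_cong2 (fun x _ => FMem x (rh X)) _ _ _ TZero TZero) => //;
    try exact: Th_eq_refl; try exact: rep_cls; by apply: Th_eq_sym; apply: rep_cls.
- by split.
- by rewrite Th_imp IHp IHq.
- rewrite Th_allN; split=> h.
    move=> t; have := h (cls t); rewrite scons_cls IH /instN subst_comp.
    by congr (Th (subst _ _ _)); apply: funext => -[|n] //=; rewrite instN_tshift.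
  move=> x; have := h (rep x); rewrite -{2}(cls_rep x) scons_cls IH /instN subst_comp.
  by congr (Th (subst _ _ _)); apply: funext => -[|n] //=; rewrite instN_tshift.
- rewrite Th_allS; split=> h Y.
    have := h Y; rewrite IH /instS subst_comp.
    congr (Th (subst _ _ _)); apply: funext => n; rewrite ?tsubst_id //; by case: n.
  have := h Y; rewrite IH /instS subst_comp.
  congr (Th (subst _ _ _)); apply: funext => n; rewrite ?tsubst_id //; by case: n.
Qed.

End TermModel.

Theorem completeness T (HT : subst_closed T) p :
  (forall M, model T M -> forall e r, eval M e r p) -> proves T p.
Proof.
move=> h; have [//|hp] := pselect (proves T p); exfalso.
have [|Th [h1 h2 h3 h4 [h5 h6]]] := henkin_theory T HT (Not p :: nil).
  by move=> hi; apply: hp; apply: DN; apply: Imp_I.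
have ev : forall q sg rh, eval (tmodel Th) (fun n => cls Th (sg n)) rh q <-> Th (subst sg rh q).
  move=> q sg rh; exact: (@eval_tmodel T Th h1 h3 h4 h5 h6 q sg rh).
have hM : model T (tmodel Th).
  move=> q e r hq.
  (* An arbitrary valuation is a substitution by representatives, under which an axiom remains an
     axiom. *)
  have -> : e = fun n => cls Th (rep Th (e n)).
    by apply: funext => n; rewrite cls_rep.
  by apply/ev; apply: (h1 nil) => //; apply: Ax; apply: HT.
have := h _ hM (fun n => cls Th (TVar n)) (fun X => X).
move/ev; rewrite subst_id => hp'.
have hn : Th (Not p) by apply: h2; left.
by apply: h3; apply: (Th_mp _ _ h1 _ _ hn).
Qed.

(** * Satisfaction in a structure *)

Lemma tsubst_upN_tshift sg t : tsubst (upN sg) (tshift t) = tshift (tsubst sg t).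
Proof. by rewrite /tshift !tsubst_comp. Qed.

Lemma Delta00_subst p : Delta00 p -> forall sg rh, Delta00 (subst sg rh p).
Proof.
elim=> {p} /=; try by constructor.
- by move=> t p _ IH sg rh; rewrite tsubst_upN_tshift; apply: Delta00_All; apply: IH.
- by move=> t p _ IH sg rh; rewrite tsubst_upN_tshift; apply: Delta00_Ex; apply: IH.
Qed.

Lemma Sigma01_subst p : Sigma01 p -> forall sg rh, Sigma01 (subst sg rh p).
Proof. by case=> q hq sg rh; apply: (Sigma01_Ex (subst _ _ q)); apply: Delta00_subst. Qed.

Lemma Pi01_subst p : Pi01 p -> forall sg rh, Pi01 (subst sg rh p).
Proof. by case=> q hq sg rh; apply: (Pi01_All (subst _ _ q)); apply: Delta00_subst. Qed.

Lemma arithmetical_subst p : forall sg rh, arithmetical (subst sg rh p) = arithmetical p.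
Proof. by elim: p => //= p IHp q IHq sg rh; rewrite IHp IHq. Qed.

Lemma comprehension_subst sg rh p :
  subst sg rh (comprehension p) = comprehension (subst (upN sg) rh p).
Proof. by rewrite /comprehension /= subst_shiftS. Qed.

Lemma induction_subst sg rh p :
  subst sg rh (induction p) = induction (subst (upN sg) rh p).
Proof.
rewrite /induction /= subst_instN.
set succ := scons _ _.
have -> // : subst (upN sg) rh (subst succ (fun X => X) p) =
  subst succ (fun X => X) (subst (upN sg) rh p).
rewrite !subst_comp; congr subst; apply: funext => -[|n] //=.
by rewrite /tshift !tsubst_comp.
Qed.

Lemma ACA0_subst : subst_closed ACA0.
Proof.
move=> p sg rh [{}p [{}p h|{}p h|{}p q h h']|{}p h].
- suff -> : subst sg rh p = p by apply: ACA0_RCA0; apply: RCA0_basic.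
  by case: h => [<-|[<-|[<-|[<-|[<-|[<-|[<-|[<-|[]]]]]]]]].
- rewrite induction_subst; apply: ACA0_RCA0; apply: RCA0_induction.
  exact: Sigma01_subst.
- apply: ACA0_RCA0; cbn [subst]; rewrite comprehension_subst.
  by apply: (RCA0_comprehension (subst _ _ p) (subst _ _ q));
     [apply: Sigma01_subst|apply: Pi01_subst].
- rewrite comprehension_subst; apply: ACA0_comprehension.
  by rewrite arithmetical_subst.
Qed.

Lemma teval_subst M e sg t : teval M e (tsubst sg t) = teval M (fun n => teval M e (sg n)) t.
Proof. by elim: t => //= s -> t ->. Qed.

Lemma eval_subst M p : forall e r sg rh,
  eval M e r (subst sg rh p) <-> eval M (fun n => teval M e (sg n)) (fun X => r (rh X)) p.
Proof.
elim: p => [s t|s t|t X||p IHp q IHq|p IH|p IH] e r sg rh; cbn [eval subst];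
  rewrite ?teval_subst //.
- by rewrite IHp IHq.
- have E x : (fun n => teval M (scons x e) (upN sg n)) = scons x (fun n => teval M e (sg n)).
    by apply: funext => -[|n] //=; rewrite /tshift teval_subst.
  by split=> h x; have := h x; rewrite IH E.
- have E X : (fun n => scons X r (upS rh n)) = scons X (fun n => r (rh n)).
    by apply: funext => -[|n].
  by split=> h X; have := h X; rewrite IH E.
Qed.

(** The connectives that the object language expresses by [Imp], [Bot] and
    [ForallN] are a parameter of the translation below: with their encodings
    it is convertible to [eval]; with those of Rocq it can be worked with. *)

Record logic (M : structure) := Logic {
  l_and : Prop -> Prop -> Prop;
  l_or : Prop -> Prop -> Prop;
  l_iff : Prop -> Prop -> Prop;
  l_exN : (num M -> Prop) -> Prop;
  l_exS : (set M -> Prop) -> Prop }.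

Definition deep_logic M : logic M := {|
  l_and := fun P Q => ~ (P -> ~ Q);
  l_or := fun P Q => ~ P -> Q;
  l_iff := fun P Q => ~ ((P -> Q) -> ~ (Q -> P));
  l_exN := fun P => ~ forall x, ~ P x;
  l_exS := fun P => ~ forall X, ~ P X |}.

Definition rocq_logic M : logic M := {|
  l_and := and; l_or := or; l_iff := iff; l_exN := @ex _; l_exS := @ex _ |}.

(** Excluded middle and extensionality identify the encoded connectives with those of Rocq. As this
    is an equality of records, one rewriting transfers the whole statement. *)
Lemma deep_rocq M : deep_logic M = rocq_logic M.
Proof.
rewrite /deep_logic /rocq_logic; congr Logic.
- apply: funext => P; apply: funext => Q; apply/propext; split=> [|[p q] h]; last exact: h.
  by move=> h; apply: contrapT => h'; apply: h => p q; apply: h'.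
- apply: funext => P; apply: funext => Q; apply/propext; split=> [h|[p np|q _]] //.
  by have [p|np] := pselect P; [left|right; apply: h].
- apply: funext => P; apply: funext => Q; apply/propext; split=> [|[p q] h]; last exact: h.
  by move=> h; apply: contrapT => h'; apply: h => p q; apply: h'.
- apply: funext => P; apply/propext; split=> [h|[x hx] h]; last exact: h hx.
  by apply: contrapT => h'; apply: h => x hx; apply: h'; exists x.
- apply: funext => P; apply/propext; split=> [h|[x hx] h]; last exact: h hx.
  by apply: contrapT => h'; apply: h => x hx; apply: h'; exists x.
Qed.

(* The statement read in a structure *)
Declare Scope sem_scope.

Section Semantics.
Variables (M : structure) (L : logic M).
Local Open Scope sem_scope.
Local Notation N := (num M).
Local Notation "0" := (zer M) : sem_scope.
Local Notation "1" := (one M) : sem_scope.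
Local Notation "s + t" := (add M s t) : sem_scope.
Local Notation "s * t" := (mul M s t) : sem_scope.
Local Notation "s < t" := (lt M s t) : type_scope.
Local Notation "s < t" := (lt M s t) : sem_scope.
Local Notation "s '\in' X" := (mem M s X) : type_scope.
Local Notation "s '\in' X" := (mem M s X) : sem_scope.
Local Notation "p /\ q" := (l_and M L p q) : type_scope.
Local Notation "p /\ q" := (l_and M L p q) : sem_scope.
Local Notation "p \/ q" := (l_or M L p q) : type_scope.
Local Notation "p \/ q" := (l_or M L p q) : sem_scope.
Local Notation "p <-> q" := (l_iff M L p q) : type_scope.
Local Notation "p <-> q" := (l_iff M L p q) : sem_scope.
Local Notation "'EX' x .. y , p" := (l_exN M L (fun x => .. (l_exN M L (fun y => p)) ..)) : type_scope.
Local Notation "'EX' x .. y , p" := (l_exN M L (fun x => .. (l_exN M L (fun y => p)) ..)) : sem_scope.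
Local Notation "'EXS' X .. Y , p" := (l_exS M L (fun X => .. (l_exS M L (fun Y => p)) ..)) : type_scope.
Local Notation "'EXS' X .. Y , p" := (l_exS M L (fun X => .. (l_exS M L (fun Y => p)) ..)) : sem_scope.
Local Notation "3" := (1 + 1 + 1) : sem_scope.

Definition mpair (x y : N) : N := (x + y) * (x + y) + x.
Local Notation "<( x , y )>" := (mpair x y) : sem_scope.

Definition mN (_ : N) : Prop := 0 = 0.

Definition mFun (F : set M) (P Q : N -> Prop) : Prop :=
  (forall z, z \in F -> EX x y, P x /\ Q y /\ z = <(x, y)>) /\
  (forall x, P x -> EX y, <(x, y)> \in F /\ forall y', <(x, y')> \in F -> y' = y).

Definition mpow2 (k y : N) : Prop :=
  EXS E, mFun E mN mN /\ <(0, 1)> \in E /\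
    (forall n m, <(n, m)> \in E -> <(n + 1, m + m)> \in E) /\ <(k, y)> \in E.

Record mrat : Type := MRat { mpos : N; mneg : N; mden : N }.

Definition mqcode (q : mrat) : N := <( <(mpos q, mneg q)>, mden q )>.

Definition mallQ (f : mrat -> Prop) : Prop :=
  forall p n d, 0 < d -> f (MRat p n d).
Definition mexQ (f : mrat -> Prop) : Prop :=
  EX p n d, 0 < d /\ f (MRat p n d).
Definition mqpos (q : mrat) : Prop := mneg q < mpos q.
Definition mallQp (f : mrat -> Prop) : Prop := mallQ (fun q => mqpos q -> f q).
Definition mexQp (f : mrat -> Prop) : Prop := mexQ (fun q => mqpos q /\ f q).

Local Notation "'ALLQ' x .. y , p" := (mallQ (fun x => .. (mallQ (fun y => p)) ..)) : type_scope.
Local Notation "'ALLQ' x .. y , p" := (mallQ (fun x => .. (mallQ (fun y => p)) ..)) : sem_scope.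
Local Notation "'EXQ' x .. y , p" := (mexQ (fun x => .. (mexQ (fun y => p)) ..)) : type_scope.
Local Notation "'EXQ' x .. y , p" := (mexQ (fun x => .. (mexQ (fun y => p)) ..)) : sem_scope.
Local Notation "'ALLQp' x .. y , p" := (mallQp (fun x => .. (mallQp (fun y => p)) ..)) : type_scope.
Local Notation "'ALLQp' x .. y , p" := (mallQp (fun x => .. (mallQp (fun y => p)) ..)) : sem_scope.
Local Notation "'EXQp' x .. y , p" := (mexQp (fun x => .. (mexQp (fun y => p)) ..)) : type_scope.
Local Notation "'EXQp' x .. y , p" := (mexQp (fun x => .. (mexQp (fun y => p)) ..)) : sem_scope.

Definition mQ (c : N) : Prop := EXQ q, c = mqcode q.

Definition mqadd (q r : mrat) : mrat :=
  MRat (mpos q * mden r + mpos r * mden q)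
       (mneg q * mden r + mneg r * mden q) (mden q * mden r).
Definition mqlt (q r : mrat) : Prop :=
  mpos q * mden r + mneg r * mden q < mpos r * mden q + mneg q * mden r.
Definition mqeq (q r : mrat) : Prop :=
  mpos q * mden r + mneg r * mden q = mpos r * mden q + mneg q * mden r.
Definition mqle (q r : mrat) : Prop := ~ mqlt r q.

Definition mq0 : mrat := MRat 0 0 1.

Definition mwith_hpow (k : N) (f : mrat -> Prop) : Prop :=
  EX y, mpow2 k y /\ f (MRat 1 0 y).

Definition mreal : Type := N -> mrat -> Prop.

Definition mrset (R : set M) : mreal := fun k q => <(k, mqcode q)> \in R.
Definition mrrat (r : mrat) : mreal := fun _ q => mqeq q r.
Definition mrhpow (n : N) : mreal := fun _ q => mwith_hpow n (mqeq q).
Definition mradd (x y : mreal) : mreal := fun k q =>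
  EXQ u v, x (k + 1) u /\ y (k + 1) v /\ mqeq q (mqadd u v).

Definition mrlt (x y : mreal) : Prop :=
  EX k, EXQ q r, x k q /\ y k r /\
    mwith_hpow k (fun e => mqlt (mqadd q (mqadd e e)) r).
Definition mrle (x y : mreal) : Prop := ~ mrlt y x.
Definition mreq (x y : mreal) : Prop := mrle x y /\ mrle y x.

Definition mrapid (x : mreal) : Prop :=
  forall k i, ALLQ q r, x k q /\ x (k + i) r ->
    mwith_hpow k (fun e => mqle q (mqadd r e) /\ mqle r (mqadd q e)).

Definition mReal (R : set M) : Prop := mFun R mN mQ /\ mrapid (mrset R).
Definition mRealPos (R : set M) : Prop := mReal R /\ mrlt (mrrat mq0) (mrset R).

Record mspace : Type := MSpace { mcar : set M; mdist : set M }.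

Definition mdA (X : mspace) (a b : N) : mreal := fun k q =>
  <( <( <(a, b)>, k )>, mqcode q )> \in mdist X.

Definition misSpace (X : mspace) : Prop :=
  mFun (mdist X)
    (fun z => EX a b k, a \in mcar X /\ b \in mcar X /\ z = <( <(a, b)>, k )>) mQ /\
  (forall a b, a \in mcar X /\ b \in mcar X ->
     mrapid (mdA X a b) /\
     mreq (mdA X a a) (mrrat mq0) /\
     mreq (mdA X a b) (mdA X b a) /\
     mrle (mrrat mq0) (mdA X a b) /\
     forall c, c \in mcar X ->
       mrle (mdA X a b) (mradd (mdA X a c) (mdA X c b))).

Definition mpoint : Type := N -> N -> Prop.
Definition mpset (X : set M) : mpoint := fun n a => <(n, a)> \in X.
Definition mpconst (b : N) : mpoint := fun _ a => a = b.

Definition misPoint (S : mspace) (X : set M) : Prop :=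
  mFun X mN (fun a => a \in mcar S) /\
  forall n a b, <(n, a)> \in X /\ <(n + 1, b)> \in X ->
    mrlt (mdA S a b) (mrhpow n).

Definition mdP (S : mspace) (x y : mpoint) : mreal := fun k q =>
  EX a b, x (k + 3) a /\ y (k + 3) b /\ mdA S a b (k + 3) q.

Definition mallP (S : mspace) (f : mpoint -> Prop) : Prop :=
  forall X, misPoint S X -> f (mpset X).

Definition misOpenSeq (S : mspace) (U : set M) : Prop :=
  mFun U (fun z => EX n m, z = <(n, m)>)
    (fun w => EX a, EXQp q, a \in mcar S /\ w = <(a, mqcode q)>).

Definition minOpen (S : mspace) (U : set M) (n : N) (x : mpoint) : Prop :=
  EX m a, EXQp q, <( <(n, m)>, <(a, mqcode q)> )> \in U /\
    mrlt (mdP S x (mpconst a)) (mrrat q).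

Definition misOpenCovering (S : mspace) (U : set M) : Prop :=
  misOpenSeq S U /\ mallP S (fun x => EX n, minOpen S U n x).

Definition mLebesgue (S : mspace) : Prop :=
  forall U, misOpenCovering S U ->
    EXS R, mRealPos R /\
      mallP S (fun x => EX n, mallP S (fun y =>
        mrlt (mdP S x y) (mrset R) -> minOpen S U n y)).

Definition mftuple (n a : N) (r : mrat) (b : N) (s : mrat) : N :=
  <( n, <( <(a, mqcode r)>, <(b, mqcode s)> )> )>.

Definition mfrel (F : set M) (a : N) (r : mrat) (b : N) (s : mrat) : Prop :=
  EX n, mftuple n a r b s \in F.

Definition misContinuous (S S' : mspace) (F : set M) : Prop :=
  (forall z, z \in F -> EX n a, EXQp r, EX b, EXQp s,
     a \in mcar S /\ b \in mcar S' /\ z = mftuple n a r b s) /\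
  (forall a, ALLQp r, forall b, ALLQp s, forall b', ALLQp s',
     mfrel F a r b s /\ mfrel F a r b' s' ->
     mrlt (mdA S' b b') (mrrat (mqadd s s'))) /\
  (forall a, ALLQp r, forall b, ALLQp s, forall b', ALLQp s',
     b' \in mcar S' /\ mfrel F a r b s /\
     mrle (mradd (mdA S' b b') (mrrat s)) (mrrat s') -> mfrel F a r b' s') /\
  (forall a, ALLQp r, forall b, ALLQp s, forall a', ALLQp r',
     a' \in mcar S /\ mfrel F a r b s /\
     mrle (mradd (mdA S a a') (mrrat r')) (mrrat r) -> mfrel F a' r' b s) /\
  mallP S (fun x => ALLQp q, EX a, EXQp r, EX b, EXQp s,
     mfrel F a r b s /\ mrlt (mdP S x (mpconst a)) (mrrat r) /\ mqlt s q).

Definition misValue (S S' : mspace) (F : set M) (x y : mpoint) : Prop :=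
  forall a, ALLQp r, forall b, ALLQp s,
    mfrel F a r b s /\ mrlt (mdP S x (mpconst a)) (mrrat r) ->
    mrlt (mdP S' y (mpconst b)) (mrrat s).

Definition misUniformlyContinuous (S S' : mspace) (F : set M) : Prop :=
  forall E, mRealPos E ->
    EXS D, mRealPos D /\
      mallP S (fun x => mallP S (fun y =>
        mrlt (mdP S x y) (mrset D) ->
        mallP S' (fun u => mallP S' (fun v =>
          misValue S S' F x u /\ misValue S S' F y v ->
          mrlt (mdP S' u v) (mrset E))))).

Definition mAtsuji (S : mspace) : Prop :=
  forall B DB, misSpace (MSpace B DB) ->
    forall F, misContinuous S (MSpace B DB) F ->
      misUniformlyContinuous S (MSpace B DB) F.

Definition mAtsuji_implies_Lebesgue : Prop :=
  forall A D, misSpace (MSpace A D) -> mAtsuji (MSpace A D) -> mLebesgue (MSpace A D).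

End Semantics.

Lemma eval_main M e r :
  eval M e r Atsuji_implies_Lebesgue = mAtsuji_implies_Lebesgue M (deep_logic M).
Proof. reflexivity. Qed.

(** * Arithmetical predicates in a model of ACA0 *)

(** One environment holds two infinite streams: variables at even indices, parameters at odd ones.
    The parameters of two subformulas can be interleaved again within the second stream. *)
Definition mixL (n : nat) := n + n.
Definition mixR (n : nat) := S (n + n).
Definition mix {A} (f g : nat -> A) (n : nat) : A :=
  if Nat.even n then f (Nat.div2 n) else g (Nat.div2 n).

Lemma mix_L A (f g : nat -> A) n : mix f g (mixL n) = f n.
Proof.
rewrite /mix /mixL; have -> : n + n = 2 * n by lia.
by rewrite Nat.even_mul Nat.div2_double.
Qed.

Lemma mix_R A (f g : nat -> A) n : mix f g (mixR n) = g n.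
Proof.
rewrite /mix /mixR; have -> : S (n + n) = S (2 * n) by lia.
by rewrite Nat.even_succ Nat.odd_mul Nat.div2_succ_double.
Qed.

Lemma mix_ind (P : nat -> Prop) :
  (forall n, P (mixL n)) -> (forall n, P (mixR n)) -> forall n, P n.
Proof.
move=> hL hR n; have [[m ->]|[m ->]] := Nat.Even_or_Odd n.
  by have -> : 2 * m = mixL m by rewrite /mixL; lia.
by have -> : 2 * m + 1 = mixR m by rewrite /mixR; lia.
Qed.

Section Arithmetical.
Variables (M : structure) (r0 : nat -> set M).
Notation N := (num M).
Notation env := (nat -> N).

(** Shallow counterparts of terms and arithmetical formulas with parameters. Arithmeticity becomes a
    property of Rocq predicates, proved by syntax-directed rules without writing down a formula. *)
Inductive AT : (env -> N) -> Prop :=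
| AT_var i : AT (fun e => e i)
| AT_cst c : AT (fun _ => c)
| AT_add f g : AT f -> AT g -> AT (fun e => add M (f e) (g e))
| AT_mul f g : AT f -> AT g -> AT (fun e => mul M (f e) (g e)).

(** The constants of [AT_cst] and [Ar_mem] play the role of number and set
    parameters. *)
Inductive Ar : (env -> Prop) -> Prop :=
| Ar_eq f g : AT f -> AT g -> Ar (fun e => f e = g e)
| Ar_lt f g : AT f -> AT g -> Ar (fun e => lt M (f e) (g e))
| Ar_mem f X : AT f -> Ar (fun e => mem M (f e) X)
| Ar_bot : Ar (fun _ => False)
| Ar_imp P Q : Ar P -> Ar Q -> Ar (fun e => P e -> Q e)
| Ar_scons P : Ar P -> Ar (fun e => forall x, P (scons x e)).

Set Implicit Arguments.

Lemma Ar_ext P Q : Ar P -> (forall e, P e <-> Q e) -> Ar Q.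
Proof. by move=> h /(_ _)/propext hPQ; rewrite -(funext hPQ). Qed.

Lemma Ar_true : Ar (fun _ => True).
Proof. by apply: Ar_ext (Ar_imp _ _ Ar_bot Ar_bot) _. Qed.

Lemma Ar_all R : Ar (fun e => R (fun n => e (S n)) (e 0)) -> Ar (fun e => forall x, R e x).
Proof. exact: Ar_scons. Qed.

Lemma Ar_not P : Ar P -> Ar (fun e => ~ P e).
Proof. by move=> h; apply: Ar_imp h Ar_bot. Qed.

Lemma Ar_and P Q : Ar P -> Ar Q -> Ar (fun e => P e /\ Q e).
Proof.
move=> hP hQ; apply: Ar_ext (Ar_not (Ar_imp _ _ hP (Ar_not hQ))) _ => e.
split=> [h|[p q] h]; last exact: h.
by apply: contrapT => h'; apply: h => p q; apply: h'.
Qed.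

Lemma Ar_or P Q : Ar P -> Ar Q -> Ar (fun e => P e \/ Q e).
Proof.
move=> hP hQ; apply: Ar_ext (Ar_imp _ _ (Ar_not hP) hQ) _ => e.
split=> [h|[p np|q _]] //.
by have [p|np] := pselect (P e); [left|right; apply: h].
Qed.

Lemma Ar_iff P Q : Ar P -> Ar Q -> Ar (fun e => P e <-> Q e).
Proof. by move=> hP hQ; apply: Ar_and; apply: Ar_imp. Qed.

Lemma Ar_ex R : Ar (fun e => R (fun n => e (S n)) (e 0)) -> Ar (fun e => exists x, R e x).
Proof.
move=> h; have h1 := Ar_not h.
apply: Ar_ext (Ar_not (@Ar_all (fun e x => ~ R e x) h1)) _ => e.
split=> [{}h|[x hx] {}h]; last exact: h hx.
by apply: contrapT => h'; apply: h => x hx; apply: h'; exists x.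
Qed.

Lemma AT_repr f : AT f -> exists t c, forall e, f e = teval M (mix e c) t.
Proof.
(* [s1] and [s2] redirect the parameters of the two subterms to the even and the odd half of the
   joint parameter stream. *)
pose s1 := mix (fun i => TVar (mixL i)) (fun i => TVar (mixR (mixL i))).
pose s2 := mix (fun i => TVar (mixL i)) (fun i => TVar (mixR (mixR i))).
have E1 e c1 c2 : mix e c1 = fun n => teval M (mix e (mix c1 c2)) (s1 n).
  by apply: funext => n; rewrite /s1 /s2; elim/mix_ind: n => n; rewrite !(mix_L, mix_R) /= !(mix_L, mix_R).
have E2 e c1 c2 : mix e c2 = fun n => teval M (mix e (mix c1 c2)) (s2 n).
  by apply: funext => n; rewrite /s1 /s2; elim/mix_ind: n => n; rewrite !(mix_L, mix_R) /= !(mix_L, mix_R).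
elim=> {f} [i|c|f g _ [t [c h]] _ [t' [c' h']]|f g _ [t [c h]] _ [t' [c' h']]].
- by exists (TVar (mixL i)), (fun _ => zer M) => e; rewrite /= mix_L.
- by exists (TVar (mixR 0)), (fun _ => c) => e; rewrite /= mix_R.
- exists (TAdd (tsubst s1 t) (tsubst s2 t')), (mix c c') => e.
  by rewrite h h' /= !teval_subst -E1 -E2.
- exists (TMul (tsubst s1 t) (tsubst s2 t')), (mix c c') => e.
  by rewrite h h' /= !teval_subst -E1 -E2.
Qed.

(** A quantifier puts its value in front of the interleaved stream, whereas the induction needs it
    in front of the variables alone; this renaming mediates. *)
Definition under_binder (v : nat) : term :=
  mix (scons (TVar 0) (fun i => TVar (S (mixL i)))) (fun i => TVar (S (mixR i))) v.

Lemma under_binderE x e c :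
  (fun v => teval M (scons x (mix e c)) (under_binder v)) = mix (scons x e) c.
Proof.
apply: funext => n; rewrite /under_binder; elim/mix_ind: n => n; rewrite ?(mix_L, mix_R) /=.
  by case: n => [|n] /=; rewrite ?mix_L.
by rewrite mix_R.
Qed.

Lemma Ar_repr P : Ar P ->
  exists p c r, arithmetical p /\ forall e, P e <-> eval M (mix e c) r p.
Proof.
pose s1 := mix (fun i => TVar (mixL i)) (fun i => TVar (mixR (mixL i))).
pose s2 := mix (fun i => TVar (mixL i)) (fun i => TVar (mixR (mixR i))).
have E1 e c1 c2 : (fun n => teval M (mix e (mix c1 c2)) (s1 n)) = mix e c1.
  by apply: funext => n; rewrite /s1 /s2; elim/mix_ind: n => n; rewrite !(mix_L, mix_R) /= !(mix_L, mix_R).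
have E2 e c1 c2 : (fun n => teval M (mix e (mix c1 c2)) (s2 n)) = mix e c2.
  by apply: funext => n; rewrite /s1 /s2; elim/mix_ind: n => n; rewrite !(mix_L, mix_R) /= !(mix_L, mix_R).
have F1 (r r' : nat -> set M) : (fun n => mix r r' (mixL n)) = r.
  by apply: funext => n; rewrite mix_L.
have F2 (r r' : nat -> set M) : (fun n => mix r r' (mixR n)) = r'.
  by apply: funext => n; rewrite mix_R.
elim=> {P} [f g /AT_repr [t [c h]] /AT_repr [t' [c' h']]
  |f g /AT_repr [t [c h]] /AT_repr [t' [c' h']]
  |f X /AT_repr [t [c h]]||P Q _ [p [c [r [hp h]]]] _ [q [c' [r' [hq h']]]]
  |P _ [p [c [r [hp h]]]]].
- exists (FEq (tsubst s1 t) (tsubst s2 t')), (mix c c'), r0; split=> // e.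
  by rewrite h h' /= !teval_subst E1 E2.
- exists (FLt (tsubst s1 t) (tsubst s2 t')), (mix c c'), r0; split=> // e.
  by rewrite h h' /= !teval_subst E1 E2.
- by exists (FMem t 0), c, (fun _ => X); split=> // e; rewrite h.
- by exists Bot, (fun _ => zer M), r0.
- exists (Imp (subst s1 mixL p) (subst s2 mixR q)), (mix c c'), (mix r r').
  split=> [/=|e]; first by rewrite !arithmetical_subst.
  by rewrite h h' /= !eval_subst E1 E2 F1 F2.
- exists (ForallN (subst under_binder (fun X => X) p)), c, r.
  split=> [/=|e]; first by rewrite arithmetical_subst.
  split=> /= h' x; have := h' x; by rewrite eval_subst under_binderE h.
Qed.

Unset Implicit Arguments.
Hypothesis HM : model ACA0 M.

Lemma eval_shiftS e r X p : eval M e (scons X r) (shiftS p) <-> eval M e r p.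
Proof. by rewrite /shiftS eval_subst. Qed.

Lemma comprehension_formula p e r : arithmetical p ->
  exists X, forall n, mem M n X <-> eval M (scons n e) r p.
Proof.
move=> hp; have /= h := HM _ e r (ACA0_comprehension _ hp).
apply: contrapT => h'; apply: h => X hX; apply: h'; exists X => n.
apply: contrapT => h; apply: (hX n) => h1 h2; apply: h.
by rewrite -(eval_shiftS _ _ X); split.
Qed.

Lemma comprehension_Ar P : Ar (fun e => P (e 0)) ->
  exists X, forall n, mem M n X <-> P n.
Proof.
move=> /Ar_repr [p [c [r [hp h]]]].
have [|X hX] := comprehension_formula (subst under_binder (fun X => X) p)
  (mix (fun _ => zer M) c) r; first by rewrite arithmetical_subst.
by exists X => n; rewrite hX eval_subst under_binderE -h.
Qed.

Lemma set_induction X : mem M (zer M) X ->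
  (forall n, mem M n X -> mem M (add M n (one M)) X) -> forall n, mem M n X.
Proof.
move=> h0 hS n; apply: contrapT => hn.
(* Membership becomes [Sigma01] through a vacuous quantifier, under which the induction variable is
   [TVar 1]. *)
have hsig : Sigma01 (ExistsN (FMem (TVar 1) 0)) by do 2 constructor.
have /= h := HM _ (fun _ => zer M) (fun _ => X) (ACA0_RCA0 _ (RCA0_induction _ hsig)).
apply: (h _ n); last by move=> _.
move=> h'; apply: h' => [h'|m h1 h2]; first exact: h' (zer M) h0.
by apply: h1 => _ hm; apply: (h2 (zer M)); apply: hS.
Qed.

(** Arithmetical comprehension turns [P] into a set, so that induction for sets suffices. *)
Lemma induction_Ar P : Ar (fun e => P (e 0)) -> P (zer M) ->
  (forall n, P n -> P (add M n (one M))) -> forall n, P n.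
Proof.
move=> /comprehension_Ar [X hX] h0 hS n; apply/hX; apply: set_induction n.
  by apply/hX.
by move=> n /hX h; apply/hX; apply: hS.
Qed.

End Arithmetical.

Ltac ar_basic_step :=
  match goal with
  | |- AT _ _ => first
    [ apply: AT_var | apply: AT_cst | apply: AT_add | apply: AT_mul ]
  | |- Ar _ _ => first
    [ assumption
    | apply: Ar_not | apply: Ar_and | apply: Ar_or | apply: Ar_iff
    | apply: Ar_ex | apply: Ar_eq | apply: Ar_lt | apply: Ar_mem | apply: Ar_bot | apply: Ar_true
    | apply: Ar_imp | apply: Ar_all ]
  end; cbn beta.

Ltac ar_basic := repeat ar_basic_step.

(** * Arithmetic and order in a model *)

Section Basic.
Variables (M : structure) (r0 : nat -> set M) (HM : model ACA0 M).
Local Notation "0" := (zer M).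
Local Notation "1" := (one M).
Local Infix "+" := (add M).
Local Infix "*" := (mul M).
Local Infix "<" := (lt M).

Lemma model_basic :
  ((forall n, n + 1 <> 0) /\ (forall m n, m + 1 = n + 1 -> m = n)) /\
  ((forall m, m + 0 = m) /\ (forall m n, m + (n + 1) = m + n + 1)) /\
  ((forall m, m * 0 = 0) /\ (forall m n, m * (n + 1) = m * n + m)) /\
  ((forall m, ~ m < 0) /\ (forall m n, m < n + 1 <-> m < n \/ m = n)).
Proof.
have ax p : In p basic_axioms -> eval M (fun _ => 0) r0 p.
  by move=> h; apply: HM; apply: ACA0_RCA0; apply: RCA0_basic.
do !split.
- exact: (ax (closed (ALL n, ~ n + 1 = 0)%so) (or_introl erefl)).
- by apply: (ax (List.nth 1 basic_axioms Bot)); right; left.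
- by apply: (ax (List.nth 2 basic_axioms Bot)); do 2 right; left.
- by apply: (ax (List.nth 3 basic_axioms Bot)); do 3 right; left.
- by apply: (ax (List.nth 4 basic_axioms Bot)); do 4 right; left.
- by apply: (ax (List.nth 5 basic_axioms Bot)); do 5 right; left.
- by apply: (ax (List.nth 6 basic_axioms Bot)); do 6 right; left.
- have /= h : eval M (fun _ => 0) r0 (List.nth 7 basic_axioms Bot).
    by apply: ax; do 7 right; left.
  move=> hl; apply: contrapT => hn; apply: (h m n) => h1 _.
  by apply: hn; have [e|e] := pselect (m < n); [left|right; apply: h1].
- have /= h : eval M (fun _ => 0) r0 (List.nth 7 basic_axioms Bot).
    by apply: ax; do 7 right; left.
  move=> hl; apply: contrapT => hn; apply: (h m n) => _ h1.
  by apply: hn; apply: h1 => e; case: hl.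
Qed.

Lemma nat_ind_Ar P : Ar M (fun e => P (e O)) -> P 0 ->
  (forall n, P n -> P (n + 1)) -> forall n, P n.
Proof. exact: induction_Ar. Qed.

Lemma NaddS m n : m + (n + 1) = m + n + 1. Proof. by have [_ [[_ h] _]] := model_basic. Qed.
Lemma Naddn0 m : m + 0 = m. Proof. by have [_ [[h _] _]] := model_basic. Qed.
Lemma NmulS m n : m * (n + 1) = m * n + m. Proof. by have [_ [_ [[_ h] _]]] := model_basic. Qed.
Lemma Nmuln0 m : m * 0 = 0. Proof. by have [_ [_ [[h _] _]]] := model_basic. Qed.
Lemma Nsucc_neq0 n : n + 1 <> 0. Proof. by have [[h _] _] := model_basic. Qed.
Lemma Nsucc_inj m n : m + 1 = n + 1 -> m = n. Proof. have [[_ h] _] := model_basic; exact: h. Qed.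
Lemma Nltn0 m : ~ m < 0. Proof. by have [_ [_ [_ [h _]]]] := model_basic. Qed.
Lemma NltnS m n : m < n + 1 <-> m < n \/ m = n. Proof. by have [_ [_ [_ [_ h]]]] := model_basic. Qed.

Lemma NaddA l m n : l + (m + n) = l + m + n.
Proof.
move: n; apply: nat_ind_Ar; [by ar_basic|by rewrite !Naddn0|].
by move=> n IH; rewrite !NaddS IH.
Qed.

Lemma Nadd0n n : 0 + n = n.
Proof. by move: n; apply: nat_ind_Ar => [||n IH]; [by ar_basic|rewrite Naddn0|rewrite NaddS IH]. Qed.

Lemma NaddSn m n : m + 1 + n = m + n + 1.
Proof. by move: n; apply: nat_ind_Ar => [||n IH]; [by ar_basic|rewrite !Naddn0|rewrite !NaddS IH]. Qed.

Lemma NaddC m n : m + n = n + m.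
Proof.
by move: n; apply: nat_ind_Ar => [||n IH]; [by ar_basic|rewrite Naddn0 Nadd0n|rewrite NaddS IH NaddSn].
Qed.

Lemma NmulDr l m n : l * (m + n) = l * m + l * n.
Proof.
move: n; apply: nat_ind_Ar => [||n IH]; [by ar_basic|by rewrite Nmuln0 !Naddn0|].
by rewrite NaddS !NmulS IH NaddA.
Qed.

Lemma Nmul0n n : 0 * n = 0.
Proof. by move: n; apply: nat_ind_Ar => [||n IH]; [by ar_basic|rewrite Nmuln0|rewrite NmulS IH Naddn0]. Qed.

Lemma NmulSn m n : (m + 1) * n = m * n + n.
Proof.
move: n; apply: nat_ind_Ar => [||n IH]; [by ar_basic|by rewrite !Nmuln0 Naddn0|].
by rewrite !NmulS IH !NaddS; congr (_ + 1); rewrite -!NaddA (NaddC n m).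
Qed.

Lemma NmulC m n : m * n = n * m.
Proof.
by move: n; apply: nat_ind_Ar => [||n IH]; [by ar_basic|rewrite Nmuln0 Nmul0n|rewrite NmulS IH NmulSn].
Qed.

Lemma NmulA l m n : l * (m * n) = l * m * n.
Proof.
move: n; apply: nat_ind_Ar => [||n IH]; [by ar_basic|by rewrite !Nmuln0|].
by rewrite !NmulS NmulDr IH.
Qed.

Lemma Nmul1n n : 1 * n = n.
Proof. by rewrite -[1]Nadd0n NmulSn Nmul0n Nadd0n. Qed.

Lemma N_semiring : semi_ring_theory 0 1 (add M) (mul M) eq.
Proof.
split=> *; rewrite ?Nadd0n ?Nmul1n ?Nmul0n ?NaddA ?NmulA //; try exact: NaddC; try exact: NmulC.
by rewrite NmulC NmulDr; congr (_ + _); exact: NmulC.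
Qed.

Add Ring N_ring : N_semiring.

Lemma NaddI l m n : m + l = n + l -> m = n.
Proof.
move: l; apply: nat_ind_Ar => [||l IH]; [by ar_basic|by rewrite !Naddn0|].
by rewrite !NaddS => /Nsucc_inj.
Qed.

Lemma Nlt_ex m n : m < n <-> exists k, n = m + k + 1.
Proof.
move: n; apply: nat_ind_Ar => [||n IH]; [by ar_basic| |].
  by split=> [/Nltn0|[k]] // => /esym /Nsucc_neq0.
rewrite NltnS; split=> [[/IH [k ->]| ->]|[k /Nsucc_inj e]].
- by exists (k + 1); rewrite NaddS.
- by exists 0; rewrite Naddn0.
- have [k0|[j kj]] : k = 0 \/ exists j, k = j + 1.
    by move: k {e}; apply: nat_ind_Ar => [||k _]; [ar_basic|left|right; exists k].
  by right; rewrite e k0 Naddn0.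
by left; apply/IH; exists j; rewrite e kj NaddA.
Qed.

Lemma N0_or_S n : n = 0 \/ exists k, n = k + 1.
Proof. by move: n; apply: nat_ind_Ar => [||n _]; [ar_basic|left|right; exists n]. Qed.

Lemma Nltxx n : ~ n < n.
Proof.
rewrite Nlt_ex => -[k]; rewrite -NaddA -{1}(Naddn0 n) (NaddC n) (NaddC n) => /NaddI.
by move=> /esym /Nsucc_neq0.
Qed.

Lemma Nlt_total m n : m < n \/ m = n \/ n < m.
Proof.
move: m; apply: nat_ind_Ar => [|| m IH]; first by ar_basic.
  by have [->|[k ->]] := N0_or_S n; [right; left|left; apply/Nlt_ex; exists k; rewrite Nadd0n].
case: IH => [/Nlt_ex [k ->]|[->|h]].
- have [->|[j ->]] := N0_or_S k; first by right; left; rewrite Naddn0.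
  left; apply/Nlt_ex; exists j; by rewrite NaddSn !NaddA.
- by right; right; apply/NltnS; right.
- by right; right; apply/NltnS; left.
Qed.

Lemma NltM l m n : 0 < l -> m < n -> m * l < n * l.
Proof.
move=> /Nlt_ex [i ->] /Nlt_ex [j ->]; rewrite Nadd0n; apply/Nlt_ex.
exists (j * (i + 1) + i).
ring.
Qed.

End Basic.

From HB Require Import structures.
From mathcomp Require Import eqtype choice order ssralg ssrnum.

(** * Fractions *)

Section Fractions.
Variables (M : structure) (r0 : nat -> set M) (HM : model ACA0 M).
Local Notation N := (num M).
Local Notation "0" := (zer M).
Local Notation "1" := (one M).
Local Infix "+" := (add M).
Local Infix "*" := (mul M).
Local Infix "<" := (lt M).
Add Ring N_ring' : (N_semiring M r0 HM).

(** [Frac p n d] stands for [(p - n) / (d + 1)]. *)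
Record frac := Frac { fp : N; fn : N; fd : N }.

Definition feq (q r : frac) :=
  fp q * (fd r + 1) + fn r * (fd q + 1) = fp r * (fd q + 1) + fn q * (fd r + 1).

Lemma Nmul_inj l m n : m * (l + 1) = n * (l + 1) -> m = n.
Proof.
have hl : 0 < l + 1 by apply/(Nlt_ex _ r0 HM); exists l; ring.
move=> e; have [h|[//|h]] := Nlt_total _ r0 HM m n;
  have := NltM _ r0 HM _ _ _ hl h; rewrite e => /(Nltxx _ r0 HM) [].
Qed.

Lemma feq_sym q r : feq q r -> feq r q. Proof. by rewrite /feq => ->. Qed.
Lemma feq_trans q r s : feq q r -> feq r s -> feq q s.
Proof.
case: q r s => [p n d] [p' n' d'] [p'' n'' d'']; rewrite /feq /= => h h'.
apply: (Nmul_inj d'); apply: (NaddI _ r0 HM (n' * (d + 1) * (d'' + 1) + p' * (d + 1) * (d'' + 1))).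
transitivity ((p * (d' + 1) + n' * (d + 1)) * (d'' + 1) +
              (p' * (d'' + 1) + n'' * (d' + 1)) * (d + 1)); first by ring.
by rewrite h h'; ring.
Qed.

Definition quot := {c : frac -> Prop | exists q, c = feq q}.
Definition qpi q : quot := exist _ (feq q) (ex_intro _ q erefl).
Definition qrep (x : quot) : frac := sval (cid (svalP x)).

Lemma qpi_rep x : qpi (qrep x) = x.
Proof.
by rewrite /qrep; case: cid; case: x => c hc q /= hq; apply: eq_exist.
Qed.

Lemma qpiP q r : qpi q = qpi r <-> feq q r.
Proof.
split=> [[h]|h]; first by rewrite h.
apply: eq_exist; apply: funext => s; apply/propext; split.
  by apply: feq_trans; apply: feq_sym.
exact: feq_trans.
Qed.

Lemma qrep_pi q : feq (qrep (qpi q)) q.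
Proof. by apply/qpiP; rewrite qpi_rep. Qed.

(** Denominators are stored less one, hence never zero: [d * d' + d + d'] codes the product
    [(d + 1) * (d' + 1)]. *)
Definition fadd (q r : frac) := Frac
  (fp q * (fd r + 1) + fp r * (fd q + 1)) (fn q * (fd r + 1) + fn r * (fd q + 1))
  (fd q * fd r + fd q + fd r).
Definition fopp (q : frac) := Frac (fn q) (fp q) (fd q).
Definition fmul (q r : frac) := Frac
  (fp q * fp r + fn q * fn r) (fp q * fn r + fn q * fp r)
  (fd q * fd r + fd q + fd r).

Lemma fadd_feq q q' r r' : feq q q' -> feq r r' -> feq (fadd q r) (fadd q' r').
Proof.
case: q q' r r' => [p n d] [p' n' d'] [a b c] [a' b' c']; rewrite /feq /= => h h'.
transitivity ((p * (d' + 1) + n' * (d + 1)) * (c + 1) * (c' + 1) +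
  (a * (c' + 1) + b' * (c + 1)) * (d + 1) * (d' + 1)); first by ring.
by rewrite h h'; ring.
Qed.

Lemma fmulC q r : feq (fmul q r) (fmul r q).
Proof. by rewrite /feq /=; ring. Qed.

Lemma fmul_feq_r q r r' : feq r r' -> feq (fmul q r) (fmul q r').
Proof.
case: q r r' => [p n d] [a b c] [a' b' c']; rewrite /feq /= => h.
transitivity ((p * (d + 1)) * (a * (c' + 1) + b' * (c + 1)) +
              (n * (d + 1)) * (a' * (c + 1) + b * (c' + 1))); first by ring.
transitivity ((p * (d + 1)) * (a' * (c + 1) + b * (c' + 1)) +
              (n * (d + 1)) * (a * (c' + 1) + b' * (c + 1))); first by rewrite h.
ring.
Qed.

Lemma fmul_feq q q' r r' : feq q q' -> feq r r' -> feq (fmul q r) (fmul q' r').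
Proof.
move=> h /(fmul_feq_r q) h'; apply: feq_trans h' _.
apply: feq_trans (fmulC _ _) _; apply: feq_trans (fmulC _ _).
exact: fmul_feq_r.
Qed.

Definition qadd (x y : quot) := qpi (fadd (qrep x) (qrep y)).
Definition qmul (x y : quot) := qpi (fmul (qrep x) (qrep y)).
Definition qopp (x : quot) := qpi (fopp (qrep x)).

Lemma qaddE q r : qadd (qpi q) (qpi r) = qpi (fadd q r).
Proof. by apply/qpiP; apply: fadd_feq; apply: qrep_pi. Qed.

Lemma qmulE q r : qmul (qpi q) (qpi r) = qpi (fmul q r).
Proof. by apply/qpiP; apply: fmul_feq; apply: qrep_pi. Qed.

Lemma qoppE q : qopp (qpi q) = qpi (fopp q).
Proof.
apply/qpiP; have := qrep_pi q; rewrite /feq /= => h.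
rewrite (NaddC _ r0 HM) -h; exact: (NaddC _ r0 HM).
Qed.

Lemma quot_ind (P : quot -> Prop) : (forall q, P (qpi q)) -> forall x, P x.
Proof. by move=> h x; rewrite -(qpi_rep x). Qed.

Lemma qaddA : associative qadd.
Proof.
move=> x y z; elim/quot_ind: x => x; elim/quot_ind: y => y; elim/quot_ind: z => z.
by rewrite !qaddE; apply/qpiP; rewrite /feq /=; ring.
Qed.

Lemma qaddC : commutative qadd.
Proof.
move=> x y; elim/quot_ind: x => x; elim/quot_ind: y => y.
by rewrite !qaddE; apply/qpiP; rewrite /feq /=; ring.
Qed.

Definition qzero := qpi (Frac 0 0 0).
Definition qone := qpi (Frac 1 0 0).

Lemma qadd0 : left_id qzero qadd.
Proof. by move=> x; elim/quot_ind: x => x; rewrite qaddE; apply/qpiP; rewrite /feq /=; ring. Qed.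

Lemma qaddN : left_inverse qzero qopp qadd.
Proof.
by move=> x; elim/quot_ind: x => x; rewrite qoppE qaddE; apply/qpiP; rewrite /feq /=; ring.
Qed.

Lemma qmulA : associative qmul.
Proof.
move=> x y z; elim/quot_ind: x => x; elim/quot_ind: y => y; elim/quot_ind: z => z.
by rewrite !qmulE; apply/qpiP; rewrite /feq /=; ring.
Qed.

Lemma qmulC : commutative qmul.
Proof.
move=> x y; elim/quot_ind: x => x; elim/quot_ind: y => y.
by rewrite !qmulE; apply/qpiP; rewrite /feq /=; ring.
Qed.

Lemma qmul1 : left_id qone qmul.
Proof. by move=> x; elim/quot_ind: x => x; rewrite qmulE; apply/qpiP; rewrite /feq /=; ring. Qed.

Lemma qmulDl : left_distributive qmul qadd.
Proof.
move=> x y z; elim/quot_ind: x => x; elim/quot_ind: y => y; elim/quot_ind: z => z.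
by rewrite !(qmulE, qaddE); apply/qpiP; rewrite /feq /=; ring.
Qed.

HB.instance Definition _ := gen_eqMixin quot.
HB.instance Definition _ := gen_choiceMixin quot.
HB.instance Definition _ := GRing.isZmodule.Build quot qaddA qaddC qadd0 qaddN.

Lemma qone_neq0 : qone != (GRing.zero : quot).
Proof.
apply/eqP => /qpiP; rewrite /feq /= => h.
by apply: (Nsucc_neq0 _ r0 HM 0); transitivity (1 * (0 + 1) + 0 * (0 + 1)); [ring|rewrite h; ring].
Qed.

HB.instance Definition _ := GRing.Zmodule_isComNzRing.Build quot qmulA qmulC qmul1 qmulDl qone_neq0.

Lemma quot_pos_neg (P : quot -> Prop) :
  (forall n d, P (qpi (Frac n 0 d))) -> (forall n d, P (qpi (Frac 0 n d))) ->
  forall x, P x.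
Proof.
move=> hp hn x; elim/quot_ind: x => -[p n d].
have [/(Nlt_ex _ r0 HM) [k ->]|[->|/(Nlt_ex _ r0 HM) [k ->]]] := Nlt_total _ r0 HM p n.
- rewrite (_ : qpi _ = qpi (Frac 0 (k + 1) d)) //.
  by apply/qpiP; rewrite /feq /=; ring.
- rewrite (_ : qpi _ = qpi (Frac 0 0 d)) //.
  by apply/qpiP; rewrite /feq /=; ring.
- rewrite (_ : qpi _ = qpi (Frac (k + 1) 0 d)) //.
  by apply/qpiP; rewrite /feq /=; ring.
Qed.

Lemma qinv_ex (x : quot) : exists y : quot, (x <> 0%R -> (y * x)%R = 1%R) /\ (x = 0%R -> y = 0%R).
Proof.
have [->|hx] := pselect (x = 0%R); first by exists 0%R.
suff [y hy] : exists y : quot, (y * x)%R = 1%R by exists y.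
move: x hx; apply: quot_pos_neg => n d; have [->| [k ->]] := N0_or_S _ r0 HM n.
- by case; apply/qpiP; rewrite /feq /=; ring.
- move=> _; exists (qpi (Frac (d + 1) 0 k)).
  by rewrite [LHS]qmulE; apply/qpiP; rewrite /feq /=; ring.
- by case; apply/qpiP; rewrite /feq /=; ring.
- move=> _; exists (qpi (Frac 0 (d + 1) k)).
  by rewrite [LHS]qmulE; apply/qpiP; rewrite /feq /=; ring.
Qed.

Definition qinv (x : quot) : quot := sval (cid (qinv_ex x)).

Lemma qmulV (x : quot) : x != 0%R -> (qinv x * x)%R = 1%R.
Proof. by move=> /eqP; have [h _] := svalP (cid (qinv_ex x)); apply: h. Qed.

Lemma qinv0 : qinv 0%R = 0%R.
Proof. by have [_ h] := svalP (cid (qinv_ex 0%R)); apply: h. Qed.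

HB.instance Definition _ := GRing.ComNzRing_isField.Build quot qmulV qinv0.

Definition qnn (x : quot) := exists n d, x = qpi (Frac n 0 d).
Definition qle (x y : quot) : bool := `[< qnn (y - x)%R >].
Definition qnorm (x : quot) : quot := if qle 0%R x then x else (- x)%R.

Lemma qle0P x : reflect (qnn x) (qle 0%R x).
Proof. by rewrite /qle GRing.subr0; apply: asboolP. Qed.

Lemma qnn_add x y : qle 0%R x -> qle 0%R y -> qle 0%R (x + y)%R.
Proof.
move=> /qle0P [n [d ->]] /qle0P [n' [d' ->]]; apply/qle0P.
exists (n * (d' + 1) + n' * (d + 1)), (d * d' + d + d').
by rewrite [LHS]qaddE; apply/qpiP; rewrite /feq /=; ring.
Qed.

Lemma qnn_mul x y : qle 0%R x -> qle 0%R y -> qle 0%R (x * y)%R.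
Proof.
move=> /qle0P [n [d ->]] /qle0P [n' [d' ->]]; apply/qle0P.
exists (n * n'), (d * d' + d + d').
by rewrite [LHS]qmulE; apply/qpiP; rewrite /feq /=; ring.
Qed.

Lemma qsub_ge0 x y : qle 0%R (y - x)%R = qle x y.
Proof. by rewrite /qle GRing.subr0. Qed.

Lemma qle_anti x : qle 0%R x -> qle x 0%R -> x = 0%R.
Proof.
rewrite -[qle x _]qsub_ge0 GRing.sub0r => /qle0P [n [d ->]] /qle0P [n' [d' /esym]].
rewrite [(- _)%R]qoppE => /qpiP; rewrite /feq /= => h.
have {}h : n' * (d + 1) + n * (d' + 1) = 0.
  by transitivity (n' * (d + 1) + n * (d' + 1)); [ring|rewrite h; ring].
have [n0|[k nk]] := N0_or_S _ r0 HM n.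
  by apply/qpiP; rewrite n0 /feq /=; ring.
case: (Nsucc_neq0 _ r0 HM (n' * (d + 1) + k * d' + k + d')).
by rewrite -[RHS]h nk; ring.
Qed.

Lemma qle_total x : qle 0%R x || qle x 0%R.
Proof.
move: x; apply: quot_pos_neg => n d; apply/orP; [left|right].
  by apply/qle0P; exists n, d.
rewrite -qsub_ge0 GRing.sub0r; apply/qle0P; exists n, d.
by rewrite [LHS]qoppE.
Qed.

Lemma qnormN x : qnorm (- x)%R = qnorm x.
Proof.
have h y : qle 0%R (- y)%R = qle y 0%R by rewrite -[RHS]qsub_ge0 GRing.sub0r.
rewrite /qnorm h GRing.opprK; case: ifP => h1; case: ifP => h2 //.
  by rewrite (qle_anti _ h2 h1) GRing.oppr0.
by have := qle_total x; rewrite h1 h2.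
Qed.

Lemma qnorm_ge0 x : qle 0%R x -> qnorm x = x.
Proof. by rewrite /qnorm => ->. Qed.

HB.instance Definition _ := Num.IntegralDomain_isLeReal.Build quot
  qnn_add qnn_mul qle_anti qsub_ge0 qle_total qnormN qnorm_ge0 (fun x y => erefl).

(** The interface of the construction for all that follows. Its last clause lets a quantifier over
    the field be replaced by quantifiers over numbers, so that statements about rationals remain
    arithmetical. *)
Lemma fraction_field : exists (Q : realFieldType) (io : N -> Q),
  ((io 0 = 0%R) /\ (io 1 = 1%R) /\ (forall m n, io (m + n) = (io m + io n)%R) /\
   (forall m n, io (m * n) = (io m * io n)%R)) /\
  (forall m n, (io m < io n)%R <-> m < n) /\
  (forall q, exists p n d, q = ((io p - io n) / io (add M d (one M)))%R).
Proof.
pose io n := qpi (Frac n 0 0).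
have ioD m n : io (m + n) = (io m + io n)%R.
  by rewrite [RHS]qaddE; apply/qpiP; rewrite /feq /=; ring.
have ioM m n : io (m * n) = (io m * io n)%R.
  by rewrite [RHS]qmulE; apply/qpiP; rewrite /feq /=; ring.
have io_lt m n : m < n -> (io m < io n)%R.
  move=> /(Nlt_ex _ r0 HM) [k ->]; have -> : m + k + 1 = m + (k + 1) by ring.
  rewrite ioD Num.Theory.ltrDl.
  rewrite Order.POrderTheory.lt_def; apply/andP; split.
    apply/eqP => /qpiP; rewrite /feq /= => h; apply: (Nsucc_neq0 _ r0 HM k).
    by transitivity ((k + 1) * (0 + 1) + 0 * (0 + 1)); [ring|rewrite h; ring].
  by rewrite -[(_ <= _)%R]/(qle _ _); apply/qle0P; exists (k + 1), 0.
exists quot, io; do !split=> //.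
- move=> h; have [//|[e|/io_lt h']] := Nlt_total _ r0 HM m n.
    by move: h; rewrite e Order.POrderTheory.ltxx.
  by move: (Order.POrderTheory.lt_trans h h'); rewrite Order.POrderTheory.ltxx.
- exact: io_lt.
- move=> q; elim/quot_ind: q => -[p n d]; exists p, n, d.
  have hd : io (d + 1) != 0%R.
    have /io_lt : 0 < d + 1 by apply/(Nlt_ex _ r0 HM); exists d; ring.
    by rewrite Order.POrderTheory.lt_def => /andP [].
  apply: (GRing.mulIf hd); rewrite GRing.divfK //.
  rewrite [LHS]qmulE [(- _)%R]qoppE [RHS]qaddE; apply/qpiP; rewrite /feq /=; ring.
Qed.

End Fractions.

From mathcomp Require Import ring lra.
Import Order.TTheory GRing.Theory Num.Theory.
Set Implicit Arguments.
Unset Strict Implicit.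

(** * Arithmetical functions *)

(** Bundled so that unification finds the model and its field of fractions. *)
Record aca := Aca {
  acaM : structure;
  aca_asg : nat -> set acaM;
  aca_model : model ACA0 acaM;
  acaQ : realFieldType;
  io : num acaM -> acaQ;
  io0 : io (zer acaM) = 0%R;
  io1 : io (one acaM) = 1%R;
  ioD : forall m n, io (add acaM m n) = (io m + io n)%R;
  ioM : forall m n, io (mul acaM m n) = (io m * io n)%R;
  io_lt : forall m n, (io m < io n)%R <-> lt acaM m n;
  io_frac : forall q, exists p n d, q = ((io p - io n) / io (add acaM d (one acaM)))%R }.

Section Arithmetic.
Variable A : aca.
Local Notation M := (acaM A).
Local Notation N := (num M).
Local Notation Q := (acaQ A).
Local Notation io := (@io A).
Local Notation env := (nat -> N).
Local Notation Ar := (Ar M).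
Local Notation AT := (AT M).
Local Notation succ n := (add M n (one M)).
Local Open Scope ring_scope.

Definition ioE := (@io0 A, @io1 A, @ioD A, @ioM A).

Lemma io_inj m n : io m = io n -> m = n.
Proof.
move=> e; have [/io_lt|[//|/io_lt]] := Nlt_total M (@aca_asg A) (@aca_model A) m n;
  by rewrite e ltxx.
Qed.

Lemma lt_ex m n : (io m < io n) -> exists k, io n = io m + io k + 1.
Proof.
move/io_lt/(Nlt_ex M (@aca_asg A) (@aca_model A)) => [k ->]; exists k.
by rewrite !ioE.
Qed.

Lemma N_cases n : n = zer M \/ exists k, n = succ k.
Proof. exact: N0_or_S (@aca_asg A) (@aca_model A) n. Qed.

Lemma N_ind P : Ar (fun e => P (e 0%nat)) -> P (zer M) ->
  (forall n, P n -> P (succ n)) -> forall n, P n.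
Proof. exact: nat_ind_Ar (@aca_asg A) (@aca_model A) P. Qed.

Lemma N_compr P : Ar (fun e => P (e 0%nat)) -> exists X, forall n, mem M n X <-> P n.
Proof. exact: comprehension_Ar (@aca_asg A) (@aca_model A) P. Qed.

Lemma io_ge0 n : 0 <= io n.
Proof.
rewrite -io0 leNgt; apply/negP => /io_lt.
exact: Nltn0 (@aca_asg A) (@aca_model A) n.
Qed.

Lemma io_succ n : io (succ n) = io n + 1.
Proof. by rewrite !ioE. Qed.

Lemma io_succ_gt0 n : 0 < io (succ n).
Proof. by rewrite io_succ ltr_wpDl // io_ge0. Qed.

Lemma io_ge1 n : 0 < io n -> 1 <= io n.
Proof.
by have [->|[k ->]] := N_cases n; rewrite ?io0 ?ltxx // io_succ lerDr io_ge0.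
Qed.

Lemma io_ltS m n : io m < io n + 1 -> io m <= io n.
Proof.
rewrite -io_succ => /lt_ex [k]; rewrite io_succ => e.
by have := io_ge0 k; lra.
Qed.

Lemma io_le m n : io m <= io n -> exists k, io n = io m + io k.
Proof.
rewrite le_eqVlt => /orP [/eqP ->|/lt_ex [k ->]]; first by exists (zer M); rewrite io0 addr0.
by exists (succ k); rewrite io_succ addrA.
Qed.

Lemma AT_subst f : AT f -> forall s : nat -> env -> N, (forall i, AT (s i)) ->
  AT (fun e => f (fun i => s i e)).
Proof.
elim=> {f} [i|c|f g _ IHf _ IHg|f g _ IHf _ IHg] s hs; first exact: hs.
- exact: AT_cst.
- by apply: AT_add; [apply: IHf|apply: IHg].
- by apply: AT_mul; [apply: IHf|apply: IHg].
Qed.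

Lemma Ar_subst P : Ar P -> forall s : nat -> env -> N, (forall i, AT (s i)) ->
  Ar (fun e => P (fun i => s i e)).
Proof.
elim=> {P} [f g hf hg|f g hf hg|f X hf||P R _ IHP _ IHR|P _ IH] s hs.
- by apply: Ar_eq; apply: AT_subst.
- by apply: Ar_lt; apply: AT_subst.
- by apply: Ar_mem; apply: AT_subst.
- exact: Ar_bot.
- by apply: Ar_imp; [apply: IHP|apply: IHR].
- pose s' := scons (fun e : env => e 0%nat) (fun i e => s i (fun n => e (S n))).
  apply: (@Ar_ext M (fun e => forall x, P (fun i => s' i (scons x e)))).
    apply: (@Ar_scons M (fun e => P (fun i => s' i e))); apply: IH => -[|i] /=.
      exact: AT_var.
    by apply: (AT_subst (hs i) (s := fun n e => e (S n))) => n; apply: AT_var.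
  move=> e; split=> h x; have := h x; congr P; apply: funext => -[|i] //=.
Qed.

(** A function is arithmetical if its graph is. This admits functions obtained by recursion or by
    unique choice, for which there is no term. *)
Definition Af (f : env -> N) := Ar (fun e => e 0%nat = f (fun n => e (S n))).

Lemma Af_AT f : AT f -> Af f.
Proof.
move=> hf; apply: Ar_eq; first exact: AT_var.
by apply: (AT_subst hf (s := fun n e => e (S n))) => n; apply: AT_var.
Qed.

Lemma Af_var i : Af (fun e => e i). Proof. by apply: Af_AT; apply: AT_var. Qed.
Lemma Af_cst c : Af (fun _ => c). Proof. by apply: Af_AT; apply: AT_cst. Qed.

Lemma Af_shift f : Af f -> Af (fun e => f (fun n => e (S n))).
Proof.
move=> hf.
by apply: (Ar_subst hf (s := fun n e => scons (e 0%nat) (fun n => e (S (S n))) n)) => -[|n];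
   apply: AT_var.
Qed.

Lemma Ar_inst R f : Ar (fun e => R (fun n => e (S n)) (e 0%nat)) -> Af f ->
  Ar (fun e => R e (f e)).
Proof.
move=> hR hf; apply: (@Ar_ext M (fun e => exists x, x = f e /\ R e x)).
  by apply: Ar_ex; apply: Ar_and.
by move=> e; split=> [[x [->]]|h] //; exists (f e).
Qed.

(** The functions are put in one at a time by [Ar_inst]; the variables that are left over keep their
    order, whence the subtraction in the index. *)
Lemma Ar_prefix P n : Ar P -> forall fs : nat -> env -> N, (forall i, Af (fs i)) ->
  Ar (fun e => P (fun i => if Nat.ltb i n then fs i e else e (Nat.sub i n))).
Proof.
move=> hP; elim: n => [|n IH] fs hfs.
  by apply: Ar_ext hP _ => e; split; congr P; apply: funext => i /=;
    rewrite Nat.sub_0_r.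
have := IH (fun i e => fs i (fun n => e (S n))) (fun i => Af_shift (hfs i)).
set P' := fun e => _ => hP'.
apply: (@Ar_ext M (fun e => P' (scons (fs n e) e))).
  apply: (@Ar_inst (fun e x => P' (scons x e))) => //.
  apply: Ar_ext hP' _ => e; rewrite (_ : scons _ _ = e) //.
  by apply: funext => -[|i].
move=> e; rewrite /P' /=; set u := fun i => _; set v := fun i => _.
suff -> : u = v by [].
apply: funext => i; rewrite /u /v; case: (Nat.ltb_spec i n); case: (Nat.ltb_spec i (S n)) => h1 h2;
  try lia; first by [].
  have -> : i = n by lia.
  by rewrite Nat.sub_diag.
by have -> : Nat.sub i n = S (Nat.sub i (S n)) by lia.
Qed.

Fixpoint lookup (fs : list (env -> N)) (e : env) (i : nat) : N :=
  match fs, i with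
  | nil, _ => zer M
  | cons f fs, 0%nat => f e
  | cons f fs, S i => lookup fs e i
  end.

Lemma Ar_lookup P fs : Ar P -> List.Forall Af fs -> Ar (fun e => P (lookup fs e)).
Proof.
move=> hP hfs; pose g i := List.nth i fs (fun _ => zer M).
have hg i : Af (g i).
  rewrite /g; elim: hfs i => [|f fs' hf _ IH] [|i] //=; exact: Af_cst.
apply: Ar_ext (Ar_prefix (length fs) (@Ar_subst _ hP (fun i => if Nat.ltb i (length fs) then (fun e => e i) else fun _ => zer M) _) hg) _ => [i|e].
  by case: ifP => _; [apply: AT_var|apply: AT_cst].
rewrite /=; set u := fun i => _; suff -> : u = lookup fs e by [].
apply: funext => i; rewrite /u; case: (Nat.ltb_spec i (length fs)) => [h|h].
  move/Nat.ltb_lt: (h) => ->.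
  rewrite /g {u hg hfs g}; elim: fs i h => [|f fs IH] [|i] h //=; try (cbn in h; lia).
  by apply: IH; cbn in h; lia.
elim: fs i h {u hg hfs g} => [|f fs IH] [|i] h //=; try (cbn in h; lia).
by apply: IH; cbn in h; lia.
Qed.

Lemma Af_lookup f fs : Af f -> List.Forall Af fs -> Af (fun e => f (lookup fs e)).
Proof.
move=> hf hfs.
have h : List.Forall Af (cons (fun e => e 0%nat) (List.map (fun f e => f (fun n => e (S n))) fs)).
  constructor; first exact: Af_var.
  by elim: hfs => [|g gs hg _ IH] /=; constructor=> //; apply: Af_shift.
apply: Ar_ext (Ar_lookup hf h) _ => e /=.
rewrite (_ : (fun n => _) = lookup fs (fun n => e (S n))) //.
apply: funext; elim: {hfs h} fs => [|g gs IH] [|i] //=.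
Qed.

Ltac lookup h fs := first
  [ apply: (Ar_lookup (fs := fs) h) | apply: (Af_lookup (fs := fs) h) ];
  repeat constructor => //.

Lemma Af_add f g : Af f -> Af g -> Af (fun e => add M (f e) (g e)).
Proof.
move=> hf hg.
have h : Af (fun e => add M (e 0%nat) (e 1%nat)).
  by apply: Af_AT; apply: AT_add; apply: AT_var.
by lookup h (cons f (cons g nil)).
Qed.

Lemma Af_mul f g : Af f -> Af g -> Af (fun e => mul M (f e) (g e)).
Proof.
move=> hf hg.
have h : Af (fun e => mul M (e 0%nat) (e 1%nat)).
  by apply: Af_AT; apply: AT_mul; apply: AT_var.
by lookup h (cons f (cons g nil)).
Qed.

Lemma Af_fun (phi : N -> N) f : Af (fun e => phi (e 0%nat)) -> Af f -> Af (fun e => phi (f e)).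
Proof. by move=> h hf; lookup h (cons f nil). Qed.

Lemma Ar_feq f g : Af f -> Af g -> Ar (fun e => f e = g e).
Proof.
move=> hf hg; have h : Ar (fun e => e 0%nat = e 1%nat) by apply: Ar_eq; apply: AT_var.
by lookup h (cons f (cons g nil)).
Qed.

Lemma Ar_flt f g : Af f -> Af g -> Ar (fun e => lt M (f e) (g e)).
Proof.
move=> hf hg; have h : Ar (fun e => lt M (e 0%nat) (e 1%nat)) by apply: Ar_lt; apply: AT_var.
by lookup h (cons f (cons g nil)).
Qed.

Lemma Ar_fmem f X : Af f -> Ar (fun e => mem M (f e) X).
Proof.
move=> hf; have h : Ar (fun e => mem M (e 0%nat) X) by apply: Ar_mem; apply: AT_var.
by lookup h (cons f nil).
Qed.

Lemma Ar_app1 (R : N -> Prop) f : Ar (fun e => R (e 0%nat)) -> Af f -> Ar (fun e => R (f e)).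
Proof. by move=> h hf; lookup h (cons f nil). Qed.

Lemma Ar_app2 (R : N -> N -> Prop) f g : Ar (fun e => R (e 0%nat) (e 1%nat)) -> Af f -> Af g ->
  Ar (fun e => R (f e) (g e)).
Proof. by move=> h hf hg; lookup h (cons f (cons g nil)). Qed.

(** * Rational-valued arithmetical functions *)

Definition tQ (f : env -> Q) := exists p n d, [/\ Af p, Af n, Af d &
  forall e, f e = (io (p e) - io (n e)) / io (succ (d e))].

Lemma io_succ_neq0 n : io (succ n) != 0.
Proof. by rewrite gt_eqF // io_succ_gt0. Qed.

Lemma tQ_cst q : tQ (fun _ => q).
Proof.
have [p [n [d h]]] := io_frac q.
by exists (fun _ => p), (fun _ => n), (fun _ => d); split=> //; apply: Af_cst.
Qed.

Lemma tQ_io f : Af f -> tQ (fun e => io (f e)).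
Proof.
move=> hf; exists f, (fun _ => zer M), (fun _ => zer M); split=> //; try exact: Af_cst.
by move=> e; rewrite !ioE; field.
Qed.

Lemma tQ_opp f : tQ f -> tQ (fun e => - f e).
Proof.
move=> [p [n [d [hp hn hd h]]]]; exists n, p, d; split=> // e.
by rewrite h; field; apply: io_succ_neq0.
Qed.

Lemma tQ_add f g : tQ f -> tQ g -> tQ (fun e => f e + g e).
Proof.
move=> [p [n [d [hp hn hd h]]]] [p' [n' [d' [hp' hn' hd' h']]]].
pose P e := add M (mul M (p e) (succ (d' e))) (mul M (p' e) (succ (d e))).
pose P' e := add M (mul M (n e) (succ (d' e))) (mul M (n' e) (succ (d e))).
pose P'' e := add M (add M (mul M (d e) (d' e)) (d e)) (d' e).
exists P, P', P''; split; try by do ! first [exact: Af_cst|apply: Af_add|apply: Af_mul].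
move=> e; rewrite h h' /P /P' /P''.
have := io_succ_neq0 (d e); have := io_succ_neq0 (d' e).
rewrite !ioE => h1 h2; field; rewrite h1 h2 /= andbT.
have -> : io (d e) * io (d' e) + io (d e) + io (d' e) + 1 = (io (d e) + 1) * (io (d' e) + 1) by ring.
by rewrite mulf_neq0.
Qed.

Lemma tQ_mul f g : tQ f -> tQ g -> tQ (fun e => f e * g e).
Proof.
move=> [p [n [d [hp hn hd h]]]] [p' [n' [d' [hp' hn' hd' h']]]].
pose P e := add M (mul M (p e) (p' e)) (mul M (n e) (n' e)).
pose P' e := add M (mul M (p e) (n' e)) (mul M (n e) (p' e)).
pose P'' e := add M (add M (mul M (d e) (d' e)) (d e)) (d' e).
exists P, P', P''; split; try by do ! first [exact: Af_cst|apply: Af_add|apply: Af_mul].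
move=> e; rewrite h h' /P /P' /P''.
have := io_succ_neq0 (d e); have := io_succ_neq0 (d' e).
rewrite !ioE => h1 h2; field; rewrite h1 h2 /= andbT.
have -> : io (d e) * io (d' e) + io (d e) + io (d' e) + 1 = (io (d e) + 1) * (io (d' e) + 1) by ring.
by rewrite mulf_neq0.
Qed.

Lemma tQ_inv f : Af f -> tQ (fun e => (io (succ (f e)))^-1).
Proof.
move=> hf; exists (fun _ => one M), (fun _ => zer M), f; split=> //; try exact: Af_cst.
by move=> e; rewrite !ioE subr0 mul1r.
Qed.

Lemma Ar_qlt f g : tQ f -> tQ g -> Ar (fun e => f e < g e).
Proof.
move=> [p [n [d [hp hn hd h]]]] [p' [n' [d' [hp' hn' hd' h']]]].
apply: (@Ar_ext M (fun e => lt M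
  (add M (mul M (p e) (succ (d' e))) (mul M (n' e) (succ (d e))))
  (add M (mul M (p' e) (succ (d e))) (mul M (n e) (succ (d' e)))))) => [|e].
  by apply: Ar_flt; do ! first [exact: Af_cst|apply: Af_add|apply: Af_mul].
rewrite -io_lt h h' ltr_pdivrMr ?io_succ_gt0 // mulrAC ltr_pdivlMr ?io_succ_gt0 //.
by rewrite !ioE; split=> ?; lra.
Qed.

Lemma Ar_qle f g : tQ f -> tQ g -> Ar (fun e => f e <= g e).
Proof.
move=> hf hg; apply: Ar_ext (Ar_not (Ar_qlt hg hf)) _ => e.
by rewrite leNgt; split=> /negP.
Qed.

Lemma Ar_qeq f g : tQ f -> tQ g -> Ar (fun e => f e = g e).
Proof.
move=> hf hg; apply: Ar_ext (Ar_and (Ar_qle hf hg) (Ar_qle hg hf)) _ => e.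
by split=> [[h1 h2]|->]; [apply/eqP; rewrite eq_le h1 h2|rewrite lexx].
Qed.

Lemma Ar_and3 P1 P2 P3 : Ar P1 -> Ar P2 -> Ar P3 -> Ar (fun e => [/\ P1 e, P2 e & P3 e]).
Proof.
move=> h1 h2 h3; apply: Ar_ext (Ar_and h1 (Ar_and h2 h3)) _ => e.
by split=> [[? []]|[]].
Qed.

Lemma Ar_exrat (R : env -> mrat M -> Prop) :
  Ar (fun e => R (fun n => e (S (S (S n)))) (MRat M (e 2%nat) (e 1%nat) (e 0%nat))) ->
  Ar (fun e => exists q, R e q).
Proof.
move=> h; apply: (@Ar_ext M (fun e => exists p n d, R e (MRat M p n d))) => [|e].
  by do 3 apply: Ar_ex.
by split=> [[p [n [d hq]]]|[[p n d] hq]]; [exists (MRat M p n d)|exists p, n, d].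
Qed.

Lemma Ar_appQ (R : N -> N -> Q -> Prop) f g s :
  Ar (fun e => R (e 0%nat) (e 1%nat)
                 ((io (e 2%nat) - io (e 3%nat)) / io (succ (e 4%nat)))) ->
  Af f -> Af g -> tQ s -> Ar (fun e => R (f e) (g e) (s e)).
Proof.
move=> h hf hg [p [n [d [hp hn hd hs]]]].
apply: Ar_ext (_ : Ar (fun e => R (f e) (g e) ((io (p e) - io (n e)) / io (succ (d e))))) _.
  by lookup h (cons f (cons g (cons p (cons n (cons d nil))))).
by move=> e; rewrite hs.
Qed.

Lemma Ar_allQ (R : env -> Q -> Prop) :
  Ar (fun e => R (fun n => e (S (S (S n))))
                 ((io (e 2%nat) - io (e 1%nat)) / io (succ (e 0%nat)))) ->
  Ar (fun e => forall q, R e q).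
Proof.
move=> h.
apply: (@Ar_ext M (fun e => forall p n d, R e ((io p - io n) / io (succ d)))) => [|e].
  by do 3 apply: Ar_all.
split=> {}h => [q|p n d]; last exact: h.
by have [p [n [d ->]]] := io_frac q.
Qed.

Lemma Ar_exQ (R : env -> Q -> Prop) :
  Ar (fun e => R (fun n => e (S (S (S n))))
                 ((io (e 2%nat) - io (e 1%nat)) / io (succ (e 0%nat)))) ->
  Ar (fun e => exists q, R e q).
Proof.
move=> h; apply: Ar_ext (Ar_not (@Ar_allQ (fun e q => ~ R e q) (Ar_not h))) _ => e.
split=> [{}h|[x hx] {}h]; last exact: h hx.
by apply: contrapT => h'; apply: h => x hx; apply: h'; exists x.
Qed.

End Arithmetic.

(** Rules for the predicates defined below are added by redefinition. *)
Ltac ar_user := fail.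

Ltac ar_step :=
  match goal with
  | |- @Af _ _ => first
    [ assumption | apply: Af_var | apply: Af_cst | apply: Af_add | apply: Af_mul
    | apply: Af_fun; [assumption|] | ar_user ]
  | |- @tQ _ _ => first
    [ assumption | apply: tQ_cst | ar_user | apply: tQ_inv | apply: tQ_io | apply: tQ_opp | apply: tQ_add
    | apply: tQ_mul ]
  | |- Ar _ _ => first
    [ assumption | ar_user
    | apply: Ar_not | apply: Ar_and | apply: Ar_or | apply: Ar_iff
    | apply: Ar_and3 | apply: Ar_ex | apply: Ar_exQ | apply: Ar_exrat | apply: Ar_feq | apply: Ar_flt
    | apply: Ar_qeq | apply: Ar_qlt | apply: Ar_qle | apply: Ar_fmem
    | apply: Ar_bot | apply: Ar_true
    | apply: Ar_imp | apply: Ar_all | apply: Ar_allQ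
    | apply: Ar_app1; [assumption|] | apply: Ar_app2; [assumption| |] ]
  end; cbn [mpos mneg mden].

Ltac ar := repeat ar_step.

(** * Powers of two *)

Section Powers.
Variable A : aca.
Local Notation M := (acaM A).
Local Notation N := (num M).
Local Notation Q := (acaQ A).
Local Notation io := (@io A).
Local Notation Ar := (Ar M).
Local Notation succ n := (add M n (one M)).
Local Notation mpair := (mpair M).
Local Open Scope ring_scope.

Lemma N_least P : Ar (fun e => P (e 0%nat)) -> (exists n, P n) ->
  exists n, P n /\ forall m, io m < io n -> ~ P m.
Proof.
move=> hP [n hn]; apply: contrapT => hmin.
have : forall n m, io m < io n -> ~ P m.
  apply: N_ind; first by ar.
    by move=> m; rewrite io0 ltNge io_ge0.
  move=> k IH m; rewrite io_succ => /io_ltS; rewrite le_eqVlt => /orP [/eqP /io_inj ->|/IH //].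
  by move=> hk; apply: hmin; exists k.
by move=> /(_ (succ n) n); apply=> //; rewrite io_succ ltrDl.
Qed.

(** Uniqueness makes [R] itself the graph of the chosen function, which is therefore arithmetical
    although the axiom of choice provides it. *)
Lemma Af_choice (R : N -> N -> Prop) : Ar (fun e => R (e 0%nat) (e 1%nat)) ->
  (forall x, exists y, R x y) -> (forall x y y', R x y -> R x y' -> y = y') ->
  exists phi : N -> N, Af (fun e => phi (e 0%nat)) /\ forall x y, R x y <-> y = phi x.
Proof.
move=> hR /choice [phi hphi] huniq.
have E x y : R x y <-> y = phi x.
  by split=> [h|->]; [apply: huniq h _; apply: hphi|apply: hphi].
exists phi; split=> //; apply: Ar_ext (_ : Ar (fun e => R (e 1%nat) (e 0%nat))) _ => //.
by ar.
Qed.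

Lemma tQ_invn f : Af f -> tQ (fun e => (io (f e))^-1 : Q).
Proof.
have F k : succ k <> zer M.
  by move=> /(congr1 io); have := io_succ_gt0 k => + h; rewrite h io0 ltxx.
move=> hf.
(* [sg] is 0 at 0 and 1 elsewhere, and [pr] is the predecessor. The reciprocal, which is 0 at 0 in
   the field, is then [sg / (pr + 1)]. *)
have [|||sg [h1 hsg]] := @Af_choice (fun x y => (x = zer M /\ y = zer M) \/
    ((exists k, x = succ k) /\ y = one M)); first by ar.
- by move=> x; have [e|h] := N_cases x; [exists (zer M); left|exists (one M); right].
- move=> a y y' [[a0 ->]|[[k ak] ->]] [[a0' ->]|[[k' ak'] ->]] //.
  + by case: (F k'); rewrite -ak'.
  + by case: (F k); rewrite -ak.
have [|||pr [h2 hpr]] := @Af_choice (fun x y => (x = zer M /\ y = zer M) \/ x = succ y).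
- by ar.
- by move=> x; have [e|[k e]] := N_cases x; [exists (zer M); left|exists k; right].
- move=> a y y' [[a0 ->]|ay] [[a0' ->]|ay'] //.
  + by case: (F y'); rewrite -ay'.
  + by case: (F y); rewrite -ay.
  + by move: ay; rewrite ay' => /(congr1 io); rewrite !io_succ => /addIr /io_inj.
have -> : (fun e => (io (f e))^-1 : Q) = (fun e => io (sg (f e)) * (io (succ (pr (f e))))^-1).
  apply: funext => e; have [h0|[k hk]] := N_cases (f e).
    have <- : zer M = sg (f e) by apply/hsg; left.
    by rewrite h0 io0 invr0 mul0r.
  have <- : one M = sg (f e) by apply/hsg; right; split=> //; exists k.
  have <- : k = pr (f e) by apply/hpr; right.
  by rewrite hk io1 mul1r.
by ar.
Qed.

(** With [s = x + y], the code [s * s + x] is at least [s * s] and less than [(s + 1) * (s + 1)],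
    because [x <= s]; so it determines [s], and then [x]. *)
Lemma mpair_inj x y x' y' : mpair x y = mpair x' y' -> x = x' /\ y = y'.
Proof.
move=> /(congr1 io); rewrite /mpair !ioE.
have lt_sq (s t a b : Q) : 0 <= a -> a <= s -> 0 <= b -> s + 1 <= t -> s * s + a < t * t + b.
  move=> a0 sa b0 st; have : (s + 1) * (s + 1) <= t * t by apply: ler_pM; lra.
  by lra.
have [hx hy hx' hy'] : [/\ 0 <= io x, 0 <= io y, 0 <= io x' & 0 <= io y'].
  by split; apply: io_ge0.
move=> e; have es : io x + io y = io x' + io y'.
  rewrite -!ioD; have [/lt_ex [k]|/lt_ex [k]|-> //] := ltgtP (io (add M x y)) (io (add M x' y'));
  rewrite !ioD => h; have hk := io_ge0 k.
    have : io x + io y + 1 <= io x' + io y' by lra.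
    by move=> /(lt_sq _ _ (io x) (io x')); rewrite e ltxx; lra.
  have : io x' + io y' + 1 <= io x + io y by lra.
  by move=> /(lt_sq _ _ (io x') (io x)); rewrite e ltxx; lra.
have ex : io x = io x' by move: e; rewrite es => /addrI.
by split; apply: io_inj => //; move: es; rewrite ex => /addrI.
Qed.

(** * Goedel's moduli and the powers of two *)

Lemma common_multiple B : exists m, 0 < io m /\
  forall i, 0 < io i -> io i <= io B -> exists k, m = mul M i k.
Proof.
move: B; apply: N_ind; first by ar.
  by exists (one M); rewrite io1; split=> // i h; rewrite io0 leNgt h.
move=> B [m [m0 hm]]; exists (mul M m (succ B)); split.
  by rewrite ioM mulr_gt0 // io_succ_gt0.
move=> i i0; rewrite le_eqVlt => /orP [/eqP /io_inj ->|].
  by exists m; apply: io_inj; rewrite !ioE; ring.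
rewrite io_succ => /io_ltS /(hm _ i0) [k ->]; exists (mul M k (succ B)).
by apply: io_inj; rewrite !ioE; ring.
Qed.

(** The moduli of Goedel's beta function: if all [i] with [0 < i <= B] divide [m], those with
    [z < B] are pairwise coprime. *)
Definition modulus m z := succ (mul M (succ z) m).

Lemma modulus_gt0 m z : 0 < io (modulus m z).
Proof. exact: io_succ_gt0. Qed.

(* [modulus m z] is prime to [m], as it is congruent to 1 modulo [m]. *)
Lemma modulus_dvd_sq c m z p n :
  io c * io m ^+ 2 = io (modulus m z) * (io p - io n) -> exists y, c = mul M (modulus m z) y.
Proof.
have := modulus_gt0 m z; rewrite /modulus !ioE => q0 h.
(* With [a = (z + 1) * m] one has [c = c * (1 - a ^ 2) + (z + 1) ^ 2 * c * m ^ 2], and [1 + a]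
   divides both summands. The quotient is [P - R], first written as a difference of numbers. *)
pose P := add M c (mul M p (mul M (succ z) (succ z))).
pose R := add M (mul M c (mul M (succ z) m)) (mul M n (mul M (succ z) (succ z))).
have E : ((io z + 1) * io m + 1) * (io P - io R) = io c.
  rewrite /P /R !ioE.
  transitivity (io c * (1 - ((io z + 1) * io m) ^+ 2) + (io z + 1) ^+ 2 *
    (((io z + 1) * io m + 1) * (io p - io n))); first by ring.
  by rewrite -h; ring.
have [k hk] : exists k, io P = io R + io k.
  by apply: io_le; rewrite -subr_ge0 -(pmulr_rge0 _ q0) E io_ge0.
exists k; apply: io_inj; rewrite !ioE -E hk; ring.
Qed.

(** Modulo [modulus m z] the other modulus is [(w - z) * m]. Since [w - z] divides [m], divisibility
    passes on to [c * m ^ 2], where [modulus_dvd_sq] applies. *)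
Lemma modulus_prime B m z w c x : (forall i, 0 < io i -> io i <= io B -> exists k, m = mul M i k) ->
  io z < io B -> io w < io B -> z <> w ->
  mul M c (modulus m w) = mul M (modulus m z) x -> exists y, c = mul M (modulus m z) y.
Proof.
move=> hm hz hw hzw /(congr1 io); rewrite /modulus !ioE => e.
have B0 := io_ge0 z; have B1 := io_ge0 w.
have [/lt_ex [k hk]|/lt_ex [k hk]|/io_inj //] := ltgtP (io z) (io w).
- have [||u hu] := hm (succ k); rewrite ?io_succ_gt0 // ?io_succ; first by have := io_ge0 k; lra.
  apply: (@modulus_dvd_sq c m z (mul M x u) (mul M c u)); rewrite /modulus !ioE.
  have hu2 : io m = (io k + 1) * io u by rewrite hu !ioE.
  have -> : io c * io m ^+ 2 = io c * io m * ((io k + 1) * io u) by rewrite expr2 {2}hu2; ring.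
  transitivity ((io c * ((io w + 1) * io m + 1) - io c * ((io z + 1) * io m + 1)) * io u).
    by rewrite hk; ring.
  by rewrite e; ring.
- have [||u hu] := hm (succ k); rewrite ?io_succ_gt0 // ?io_succ; first by have := io_ge0 k; lra.
  apply: (@modulus_dvd_sq c m z (mul M c u) (mul M x u)); rewrite /modulus !ioE.
  have hu2 : io m = (io k + 1) * io u by rewrite hu !ioE.
  have -> : io c * io m ^+ 2 = io c * io m * ((io k + 1) * io u) by rewrite expr2 {2}hu2; ring.
  transitivity ((io c * ((io z + 1) * io m + 1) - io c * ((io w + 1) * io m + 1)) * io u).
    by rewrite hk; ring.
  by rewrite e; ring.
Qed.

(* Goedel's coding of finite sets by divisibility: it is needed only to show that
   the function [2 ^ k] of the statement exists. *)
Lemma code_set P B : Ar (fun e => P (e 0%nat)) ->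
  exists m c, forall z, io z < io B -> ((exists k, c = mul M (modulus m z) k) <-> P z).
Proof.
move=> hP; have [m [m0 hm]] := common_multiple B.
(* [m] depends on [B], so the induction keeps [B] and runs over a second bound [C]; each element of
   [P] multiplies the code by its modulus. *)
suff : forall C, io C <= io B -> exists c, forall z, io z < io B ->
    ((exists k, c = mul M (modulus m z) k) <-> (io z < io C /\ P z)).
  move=> /(_ B (lexx _)) [c hc]; exists m, c => z hz; rewrite hc //.
  by split=> [[]|].
apply: N_ind; first by rewrite /modulus; ar.
  move=> _; exists (one M) => z hz; split=> [[k /(congr1 io)]|[]]; last first.
    by rewrite io0 ltNge io_ge0.
  rewrite ioM /modulus !ioE; have h0 := io_ge0 k; have h1 := io_ge0 z.
  have [->|[j ->]] := N_cases k; first by rewrite io0 mulr0 => /eqP; rewrite oner_eq0.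
  have h2 := io_ge0 j; rewrite io_succ => e; exfalso.
  have : 0 < (io z + 1) * io m by nra.
  by nra.
move=> C IH hC; have [|c hc] := IH.
  by apply: le_trans hC; rewrite io_succ; lra.
have hCB : io C < io B by apply: lt_le_trans hC; rewrite io_succ ltrDl.
have ltS z : io z < io (succ C) <-> io z < io C \/ z = C.
  rewrite io_succ; split=> [/io_ltS|[h| ->]]; last by lra.
    by rewrite le_eqVlt => /orP [/eqP /io_inj|]; [right|left].
  by lra.
have [pC|npC] := pselect (P C); last first.
  exists c => z hz; rewrite hc // ltS; split=> [[h p]|[[h|e] p]]; [by split; [left|]|by []|].
  by case: npC; rewrite -e.
exists (mul M c (modulus m C)) => z hz; rewrite ltS.
have [->|hzC] := pselect (z = C).
  split=> _; first by split; [right|].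
  by exists c; apply: io_inj; rewrite !ioE mulrC.
split=> [[k hk]|[[h|//] p]].
  have [h1 h2] : io z < io C /\ P z.
    by apply/hc => //; apply: modulus_prime hm hz hCB hzC hk.
  by split; [left|].
have [k hk] : exists k, c = mul M (modulus m z) k by apply/hc.
exists (mul M k (modulus m C)); rewrite hk; apply: io_inj; rewrite !ioE; ring.
Qed.

Definition in_code m c B z := io z < io B /\ exists k, c = mul M (modulus m z) k.

(* A finite set of pairs [(j, w)] closed under [(j + 1, 2 w) -> (j, w)] contains
   only pairs with [w = 2 ^ j]. *)
Definition pow_code m c B := forall j w, in_code m c B (mpair j w) ->
  (j = zer M /\ w = one M) \/
  exists j' w', j = succ j' /\ w = add M w' w' /\ in_code m c B (mpair j' w').

Definition pow_graph k y := exists m c B, in_code m c B (mpair k y) /\ pow_code m c B.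

Lemma Ar_pow_graph : Ar (fun e => pow_graph (e 0%nat) (e 1%nat)).
Proof. by rewrite /pow_graph /pow_code /in_code /modulus /mpair; ar. Qed.

Lemma pow_graph_uniq k : forall y y', pow_graph k y -> pow_graph k y' -> y = y'.
Proof.
move: k; apply: N_ind.
- have h := Ar_pow_graph.
  have h' f g : Af f -> Af g -> Ar (fun e => pow_graph (f e) (g e)) by move=> *; apply: Ar_app2.
  by do ! first [apply: h'|ar_step].
- move=> y y' [m [c [B [h hc]]]] [m' [c' [B' [h' hc']]]].
  case: (hc _ _ h) => [[_ ->]|[j [w [/esym /Nsucc_neq0 F _]]]]; last first.
    by case: F; [exact: (@aca_asg A)|exact: (@aca_model A)].
  case: (hc' _ _ h') => [[_ ->] //|[j [w [/esym /Nsucc_neq0 F _]]]].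
  by case: F; [exact: (@aca_asg A)|exact: (@aca_model A)].
- move=> k IH y y' [m [c [B [h hc]]]] [m' [c' [B' [h' hc']]]].
  have F : succ k <> zer M.
    by apply: Nsucc_neq0; [exact: (@aca_asg A)|exact: (@aca_model A)].
  have inj j : succ k = succ j -> k = j by move=> /(congr1 io); rewrite !io_succ => /addIr /io_inj.
  case: (hc _ _ h) => [[/F]//|[j [w [/inj <- [-> hw]]]]].
  case: (hc' _ _ h') => [[/F]//|[j' [w' [/inj <- [-> hw']]]]].
  by rewrite (IH w w') //; [exists m, c, B|exists m', c', B'].
Qed.

Lemma pow_graph0 : pow_graph (zer M) (one M).
Proof.
pose z0 := mpair (zer M) (one M).
have [|m [c h]] := @code_set (fun z => z = z0) (succ z0); first by ar.
have h0 : in_code m c (succ z0) z0.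
  by rewrite /in_code io_succ ltrDl ltr01; split=> //; apply/h => //; rewrite io_succ ltrDl.
exists m, c, (succ z0); split=> // j w [h1 h2]; left.
by have /mpair_inj : mpair j w = z0 by apply/h.
Qed.

Lemma pow_graphS k y : pow_graph k y -> pow_graph (succ k) (add M y y).
Proof.
move=> [m [c [B [hk hc]]]].
pose z0 := mpair (succ k) (add M y y); pose B' := add M (succ z0) B.
have [|m' [c' h]] := @code_set (fun z => in_code m c B z \/ z = z0) B'.
  by rewrite /in_code /modulus; ar.
have BB' : io B < io B' by rewrite /B' ioD ltrDr io_succ_gt0.
have E z : in_code m' c' B' z <-> in_code m c B z \/ z = z0.
  split=> [[h1 h2]|hz]; first exact/h.
  have hB : io z < io B'.
    case: hz => [[h1 _]| ->]; first exact: lt_trans BB'.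
    rewrite /B' ioD io_succ; have := io_ge0 B; lra.
  by split=> //; apply/h.
exists m', c', B'; split; first by apply/E; right.
move=> j w /E [/hc [h0|[j' [w' [-> [-> h']]]]]|/mpair_inj [-> ->]]; first by left.
  by right; exists j', w'; split=> //; split=> //; apply/E; left.
by right; exists k, y; split=> //; split=> //; apply/E; left.
Qed.

(** The set that [mpow2] asks for exists by comprehension from the graph of [f]; conversely, any
    such set contains this graph, by induction. *)
Lemma pow2_function : exists f : N -> N, [/\ Af (fun e => f (e 0%nat)),
  f (zer M) = one M, (forall n, f (succ n) = add M (f n) (f n)) &
  forall k y, mpow2 M (rocq_logic M) k y <-> y = f k].
Proof.
have [||f [hf E]] := Af_choice Ar_pow_graph; last 1 first.
- have E0 : f (zer M) = one M by symmetry; apply/E; apply: pow_graph0.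
  have ES n : f (succ n) = add M (f n) (f n).
    by symmetry; apply/E; apply: pow_graphS; apply/E.
  exists f; split=> // k y; split.
    case=> X [[_ hX] [h0 [hS hk]]].
    have h : forall k, mem M (mpair k (f k)) X.
      apply: N_ind; first by rewrite /mpair; ar.
        by rewrite E0.
      by move=> n /hS; rewrite ES.
    by have [z [hz hu]] := hX k erefl; rewrite (hu _ hk) (hu _ (h k)).
  move=> ->; have [|X hX] := @N_compr A (fun z => exists n, z = mpair n (f n)).
    by rewrite /mpair; ar.
  have hX' n y' : mem M (mpair n y') X <-> y' = f n.
    rewrite hX; split=> [[j /mpair_inj [-> ->]]|->] //; by exists n.
  exists X; split; [split|split; [|split]].
  + by move=> z /hX [n ->]; exists n, (f n).
  + by move=> n _; exists (f n); split=> [|y' /hX' //]; apply/hX'.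
  + by apply/hX'; rewrite E0.
  + by move=> n m /hX' ->; apply/hX'; rewrite ES.
  + exact/hX'.
- apply: N_ind; first by have := Ar_pow_graph => h; ar.
    by exists (one M); apply: pow_graph0.
  by move=> n [y hy]; exists (add M y y); apply: pow_graphS.
- by move=> x; apply: pow_graph_uniq.
Qed.

Definition pw : N -> N := sval (cid pow2_function).

Lemma Af_pw : Af (fun e => pw (e 0%nat)).
Proof. by have [] := svalP (cid pow2_function). Qed.

Lemma mpow2P k y : mpow2 M (rocq_logic M) k y <-> y = pw k.
Proof. by have [_ _ _ h] := svalP (cid pow2_function); apply: h. Qed.

Lemma io_pw0 : io (pw (zer M)) = 1.
Proof. by have [_ h _ _] := svalP (cid pow2_function); rewrite /pw h io1. Qed.

Lemma io_pwS n : io (pw (succ n)) = io (pw n) + io (pw n).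
Proof. by have [_ _ h _] := svalP (cid pow2_function); rewrite /pw h ioD. Qed.

Lemma lt_pw n : io n < io (pw n).
Proof.
have hpw := Af_pw; move: n; apply: N_ind; first by ar.
  by rewrite io_pw0 io0.
move=> n h; rewrite io_pwS io_succ; have := io_ge0 n => h0.
by have := @io_ge1 A (pw n); lra.
Qed.

Lemma pw_gt0 n : 0 < io (pw n).
Proof. by apply: le_lt_trans (lt_pw n); apply: io_ge0. Qed.

(** [hp k] is [2 ^ -k]. *)
Definition hp (k : N) : Q := (io (pw k))^-1.

Lemma hp_gt0 k : 0 < hp k. Proof. by rewrite invr_gt0 pw_gt0. Qed.

Lemma hpS k : hp (succ k) = hp k / 2.
Proof.
have hk : io (pw k) != 0 by rewrite lt0r_neq0 // pw_gt0.
by rewrite /hp io_pwS; field; rewrite hk -mulr2n mulrn_eq0 negb_or hk.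
Qed.

Lemma tQ_hp f : Af f -> tQ (fun e => hp (f e)).
Proof. by move=> hf; apply: tQ_invn; apply: Af_fun => //; apply: Af_pw. Qed.

Lemma hp_le k j : io k <= io j -> hp j <= hp k.
Proof.
move=> /io_le [i]; rewrite -ioD => /io_inj ->.
have step i' : 0 <= hp (add M k i') - hp (add M k (succ i')).
  have -> : add M k (succ i') = succ (add M k i') by apply: io_inj; rewrite !ioE addrA.
  by rewrite hpS; have := hp_gt0 (add M k i'); lra.
move: i; apply: N_ind.
- by apply: Ar_qle; [apply: tQ_hp; ar|apply: tQ_cst].
- by have -> : add M k (zer M) = k by apply: io_inj; rewrite !ioE addr0.
- by move=> i IH; have := step i; lra.
Qed.

(** A positive fraction with denominator [d + 1] is at least [1 / (d + 1)], which exceeds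
    [2 ^ -(d + 1)]. The exponent is a number of the model, so the field may still have elements that
    are infinitesimal from outside. *)
Lemma archimedean (q : Q) : 0 < q -> exists k, hp k < q.
Proof.
move=> q0; have [p [n [d e]]] := io_frac q; exists (succ d).
have hd := io_succ_gt0 d; move: q0; rewrite e pmulr_lgt0 ?invr_gt0 // subr_gt0 => /lt_ex [k hk].
have h1 : (io (succ d))^-1 <= (io p - io n) / io (succ d).
  have h0 : 0 <= (io (succ d))^-1 by rewrite invr_ge0 ltW.
  by apply: ler_peMl => //; rewrite hk; have := io_ge0 k; lra.
apply: lt_le_trans h1; rewrite /hp ltf_pV2 ?posrE ?pw_gt0 //.
exact: lt_pw.
Qed.

Lemma archimedean_nat (q : Q) : exists k, q < io k.
Proof.
have [q0|q0] := leP q 0; first by exists (one M); rewrite io1; lra.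
have [|k hk] := @archimedean q^-1; first by rewrite invr_gt0.
by exists (pw k); rewrite -[io _]invrK -[q]invrK ltf_pV2 ?posrE ?invr_gt0 ?pw_gt0.
Qed.

End Powers.

Ltac ar_user ::= first [ apply: tQ_hp | apply: tQ_invn | apply: (Af_fun (Af_pw _)) ].

(** * Reals *)

Section Reals.
Variable A : aca.
Local Notation M := (acaM A).
Local Notation L := (rocq_logic M).
Local Notation Q := (acaQ A).
Local Notation io := (@io A).
Local Notation pw := (@pw A).
Local Notation hp := (@hp A).
Local Notation succ n := (add M n (one M)).
Local Notation mpair := (mpair M).
Local Notation rat := (mrat M).
Local Notation real := (mreal M).
Local Notation MRat := (MRat M).
Local Notation mpos := (mpos M).
Local Notation mneg := (mneg M).
Local Notation mden := (mden M).
Local Open Scope ring_scope.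

Definition val (q : rat) : Q := (io (mpos q) - io (mneg q)) / io (mden q).
Definition dpos (q : rat) := 0 < io (mden q).

Lemma mqltP q r : dpos q -> dpos r -> mqlt M q r <-> val q < val r.
Proof.
move=> hq hr; rewrite /mqlt -io_lt /val ltr_pdivrMr // mulrAC ltr_pdivlMr //.
by rewrite !ioE; split=> h; lra.
Qed.

Lemma mqleP q r : dpos q -> dpos r -> mqle M q r <-> val q <= val r.
Proof. by move=> hq hr; rewrite /mqle mqltP // leNgt; split=> /negP. Qed.

Lemma mqeqP q r : dpos q -> dpos r -> mqeq M q r <-> val q = val r.
Proof.
move=> hq hr; have h1 := lt0r_neq0 hq; have h2 := lt0r_neq0 hr; rewrite /mqeq /val; split.
  move=> /(congr1 io); rewrite !ioE => h; apply/eqP; rewrite eqr_div //; apply/eqP.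
  by lra.
move=> /eqP; rewrite eqr_div // => /eqP h; apply: io_inj; rewrite !ioE; lra.
Qed.

Lemma dpos_add q r : dpos q -> dpos r -> dpos (mqadd M q r).
Proof. by move=> hq hr; rewrite /dpos /= ioM mulr_gt0. Qed.

Lemma val_add q r : dpos q -> dpos r -> val (mqadd M q r) = val q + val r.
Proof.
move=> hq hr; have h1 := lt0r_neq0 hq; have h2 := lt0r_neq0 hr; rewrite /val /= !ioE.
by field; rewrite h1 h2.
Qed.

Lemma mqposP q : dpos q -> mqpos M q <-> 0 < val q.
Proof. by move=> hq; rewrite /mqpos -io_lt /val pmulr_lgt0 ?invr_gt0 // subr_gt0. Qed.

Lemma mexQP f : mexQ M L f <-> exists q, dpos q /\ f q.
Proof.
split; first by move=> [p [n [d [hd h]]]]; exists (MRat p n d); split=> //; rewrite /dpos -io0; apply/io_lt.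
by move=> [[p n d] [hd h]]; exists p, n, d; split=> //; apply/io_lt; rewrite io0.
Qed.

Lemma mallQP f : mallQ M f <-> forall q, dpos q -> f q.
Proof.
split; first by move=> h [p n d] hd; apply: h; apply/io_lt; rewrite io0.
by move=> h p n d hd; apply: h; rewrite /dpos -io0; apply/io_lt.
Qed.

Lemma mexQpP f : mexQp M L f <-> exists q, [/\ dpos q, 0 < val q & f q].
Proof.
rewrite /mexQp mexQP; split=> [[q [h [h1 h2]]]|[q [h h1 h2]]]; exists q.
  by split=> //; apply/mqposP.
by split=> //; split=> //; apply/mqposP.
Qed.

Lemma mallQpP f : mallQp M f <-> forall q, dpos q -> 0 < val q -> f q.
Proof.
rewrite /mallQp mallQP; split=> h q hq; first by move=> /(mqposP hq); apply: h.
by move=> /(mqposP hq); apply: h.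
Qed.

Definition hrat k := MRat (one M) (zer M) (pw k).

Lemma dpos_hrat k : dpos (hrat k). Proof. exact: pw_gt0. Qed.

Lemma val_hrat k : val (hrat k) = hp k.
Proof. by rewrite /val /= !ioE subr0 mul1r. Qed.

Lemma mwith_hpowP k f : mwith_hpow M L k f <-> f (hrat k).
Proof. by split=> [[y [/mpow2P ->]]|h] //; exists (pw k); split=> //; apply/mpow2P. Qed.

Lemma rat_of (s : Q) : exists q, dpos q /\ val q = s.
Proof.
have [p [n [d ->]]] := io_frac s; exists (MRat p n (succ d)); split=> //.
exact: io_succ_gt0.
Qed.

Lemma dpos_q0 : dpos (mq0 M). Proof. by rewrite /dpos /= io1. Qed.
Lemma val_q0 : val (mq0 M) = 0. Proof. by rewrite /val /= subrr mul0r. Qed.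

(** Sums and rational constants accept every code of an approximation, so a real need not be
    single-valued; only totality and rapid convergence are kept. *)
Definition regular (x : real) :=
  (forall k, exists q, dpos q /\ x k q) /\
  (forall k j q r, dpos q -> dpos r -> io k <= io j -> x k q -> x j r ->
     val q <= val r + hp k /\ val r <= val q + hp k).

Lemma mrapidP x : mrapid M L x <->
  (forall k j q r, dpos q -> dpos r -> io k <= io j -> x k q -> x j r ->
     val q <= val r + hp k /\ val r <= val q + hp k).
Proof.
have hh := dpos_hrat; split=> h.
  move=> k j q r hq hr /io_le [i]; rewrite -ioD => /io_inj -> hxq hxr.
  have /mallQP /(_ q hq) /mallQP /(_ r hr) := h k i.
  move=> /(_ (conj hxq hxr)) /mwith_hpowP [].
  by rewrite !mqleP ?val_add ?val_hrat //; apply: dpos_add.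
move=> k i; apply/mallQP => q hq; apply/mallQP => r hr [h1 h2]; apply/mwith_hpowP.
have [|h3 h4] := h _ _ _ _ hq hr _ h1 h2; first by rewrite ioD lerDl io_ge0.
by split; apply/mqleP => //; rewrite ?val_add ?val_hrat //; apply: dpos_add.
Qed.

(** [U x s] stands for [x < s], [Lw x s] for [s < x]. *)
Definition U (x : real) s := exists k q, [/\ dpos q, x k q & val q + hp k < s].
Definition Lw (x : real) s := exists k q, [/\ dpos q, x k q & s + hp k < val q].

Lemma U_le x s t : U x s -> s <= t -> U x t.
Proof. by move=> [k [q [h1 h2 h3]]] h; exists k, q; split=> //; apply: lt_le_trans h. Qed.

Lemma U_open x s : U x s -> exists t, t < s /\ U x t.
Proof.
move=> [k [q [h1 h2 h3]]]; exists ((val q + hp k + s) / 2); split; first by lra.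
by exists k, q; split=> //; lra.
Qed.

Lemma U_approx x k q s : regular x -> dpos q -> x k q -> U x s -> val q - hp k < s.
Proof.
move=> [_ hx] hq hxq [j [r [hr hxr h]]]; have := hp_gt0 k.
have [/hx|/ltW /hx] := leP (io k) (io j).
  by move=> /(_ _ _ hq hr hxq hxr) []; have := hp_gt0 j; lra.
by move=> /(_ _ _ hr hq hxr hxq) []; lra.
Qed.

Lemma Lw_U x s t : regular x -> Lw x s -> U x t -> s < t.
Proof. by move=> hx [k [q [hq hxq h]]] /(U_approx hx hq hxq); lra. Qed.

Lemma Lw_or_U x s t : regular x -> s < t -> Lw x s \/ U x t.
Proof.
move=> [hx _] st; have [|k hk] := @archimedean A ((t - s) / 2); first by lra.
have [q [hq hxq]] := hx k; have [h|h] := ltP (val q + hp k) t.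
  by right; exists k, q.
by left; exists k, q; split=> //; lra.
Qed.

Lemma N_join k j : exists i, io k <= io i /\ io j <= io i.
Proof. by exists (add M k j); rewrite !ioD lerDl lerDr !io_ge0. Qed.

Lemma mqlt_hrat q r k : dpos q -> dpos r ->
  mqlt M (mqadd M q (mqadd M (hrat k) (hrat k))) r <-> val q + 2 * hp k < val r.
Proof.
move=> hq hr; have hh := dpos_hrat k; have h2 := dpos_add hh hh.
rewrite mqltP //; last exact: dpos_add.
by rewrite !val_add // val_hrat; split=> ?; lra.
Qed.

Lemma mrltP x y : regular x -> regular y ->
  mrlt M L x y <-> exists s, U x s /\ Lw y s.
Proof.
move=> hx hy; have hh := dpos_hrat; split.
  move=> [k /mexQP [q [hq /mexQP [r [hr [h1 [h2 /mwith_hpowP /(mqlt_hrat _ hq hr) h]]]]]]].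
  exists ((val q + val r) / 2).
  by split; [exists k, q|exists k, r]; split=> //; lra.
move=> [s [/U_open [t [ts ht]] [k [q [hq hyq h]]]]].
(* Of the three parts, one absorbs the error of the approximation [p] of [x], and two the gap
   [2 * hp j] that [mrlt] requires. *)
have [|i hi] := @archimedean A ((s - t) / 3); first by lra.
have [j [h1 h2]] := N_join k i.
have [p [hdp hxp]] := hx.1 j; have [r [hdr hyr]] := hy.1 j.
exists j; apply/mexQP; exists p; split=> //; apply/mexQP; exists r; split=> //.
split=> //; split=> //; apply/mwith_hpowP; apply/mqlt_hrat => //.
have [h3 _] := hy.2 _ _ _ _ hq hdr h1 hyq hyr.
have h4 := U_approx hx hdp hxp ht.
by have := hp_le h2; have := hp_gt0 j; lra.
Qed.

Lemma mrleP x y : regular x -> regular y ->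
  mrle M L x y <-> forall s, U y s -> U x s.
Proof.
move=> hx hy; rewrite /mrle mrltP //; split.
  move=> h s /U_open [t [ts ht]]; have [hl|] := Lw_or_U hx ts; last by [].
  by case: h; exists t.
move=> h [s [/h hs] hl]; have := Lw_U hx hl hs; by rewrite ltxx.
Qed.

Lemma regular_rat r : dpos r -> regular (mrrat M r).
Proof.
move=> hr; split=> [k|k j p q hp' hq _]; first by exists r; split=> //; apply/mqeqP.
by rewrite /mrrat !mqeqP // => -> ->; have := hp_gt0 k; split; lra.
Qed.

Lemma U_rat r s : dpos r -> U (mrrat M r) s <-> val r < s.
Proof.
move=> hr; split.
  by move=> [k [q [hq /(mqeqP hq hr) -> h]]]; have := hp_gt0 k; lra.
move=> h; have [|k hk] := @archimedean A (s - val r); first by lra.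
by exists k, r; split=> //; lra.
Qed.

Lemma Lw_rat r s : dpos r -> Lw (mrrat M r) s <-> s < val r.
Proof.
move=> hr; split.
  by move=> [k [q [hq /(mqeqP hq hr) -> h]]]; have := hp_gt0 k; lra.
move=> h; have [|k hk] := @archimedean A (val r - s); first by lra.
by exists k, r; split=> //; lra.
Qed.

Lemma mrlt_rat x r : regular x -> dpos r -> mrlt M L x (mrrat M r) <-> U x (val r).
Proof.
move=> hx hr; rewrite mrltP //; last exact: regular_rat.
split=> [[s [h /Lw_rat h']]|/U_open [s [h h']]].
  by apply: U_le h _; apply/ltW/h'.
by exists s; split=> //; apply/Lw_rat.
Qed.

Lemma mrhpowE n : mrhpow M L n = mrrat M (hrat n).
Proof.
by apply: funext => k; apply: funext => r; apply/propext; rewrite /mrhpow mwith_hpowP.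
Qed.

Lemma mrlt_hpow x n : regular x -> mrlt M L x (mrhpow M L n) <-> U x (hp n).
Proof. by move=> hx; rewrite mrhpowE mrlt_rat // ?val_hrat //; apply: dpos_hrat. Qed.

Lemma mraddP x y k q : dpos q -> mradd M L x y k q <->
  exists u v, [/\ dpos u, dpos v, x (succ k) u, y (succ k) v & val q = val u + val v].
Proof.
move=> hq; rewrite /mradd mexQP; split.
  move=> [u [hu /mexQP [v [hv [xu [yv]]]]]].
  by move=> /(mqeqP hq (dpos_add hu hv)); rewrite val_add // => e; exists u, v.
move=> [u [v [hu hv xu yv e]]]; exists u; split=> //; apply/mexQP; exists v; split=> //.
by split=> //; split=> //; apply/mqeqP; rewrite ?val_add //; apply: dpos_add.
Qed.

Lemma regular_add x y : regular x -> regular y -> regular (mradd M L x y).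
Proof.
move=> hx hy; split=> [k|k j p q hdp hdq kj].
  have [u [hu xu]] := hx.1 (succ k); have [v [hv yv]] := hy.1 (succ k).
  exists (mqadd M u v); split; first exact: dpos_add.
  by apply/mraddP; [apply: dpos_add|exists u, v; rewrite val_add].
move=> /(mraddP _ _ _ hdp) [u [v [hu hv xu yv ->]]].
move=> /(mraddP _ _ _ hdq) [u' [v' [hu' hv' xu' yv' ->]]].
have sk : io (succ k) <= io (succ j) by rewrite !io_succ lerD2r.
have := hx.2 _ _ _ _ hu hu' sk xu xu'; have := hy.2 _ _ _ _ hv hv' sk yv yv'.
by rewrite hpS => -[h1 h2] [h3 h4]; split; lra.
Qed.

Lemma U_add x y s : regular x -> regular y ->
  U (mradd M L x y) s <-> exists u v, [/\ U x u, U y v & u + v <= s].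
Proof.
move=> hx hy; split.
  move=> [k [q [hq /(mraddP _ _ _ hq) [u [v [hu hv xu yv ->]]] h]]].
  exists (val u + hp k / 2 + (s - val u - val v - hp k) / 2).
  exists (val v + hp k / 2 + (s - val u - val v - hp k) / 2).
  split; last by lra.
    by exists (succ k), u; split=> //; rewrite hpS; lra.
  by exists (succ k), v; split=> //; rewrite hpS; lra.
move=> [u [v [/U_open [u' [uu' xu']] yv uvs]]].
have [|k hk] := @archimedean A ((u - u') / 2); first by lra.
have [a [ha xa]] := hx.1 (succ k); have [b [hb yb]] := hy.1 (succ k).
have h1 := U_approx hx ha xa xu'; have h2 := U_approx hy hb yb yv.
have hab := dpos_add ha hb.
exists k, (mqadd M a b); split=> //.
  by apply/mraddP => //; exists a, b; rewrite val_add.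
by rewrite val_add //; move: h1 h2; rewrite hpS; lra.
Qed.

Lemma mQP c : mQ M L c <-> exists q, dpos q /\ c = mqcode M q.
Proof. exact: mexQP. Qed.

Lemma mqcode_inj q r : mqcode M q = mqcode M r -> q = r.
Proof.
by case: q r => [p n d] [p' n' d'] /mpair_inj [/mpair_inj [/= -> ->] ->].
Qed.

Lemma mRealP R : mReal M L R -> regular (mrset M R).
Proof.
move=> [[h1 h2] /mrapidP h3]; split=> // k.
have [c [hc _]] := h2 k erefl; have [k' [c' [_ [/mQP [q [hq e]] /mpair_inj [_ e']]]]] := h1 _ hc.
by exists q; split=> //; rewrite /mrset -e -e'.
Qed.

Lemma const_real (s : Q) : 0 < s -> exists R, mRealPos M L R /\
  (forall t, U (mrset M R) t -> s < t) /\ (forall t, Lw (mrset M R) t <-> t < s).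
Proof.
move=> s0; have [r [hr rs]] := rat_of s.
have [|R hR] := @N_compr A (fun z => exists k, z = mpair k (mqcode M r)).
  by rewrite /mpair; ar.
have E k c : mem M (mpair k c) R <-> c = mqcode M r.
  by rewrite hR; split=> [[j /mpair_inj []] //|->]; exists k.
have Er k q : mrset M R k q <-> q = r.
  by rewrite /mrset E; split=> [/mqcode_inj|->].
have reg : regular (mrset M R).
  split=> [k|k j p q hdp hdq _ /Er -> /Er ->]; first by exists r; split=> //; apply/Er.
  by have := hp_gt0 k; split; lra.
have hL t : Lw (mrset M R) t <-> t < s.
  rewrite -rs; split; first by move=> [k [q [hq /Er -> h]]]; have := hp_gt0 k; lra.
  move=> h; have [|k hk] := @archimedean A (val r - t); first by lra.
  by exists k, r; split=> //; [apply/Er|lra].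
exists R; split; last first.
  split=> // t [k [q [hq /Er -> h]]]; have := hp_gt0 k; lra.
split; last first.
  apply/mrltP => //; first by apply: regular_rat; apply: dpos_q0.
  exists (s / 2); split; last by apply/hL; lra.
  by apply/U_rat; [apply: dpos_q0|rewrite val_q0; lra].
split; last by apply/mrapidP; apply: reg.2.
split; first by move=> z /hR [k ->]; exists k, (mqcode M r); split=> //; split=> //; apply/mQP; exists r.
by move=> k _; exists (mqcode M r); split=> [|c /E //]; apply/E.
Qed.

End Reals.

(** * Metric spaces and points *)

Section Spaces.
Variable A : aca.
Local Notation M := (acaM A).
Local Notation N := (num M).
Local Notation Q := (acaQ A).
Local Notation Ar := (Ar M).
Local Notation mpair := (mpair M).
Local Open Scope ring_scope.

Definition car (S : mspace M) a := mem M a (mcar M S).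
(** The relation [d(a, b) < s]. In terms of it the axioms of a metric become closure rules for
    rational bounds. *)
Definition D (S : mspace M) a b s := U (mdA M S a b) s.

Lemma Ar_D S f g (s : (nat -> N) -> Q) : Af f -> Af g -> tQ s ->
  Ar (fun e => D S (f e) (g e) (s e)).
Proof.
apply: (@Ar_appQ A (D S)).
by rewrite /D /U /mdA /mqcode /val /dpos /mpair; ar.
Qed.

End Spaces.

Ltac ar_user ::= first [ apply: Ar_D | apply: tQ_hp | apply: tQ_invn | apply: (Af_fun (Af_pw _)) ].

Section Metric.
Variable A : aca.
Local Notation M := (acaM A).
Local Notation L := (rocq_logic M).
Local Notation N := (num M).
Local Notation io := (@io A).
Local Notation hp := (@hp A).
Local Notation succ n := (add M n (one M)).
Local Notation mpair := (mpair M).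
Local Open Scope ring_scope.

Definition metric S := forall a b, car S a -> car S b ->
  [/\ regular (mdA M S a b), (forall s, 0 < s -> D S a a s),
      (forall s, D S a b s -> D S b a s), (forall s, D S a b s -> 0 < s) &
      forall c s t, car S c -> D S a c s -> D S c b t -> D S a b (s + t)].

Definition dist_fun S := mFun M L (mdist M S)
    (fun z => exists a b k, car S a /\ car S b /\ z = mpair (mpair a b) k) (mQ M L).

Lemma dist_total S a b k : dist_fun S -> car S a -> car S b ->
  exists q, dpos q /\ mdA M S a b k q.
Proof.
move=> [h1 h2] ha hb.
have [|c [hc _]] := h2 (mpair (mpair a b) k); first by exists a, b, k.
have [x' [y' [_ [/mexQP [q [hq e]] /mpair_inj [_ e']]]]] := h1 _ hc.
by exists q; split=> //; rewrite /mdA -e -e'.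
Qed.

Lemma misSpaceP S : misSpace M L S <-> dist_fun S /\ metric S.
Proof.
split=> -[hf h]; split=> //.
  have reg a b : car S a -> car S b -> regular (mdA M S a b).
    move=> ha hb; split; first by move=> k; apply: dist_total.
    by have [/mrapidP] := h a b (conj ha hb).
  have r0 := regular_rat (dpos_q0 A).
  move=> a b ha hb; have [_ [[h1 _] [h2 [h3 h4]]]] := h a b (conj ha hb).
  split; first exact: reg.
  - move=> s s0; move/mrleP: h1 => h1; apply: h1; try exact: reg; first by [].
    by apply/U_rat; [apply: dpos_q0|rewrite val_q0].
  - by move=> s; apply: (iffLR (mrleP (reg _ _ hb ha) (reg _ _ ha hb))); case: h2.
  - move=> s hs; have := iffLR (mrleP r0 (reg _ _ ha hb)) h3 s hs.
    by move/(U_rat _ (dpos_q0 A)); rewrite val_q0.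
  - move=> c s t hc hs ht.
    apply: (iffLR (mrleP (reg _ _ ha hb) (regular_add (reg _ _ ha hc) (reg _ _ hc hb))) (h4 c hc)).
    by apply/(U_add _ (reg _ _ ha hc) (reg _ _ hc hb)); exists s, t.
move=> a b [ha hb]; have reg a' b' : car S a' -> car S b' -> regular (mdA M S a' b').
  by move=> ha' hb'; have [] := h a' b' ha' hb'.
have r0 := regular_rat (dpos_q0 A).
have [_ h1 h2 h3 h4] := h a b ha hb; have [_ _ h2' _ _] := h b a hb ha.
have [_ _ _ h3' _] := h a a ha ha.
split; last split; last split; last split.
- by apply/mrapidP; apply: (reg a b ha hb).2.
- split; apply/mrleP; rewrite ?U_rat; try exact: reg; try exact: r0.
    by move=> s /(U_rat _ (dpos_q0 A)); rewrite val_q0; apply: h1.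
  by move=> s /h3' ?; apply/(U_rat _ (dpos_q0 A)); rewrite val_q0.
- by split; apply/mrleP => //; exact: reg.
- apply/mrleP => //; first exact: reg.
  by move=> s /h3 ?; apply/(U_rat _ (dpos_q0 A)); rewrite val_q0.
- move=> c hc; apply/mrleP; [exact: reg|by apply: regular_add; apply: reg|].
  move=> s /(U_add _ (reg _ _ ha hc) (reg _ _ hc hb)) [u [v [hu hv huv]]].
  by apply: U_le huv; apply: h4 hc hu hv.
Qed.

(** * Points and the distance between them *)

Section Points.
Variables (S : mspace M) (hS : metric S).

Lemma D_refl a s : car S a -> 0 < s -> D S a a s.
Proof. by move=> ha; have [_ h _ _ _] := hS ha ha; apply: h. Qed.
Lemma D_sym a b s : car S a -> car S b -> D S a b s -> D S b a s.
Proof. by move=> ha hb; have [_ _ h _ _] := hS ha hb; apply: h. Qed.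
Lemma D_gt0 a b s : car S a -> car S b -> D S a b s -> 0 < s.
Proof. by move=> ha hb; have [_ _ _ h _] := hS ha hb; apply: h. Qed.
Lemma D_tri c a b s t : car S a -> car S c -> car S b ->
  D S a c s -> D S c b t -> D S a b (s + t).
Proof. by move=> ha hc hb; have [_ _ _ _ h] := hS ha hb; apply: h. Qed.
Lemma D_le a b s t : D S a b s -> s <= t -> D S a b t.
Proof. exact: U_le. Qed.
Lemma D_open a b s : D S a b s -> exists t, t < s /\ D S a b t.
Proof. exact: U_open. Qed.
Lemma regular_dA a b : car S a -> car S b -> regular (mdA M S a b).
Proof. by move=> ha hb; have [] := hS ha hb. Qed.

Definition is_point (p : N -> N) := [/\ Af (fun e => p (e 0%nat)),
  (forall n, car S (p n)) & forall n, D S (p n) (p (succ n)) (hp n)].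

Definition represents (x : mpoint M) (p : N -> N) := forall n a, x n a <-> a = p n.

Lemma point_of X : misPoint M L S X -> exists p, is_point p /\ represents (mpset M X) p.
Proof.
move=> [[h1 h2] h3].
have [|||p [hp1 hp2]] := @Af_choice A (fun n a => mem M (mpair n a) X).
- by rewrite /mpair; ar.
- by move=> n; have [y [hy _]] := h2 n erefl; exists y.
- move=> n y y' hy hy'; have [z [hz hu]] := h2 n erefl.
  by rewrite (hu _ hy) (hu _ hy').
have hc n : car S (p n).
  have := h2 n erefl => -[y [hy hu]]; have [n' [y' [_ [hy' /mpair_inj [_ e]]]]] := h1 _ hy.
  by rewrite -((hp2 _ _).1 hy) e.
exists p; split=> //; split=> // n.
apply/(mrlt_hpow _ (regular_dA (hc _) (hc _))); apply: h3 (n) _ _ _.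
by split; apply/hp2.
Qed.

Lemma set_of_point p : is_point p -> exists X, misPoint M L S X /\ represents (mpset M X) p.
Proof.
move=> [h1 h2 h3]; have [|X hX] := @N_compr A (fun z => exists n, z = mpair n (p n)).
  by rewrite /mpair; ar.
have E n a : mem M (mpair n a) X <-> a = p n.
  by rewrite hX; split=> [[j /mpair_inj [-> ->]]|->] //; exists n.
exists X; split=> //; split; [split|].
- by move=> z /hX [n ->]; exists n, (p n); split=> //; split=> //; apply: h2.
- by move=> n _; exists (p n); split=> [|a /E //]; apply/E.
- move=> n a b [/E -> /E ->]; apply/(mrlt_hpow _ (regular_dA (h2 _) (h2 _))).
  exact: h3.
Qed.

Lemma const_point a : car S a -> is_point (fun _ => a).
Proof. by move=> ha; split=> //; [ar|move=> n; apply: D_refl (hp_gt0 _)]. Qed.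

Lemma represents_const a : represents (mpconst M a) (fun _ => a).
Proof. by []. Qed.

Lemma point_cauchy p i j : is_point p -> io i <= io j -> D S (p i) (p j) (2 * hp i).
Proof.
move=> [h1 h2 h3] /io_le [k]; rewrite -ioD => /io_inj ->.
(* The steps from [i] to [i + k] form a geometric sum, [2 * hp i - 2 * hp (i + k)]. The extra [s]
   keeps the bound strict at [k = 0]. *)
suff /(_ k (hp (add M i k)) (hp_gt0 _)) h : forall k s, 0 < s ->
    D S (p i) (p (add M i k)) (2 * hp i - 2 * hp (add M i k) + s).
  by apply: D_le h _; have := hp_gt0 (add M i k); lra.
move=> {k}; apply: N_ind; first by ar.
  move=> s s0; have -> : add M i (zer M) = i by apply: io_inj; rewrite !ioE addr0.
  by rewrite subrr add0r; apply: D_refl.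
move=> k IH s s0; have -> : add M i (succ k) = succ (add M i k).
  by apply: io_inj; rewrite !ioE addrA.
rewrite hpS.
have -> : 2 * hp i - 2 * (hp (add M i k) / 2) + s = 2 * hp i - 2 * hp (add M i k) + s + hp (add M i k).
  by field.
by apply: D_tri (IH s s0) (h3 _).
Qed.

Let three := add M (add M (one M) (one M)) (one M).

Lemma hp3 k : hp (add M k three) = hp k / 8.
Proof.
have -> : add M k three = succ (succ (succ k)) by apply: io_inj; rewrite !ioE; ring.
by rewrite !hpS; field.
Qed.

Lemma mdPE x y p q k r : represents x p -> represents y q ->
  mdP M L S x y k r <-> mdA M S (p (add M k three)) (q (add M k three)) (add M k three) r.
Proof.
move=> hx hy; split; first by move=> [a [b [/hx -> [/hy -> h]]]].
by move=> h; exists (p (add M k three)), (q (add M k three)); split; [apply/hx|split; [apply/hy|]].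
Qed.

Lemma D_approx a b k r : car S a -> car S b -> dpos r -> mdA M S a b k r ->
  (forall s, D S a b s -> val r - hp k < s) /\ (forall s, val r + hp k < s -> D S a b s).
Proof.
move=> ha hb hr h; split=> s hs; last by exists k, r.
exact: U_approx (regular_dA ha hb) hr h hs.
Qed.

Lemma regular_dP x y p q : is_point p -> is_point q -> represents x p -> represents y q ->
  regular (mdP M L S x y).
Proof.
move=> hp1 hq1 hx hy; have [_ cp _] := hp1; have [_ cq _] := hq1; split.
  move=> k; have [r [hr h]] := (regular_dA (cp (add M k three)) (cq (add M k three))).1 (add M k three).
  by exists r; split=> //; apply/(mdPE _ _ hx hy).
move=> k j r r' hr hr' kj /(mdPE _ _ hx hy) h /(mdPE _ _ hx hy) h'.
have kj3 : io (add M k three) <= io (add M j three) by rewrite !ioD lerD2r.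
have hh := hp_le kj; have hk := hp_gt0 k; have hj := hp_gt0 j.
have dp := point_cauchy hp1 kj3; have dq := point_cauchy hq1 kj3.
have dp' := D_sym (cp _) (cp _) dp; have dq' := D_sym (cq _) (cq _) dq.
have [u1 l1] := D_approx (cp _) (cq _) hr h; have [u2 l2] := D_approx (cp _) (cq _) hr' h'.
move: u1 l1 u2 l2 dp dq dp' dq'; rewrite !hp3 => u1 l1 u2 l2 dp dq dp' dq'.
split.
  (* Thanks to the reading at [k + 3], the errors add up to at most [1/4 + 1/4 + 1/4 + 1/8] times
     [2 ^ -k]. *)
  have /l2 h2 : val r' + hp j / 8 < val r' + hp j / 4 by lra.
  have := u1 _ (D_tri (cp _) (cq _) (cq _) (D_tri (cp _) (cp _) (cq _) dp h2) dq').
  by lra.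
have /l1 h2 : val r + hp k / 8 < val r + hp k / 4 by lra.
have := u2 _ (D_tri (cp _) (cq _) (cq _) (D_tri (cp _) (cp _) (cq _) dp' h2) dq).
by lra.
Qed.

(** A strict bound at the limit amounts to one bound [t < s] on a whole tail; bounding each term by
    [s] would give only [<=]. Through this lemma distances of points reduce to distances in [A]. *)
Lemma U_dP x y p q s : is_point p -> is_point q -> represents x p -> represents y q ->
  U (mdP M L S x y) s <-> exists t k, t < s /\ forall j, io k <= io j -> D S (p j) (q j) t.
Proof.
move=> hp1 hq1 hx hy; have [_ cp _] := hp1; have [_ cq _] := hq1; split.
  move=> [k [r [hr /(mdPE _ _ hx hy) h hs]]]; exists (val r + hp k), (add M k three); split=> // j hj.
  have dp := D_sym (cp _) (cp _) (point_cauchy hp1 hj); have dq := point_cauchy hq1 hj.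
  have [_ l1] := D_approx (cp _) (cq _) hr h.
  have /l1 h2 : val r + hp (add M k three) < val r + hp k / 4.
    by rewrite hp3; have := hp_gt0 k; lra.
  apply: D_le (D_tri (cp _) (cq _) (cq _) (D_tri (cp _) (cp _) (cq _) dp h2) dq) _.
  by rewrite hp3; have := hp_gt0 k; lra.
move=> [t [k [ts h]]]; have [|j hj] := @archimedean A ((s - t) / 2); first by lra.
have [i [h1 h2]] := N_join k j.
have [r [hr hxy]] := (regular_dP hp1 hq1 hx hy).1 i.
exists i, r; split=> //; move: hxy => /(mdPE _ _ hx hy) hxy.
have [u1 _] := D_approx (cp _) (cq _) hr hxy.
have /h/u1 : io k <= io (add M i three).
  by rewrite ioD; have := io_ge0 three; lra.
rewrite hp3; have := hp_le h2; have := hp_gt0 i; lra.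
Qed.

Lemma mrlt_dP x y p q r : is_point p -> is_point q -> represents x p -> represents y q ->
  dpos r -> mrlt M L (mdP M L S x y) (mrrat M r) <->
  exists t k, t < val r /\ forall j, io k <= io j -> D S (p j) (q j) t.
Proof.
move=> h1 h2 h3 h4 h5; rewrite mrlt_rat //; last exact: regular_dP h1 h2 h3 h4.
exact: U_dP.
Qed.

End Points.
End Metric.

(** * The pseudo-metric of a covering *)

Section Oscillation.
Variable A : aca.
Local Notation M := (acaM A).
Local Notation Q := (acaQ A).
Local Notation Ar := (Ar M).
Local Notation mpair := (mpair M).
Local Open Scope ring_scope.
Variables (S : mspace M) (O : set M).

Definition ball n m c (s : Q) := exists q, [/\ dpos q, val q = s &
  mem M (mpair (mpair n m) (mpair c (mqcode M q))) O].

(* In the notation of the header, [Phi n a p] is [phi_n(a) > p] (for [p >= 0]),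
   [T a t] is [phi(a) > t], [Lf n a p] is [F_n(a) > p] and [E a b q] is
   [d'(a, b) > q]. *)
Definition Phi n a p := p < 1 /\ exists m c s, ball n m c s /\ D S a c (s - p).
Definition T a t := exists n, Phi n a t.
Definition Lf n a p := p < 0 \/ exists t, 0 < t /\ ~ T a t /\ Phi n a (p * t).
Definition E a b q := q < 0 \/ exists n u v, q < u - v /\
  ((Lf n a u /\ ~ Lf n b v) \/ (Lf n b u /\ ~ Lf n a v)).

Lemma Ar_Phi f g s : Af f -> Af g -> tQ s -> Ar (fun e => Phi (f e) (g e) (s e)).
Proof.
apply: Ar_appQ; rewrite /Phi /ball /mqcode /val /dpos /mpair; ar.
Qed.

Lemma Ar_T f s : Af f -> tQ s -> Ar (fun e => T (f e) (s e)).
Proof.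
move=> hf; apply: (@Ar_appQ A (fun a _ => T a) f f) => //; rewrite /T.
by apply: Ar_ex; apply: Ar_Phi; ar.
Qed.

Lemma Ar_Lf f g s : Af f -> Af g -> tQ s -> Ar (fun e => Lf (f e) (g e) (s e)).
Proof.
apply: Ar_appQ; rewrite /Lf; do ! first [apply: Ar_Phi|apply: Ar_T|ar_step].
Qed.

Lemma Ar_E f g s : Af f -> Af g -> tQ s -> Ar (fun e => E (f e) (g e) (s e)).
Proof.
apply: Ar_appQ; rewrite /E; do ! first [apply: Ar_Lf|ar_step].
Qed.

End Oscillation.

Ltac ar_user ::= first [ apply: Ar_D | apply: tQ_hp | apply: tQ_invn | apply: (Af_fun (Af_pw _))
  | apply: Ar_E | apply: Ar_T ].

(** * Estimates for the pseudo-metric *)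

Section Cover.
Variable A : aca.
Local Notation M := (acaM A).
Local Notation L := (rocq_logic M).
Local Notation io := (@io A).
Local Notation hp := (@hp A).
Local Open Scope ring_scope.

Variables (S : mspace M) (O : set M).
Hypotheses (hS : metric S) (hO : misOpenCovering M L S O).

Local Notation ball := (ball O).
Local Notation D := (D S).
Local Notation car := (car S).
Local Notation Phi := (Phi S O).
Local Notation T := (T S O).
Local Notation Lf := (Lf S O).
Local Notation E := (E S O).

Lemma ball_car n m c s : ball n m c s -> car c.
Proof.
move=> [q [hq _ h]]; have [[h1 _] _] := hO.
have [x [y [_ [[a /mexQpP [r [_ _ [ha e]]]] /mpair_inj [_ e']]]]] := h1 _ h.
by move: e; rewrite -e' => /mpair_inj [->].
Qed.

Lemma Phi_le n a p p' : Phi n a p -> p' <= p -> Phi n a p'.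
Proof.
move=> [h1 [m [c [s [h2 h3]]]]] h; split; first exact: le_lt_trans h h1.
by exists m, c, s; split=> //; apply: D_le h3 _; lra.
Qed.

Lemma Phi_lipschitz n a b p eta : car a -> car b -> Phi n a p -> D a b eta -> Phi n b (p - eta).
Proof.
move=> ha hb [h1 [m [c [s [h2 h3]]]]] h; have h0 := D_gt0 hS ha hb h.
split; first by lra.
exists m, c, s; split=> //; have -> : s - (p - eta) = eta + (s - p) by lra.
by apply: (D_tri hS hb ha (ball_car h2)) h3; apply: D_sym.
Qed.

Lemma T_le a p p' : T a p -> p' <= p -> T a p'.
Proof. by move=> [n h] h'; exists n; apply: Phi_le h'. Qed.

Lemma T_lipschitz a b p eta : car a -> car b -> T a p -> D a b eta -> T b (p - eta).
Proof. by move=> ha hb [n h] h'; exists n; apply: Phi_lipschitz h h'. Qed.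

Lemma T_lt1 a p : T a p -> p < 1.
Proof. by move=> [n []]. Qed.

Lemma not_T_lt a p t : T a p -> ~ T a t -> p < t.
Proof. by move=> h h'; rewrite ltNge; apply/negP => /(T_le h). Qed.

Lemma minOpenP n x p : is_point S p -> represents x p ->
  minOpen M L S O n x <->
  exists m c s t k, [/\ 0 < s, ball n m c s, t < s & forall j, io k <= io j -> D (p j) c t].
Proof.
move=> h1 h2; split.
  move=> [m [a /mexQpP [q [hq q0 [hm h]]]]].
  have hb : ball n m a (val q) by exists q.
  move: h => /(mrlt_dP hS h1 (const_point hS (ball_car hb)) h2 (represents_const a) hq).
  by move=> [t [k [ht hD]]]; exists m, a, (val q), t, k.
move=> [m [c [s [t [k [s0 hb ts h]]]]]]; have hc := ball_car hb.
have [q [hq qs hm]] := hb; exists m, c; apply/mexQpP; exists q; split=> //; first by rewrite qs.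
split=> //; apply/(mrlt_dP hS h1 (const_point hS hc) h2 (represents_const c) hq).
by exists t, k; rewrite qs.
Qed.

(** Positivity of [phi] at a point is needed as one lower bound along a tail of its sequence. The
    room [s - t] of the point in some ball of the covering provides it, cut down to below 1 because
    of the truncation in [Phi]. *)
Lemma T_point p : is_point S p -> exists p0 k, 0 < p0 /\ forall j, io k <= io j -> T (p j) p0.
Proof.
move=> hp1; have [X [hX hr]] := set_of_point hS hp1.
have [_ /(_ X hX) [n /(minOpenP n hp1 hr) [m [c [s [t [k [s0 hb ts h]]]]]]]] := hO.
have [p0 [h0 h1 h2]] : exists p0, [/\ 0 < p0, p0 < 1 & t <= s - p0].
  have [h1|h1] := ltP (s - t) 1; first by exists (s - t); split; lra.
  by exists (1 / 2); split; lra.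
exists p0, k; split=> // j /h hj; exists n; split=> //; exists m, c, s; split=> //.
exact: D_le hj _.
Qed.

Lemma T_pos a : car a -> exists p, 0 < p /\ T a p.
Proof.
by move=> ha; have [p [k [h1 h2]]] := T_point (const_point hS ha); exists p; split=> //; exact: (h2 k (lexx _)).
Qed.

Lemma Lf_le n a p p' : Lf n a p -> p' <= p -> Lf n a p'.
Proof.
move=> [h|[t [t0 [h1 h2]]]] hle; first by left; lra.
right; exists t; split=> //; split=> //; apply: Phi_le h2 _.
by rewrite ler_pM2r.
Qed.

Lemma Lf_lt n a p p' : Lf n a p -> ~ Lf n a p' -> p < p'.
Proof. by move=> h h'; rewrite ltNge; apply/negP => /(Lf_le h). Qed.

Lemma Lf_lt1 n a p : Lf n a p -> p < 1.
Proof.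
move=> [h|[t [t0 [h1 h2]]]]; first by lra.
have : T a (p * t) by exists n.
by move=> /not_T_lt /(_ h1); rewrite gtr_pMl.
Qed.

Lemma not_Lf_ge0 n a p : ~ Lf n a p -> 0 <= p.
Proof. by move=> h; rewrite leNgt; apply/negP => h'; apply: h; left. Qed.

(** No element of the field need equal [phi(a)], so it is located on a grid:
    [(i - 1) * delta < phi(a) <= i * delta]. As [phi(a) > p0], the mesh [p0 * (1 - p)] is less than
    [(1 - p) * i * delta], and some [phi_n(a) > (i - 1) * delta >= p * i * delta]. *)
Lemma Lf_ex a p : car a -> p < 1 -> exists n, Lf n a p.
Proof.
move=> ha p1; have [p0 [p00 hT]] := T_pos ha.
pose delta := p0 * (1 - p); have d0 : 0 < delta by apply: mulr_gt0; lra.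
have [||i [h1 h2]] := @N_least A (fun i => ~ T a (io i * delta)); first by ar.
  have [i hi] := archimedean_nat (A := A) (delta^-1); exists i => /T_lt1.
  by move: hi; rewrite ltNge -(ler_pM2r d0) mulVf ?lt0r_neq0 // -ltNge => hi; lra.
have lt_p0 := not_T_lt hT h1.
have [i0|[k ik]] := N_cases i.
  by move: lt_p0; rewrite i0 io0 mul0r; lra.
have /contrapT [n hn] : ~ ~ T a (io k * delta) by apply: h2; rewrite ik io_succ ltrDl.
exists n; right; exists (io i * delta); split; first by lra.
split=> //; apply: Phi_le hn _.
have : p0 * (1 - p) <= io i * delta * (1 - p) by rewrite ler_pM2r ?ltW //; lra.
by rewrite -/delta ik io_succ; lra.
Qed.

Lemma E_refl a q : 0 <= q -> ~ E a a q.
Proof.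
move=> q0 [h|[n [u [v [h [[h1 h2]|[h1 h2]]]]]]]; first by lra.
  by have := Lf_lt h1 h2; lra.
by have := Lf_lt h1 h2; lra.
Qed.

Lemma E_sym a b q : E a b q -> E b a q.
Proof.
by move=> [h|[n [u [v [h [h'|h']]]]]]; [left|right; exists n, u, v; split=> //; right
  |right; exists n, u, v; split=> //; left].
Qed.

Lemma E_le a b q q' : E a b q -> q' <= q -> E a b q'.
Proof.
move=> [h|[n [u [v [h h']]]]] l; first by left; lra.
by right; exists n, u, v; split=> //; lra.
Qed.

Lemma E_lt1 a b q : E a b q -> q < 1.
Proof.
move=> [h|[n [u [v [h [[/Lf_lt1 h1 /not_Lf_ge0 h2]|[/Lf_lt1 h1 /not_Lf_ge0 h2]]]]]]]; lra.
Qed.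

Lemma E_tri c a b q r : E a b (q + r) -> E a c q \/ E c b r.
Proof.
have [q0|q0] := ltP q 0; first by left; left.
have [r0|r0] := ltP r 0; first by right; left.
move=> [h|[n [u [v [h h']]]]]; first by lra.
(* [e] is half the excess, so that the level [v + r + e] is more than [r] above [v] and more than
   [q] below [u]. Whether [F_n(c)] exceeds it decides between the two conclusions. *)
pose e := (u - v - q - r) / 2.
have [h1 h2] : q < u - (v + r + e) /\ r < v + r + e - v by rewrite /e; split; lra.
case: h' => [[hu hv]|[hu hv]].
  have [hw|hw] := pselect (Lf n c (v + r + e)).
    by right; right; exists n, (v + r + e), v; split=> //; left.
  by left; right; exists n, u, (v + r + e); split=> //; left.
have [h3 h4] : r < u - (v + q + e) /\ q < v + q + e - v by rewrite /e; split; lra.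
have [hw|hw] := pselect (Lf n c (v + q + e)).
  by left; right; exists n, (v + q + e), v; split=> //; right.
by right; right; exists n, u, (v + q + e); split=> //; right.
Qed.

Lemma not_E_tri c a b q r : ~ E a c q -> ~ E c b r -> ~ E a b (q + r).
Proof. by move=> h1 h2 /(@E_tri c) [/h1|/h2]. Qed.

Lemma not_E_le a b q q' : ~ E a b q -> q <= q' -> ~ E a b q'.
Proof. by move=> h h' /E_le /(_ h'). Qed.

Lemma not_E_sym a b q : ~ E a b q -> ~ E b a q.
Proof. by move=> h /E_sym. Qed.

(** Take [t >= phi(a)] with [phi_n(a) > u * t]. The Lipschitz bounds give [phi_n(b) > u * t - eta]
    and [phi(b) <= t + eta], so [v] exceeds [(u * t - eta) / (t + eta)]. Then
    [(u - v) * t < (1 + v) * eta <= 2 * eta], as [v < u < 1] in the case of interest. *)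
Lemma Lf_near n a b u v p eta : car a -> car b -> T a p -> D a b eta -> 0 <= p ->
  Lf n a u -> ~ Lf n b v -> (u - v) * p <= 2 * eta.
Proof.
move=> ha hb hT hD p0 hu hv; have v0 := not_Lf_ge0 hv; have u1 := Lf_lt1 hu.
have eta0 := D_gt0 hS ha hb hD.
have [uv|uv] := leP (u - v) 0.
  by apply: le_trans (_ : 0 <= _); [apply: mulr_le0_ge0|lra].
case: hu => [hu|[t [t0 [hTt hPhi]]]]; first by lra.
have pt := not_T_lt hT hTt.
have hT' : ~ T b (t + eta).
  move=> h; apply: hTt; have := T_lipschitz hb ha h (D_sym hS ha hb hD).
  by move/T_le; apply; lra.
have hPhi' := Phi_lipschitz ha hb hPhi hD.
have te : 0 < t + eta by lra.
have hw : Lf n b ((u * t - eta) / (t + eta)).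
  by right; exists (t + eta); split=> //; split=> //; rewrite divfK ?lt0r_neq0.
have := Lf_lt hw hv; rewrite ltr_pdivrMr // => h.
have h3 : (u - v) * p <= (u - v) * t by rewrite ler_pM2l //; lra.
have h4 : v * eta <= eta by rewrite ger_pMl //; lra.
by lra.
Qed.

Lemma not_E_near a b q p eta : car a -> car b -> T a p -> D a b eta ->
  0 < p -> 0 < q -> eta <= p / 2 -> 4 * eta < q * p -> ~ E a b q.
Proof.
move=> ha hb hT hD p0 q0 h1 h2 [h|[n [u [v [h [[hu hv]|[hu hv]]]]]]]; first by lra.
  have := Lf_near ha hb hT hD (ltW p0) hu hv => h3.
  have h4 : q * p < (u - v) * p by rewrite ltr_pM2r.
  have := D_gt0 hS ha hb hD; lra.
(* With [a] and [b] exchanged the lower bound for [phi] drops from [p] to [p - eta >= p / 2], which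
   turns the factor 2 into 4. *)
have hT' := T_lipschitz ha hb hT hD.
have := Lf_near hb ha hT' (D_sym hS ha hb hD) _ hu hv => h3.
have h4 : q * (p / 2) <= (u - v) * (p / 2) by rewrite ler_pM2r //; lra.
have h5 : (u - v) * (p / 2) <= (u - v) * (p - eta) by rewrite ler_pM2l //; lra.
by have := h3; lra.
Qed.

Lemma E_cauchy p q : is_point S p -> 0 < q -> exists k, forall i j,
  io k <= io i -> io k <= io j -> ~ E (p i) (p j) q.
Proof.
move=> hp1 q0; have [p0 [k [p00 hT]]] := T_point hp1; have [_ cp _] := hp1.
have qp : 0 < q * p0 by apply: mulr_gt0.
(* Terms from [i] on are within [2 * hp i] of the [i]-th; [not_E_near] asks this to be at most
   [p0 / 2] and less than [q * p0 / 4]. *)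
have [k1 hk1] := @archimedean A (p0 / 4) ltac:(lra).
have [k2 hk2] := @archimedean A (q * p0 / 8) ltac:(lra).
have [k3 [h1 h2]] := N_join k k1; have [k4 [h3 h4]] := N_join k3 k2.
have half i j : io k4 <= io i -> io i <= io j -> ~ E (p i) (p j) q.
  move=> hi hij; have hD := point_cauchy hS hp1 hij.
  have l1 : hp i <= hp k1 by apply: hp_le; lra.
  have l2 : hp i <= hp k2 by apply: hp_le; lra.
  by apply: not_E_near (hT i _) hD _ _ _ _ => //; lra.
exists k4 => i j hi hj; have [/half|/ltW /half] := leP (io i) (io j); first exact.
by move=> h /E_sym; apply: h.
Qed.

End Cover.

(** * The target space and the code of the identity *)

Section Target.
Variable A : aca.
Local Notation M := (acaM A).
Local Notation L := (rocq_logic M).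
Local Notation io := (@io A).
Local Notation hp := (@hp A).
Local Notation pw := (@pw A).
Local Notation succ n := (add M n (one M)).
Local Notation mpair := (mpair M).
Local Notation MRat := (MRat M).
Local Open Scope ring_scope.

Variables (S : mspace M) (O : set M).
Hypotheses (hS : metric S) (hO : misOpenCovering M L S O).

Local Notation car := (car S).
Local Notation Lf := (Lf S O).
Local Notation E := (E S O).

(* [E_index a b k i] makes [i 2^-k] the k-th approximation of [d'(a, b)], which
   lies between [i 2^-k] and [(i + 1) 2^-k]. *)
Definition E_index a b k i := ~ E a b (io (succ i) * hp k) /\
  forall j, io j < io i -> E a b (io (succ j) * hp k).

Lemma E_index_ex a b k : exists i, E_index a b k i.
Proof.
have [||i [h1 h2]] := @N_least A (fun i => ~ E a b (io (succ i) * hp k)); first by ar.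
  (* Since [d' < 1], the search ends at [2 ^ k] at the latest. *)
  exists (pw k) => /E_lt1; rewrite io_succ mulrDl /hp divff ?lt0r_neq0 ?pw_gt0 //.
  by have := @hp_gt0 A k; rewrite /hp; lra.
by exists i; split=> // j /h2 /contrapT.
Qed.

Lemma E_index_uniq a b k i i' : E_index a b k i -> E_index a b k i' -> i = i'.
Proof.
move=> [h1 h2] [h3 h4]; apply: io_inj.
by have [/h4|/h2|] := ltgtP (io i) (io i').
Qed.

Lemma E_indexP a b k i : E_index a b k i ->
  (forall s, s < io i * hp k -> E a b s) /\ ~ E a b (io i * hp k + hp k).
Proof.
have h0 := hp_gt0 k; move=> [h1 h2]; split; last by move: h1; rewrite io_succ mulrDl mul1r.
move=> s; have [->|[j ij]] := N_cases i; first by rewrite io0 mul0r => ?; left.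
have /h2 h : io j < io i by rewrite ij io_succ ltrDl.
by rewrite ij => hs; apply: E_le h _; apply: ltW.
Qed.

Definition irat k i := MRat i (zer M) (pw k).

Lemma dpos_irat k i : dpos (irat k i). Proof. exact: pw_gt0. Qed.
Lemma val_irat k i : val (irat k i) = io i * hp k.
Proof. by rewrite /val /= io0 subr0. Qed.

Lemma dist_set_ex : exists DB, (forall z, mem M z DB -> exists a b k c, z = mpair (mpair (mpair a b) k) c) /\
  forall a b k c, mem M (mpair (mpair (mpair a b) k) c) DB <->
    [/\ car a, car b & exists i, E_index a b k i /\ c = mqcode M (irat k i)].
Proof.
have [|DB hDB] := @N_compr A (fun z => exists a b k i, car a /\ car b /\ E_index a b k i /\
    z = mpair (mpair (mpair a b) k) (mqcode M (irat k i))).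
  by rewrite /car /E_index /irat /mqcode /mpair; ar.
exists DB; split=> [z /hDB [a [b [k [i [_ [_ [_ ->]]]]]]]|a b k c]; first by do 4 eexists.
rewrite hDB; split.
  move=> [a' [b' [k' [i [ha [hb [hi /mpair_inj [/mpair_inj [/mpair_inj [-> ->] ->] ->]]]]]]]].
  by split=> //; exists i.
by move=> [ha hb [i [hi ->]]]; exists a, b, k, i.
Qed.

(** [d'] may vanish between distinct elements. Codes of spaces allow this, as points at distance
    zero are identified in the completion, so the carrier is kept unchanged. *)
Lemma target_space : exists DB, misSpace M L (MSpace M (mcar M S) DB) /\
  forall a b s, car a -> car b ->
    D (MSpace M (mcar M S) DB) a b s <-> exists t, t < s /\ ~ E a b t.
Proof.
have [DB [h1 h2]] := dist_set_ex; exists DB; set B := MSpace _ _ _.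
have dE a b k q : car a -> car b -> mdA M B a b k q <-> exists i, E_index a b k i /\ q = irat k i.
  move=> ha hb; rewrite /mdA /= h2; split=> [[_ _ [i [hi /mqcode_inj ->]]]|[i [hi ->]]].
    by exists i.
  by split=> //; exists i.
have DE a b s : car a -> car b -> D B a b s <-> exists t, t < s /\ ~ E a b t.
  move=> ha hb; split.
    move=> [k [q [hq /(dE _ _ _ _ ha hb) [i [hi qi]] hs]]].
    exists (val q + hp k); split=> //; rewrite qi val_irat.
    by have [] := E_indexP hi.
  move=> [t [ts ht]]; have [k hk] := @archimedean A (s - t) ltac:(lra).
  have [i hi] := E_index_ex a b k; have [h3 _] := E_indexP hi.
  exists k, (irat k i); split; first exact: dpos_irat.
    by apply/dE => //; exists i.
  rewrite val_irat; have [h|h] := ltP t (io i * hp k); last by lra.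
  by case: ht; apply: h3.
split=> //; apply/misSpaceP; split.
  split=> [z hz|z [a [b [k [ha [hb ->]]]]]].
    have [a [b [k [c zE]]]] := h1 z hz; move: hz; rewrite zE => /h2 [ha hb [i [hi ->]]].
    exists (mpair (mpair a b) k), (mqcode M (irat k i)); split; first by exists a, b, k.
    by split=> //; apply/mQP; exists (irat k i); split=> //; apply: dpos_irat.
  have [i hi] := E_index_ex a b k; exists (mqcode M (irat k i)); split.
    by apply/h2; split=> //; exists i.
  by move=> c /h2 [_ _ [j [hj ->]]]; rewrite (E_index_uniq hi hj).
move=> a b ha hb; split.
- split=> [k|k j q r hq hr kj].
    have [i hi] := E_index_ex a b k; exists (irat k i); split; first exact: dpos_irat.
    by apply/dE => //; exists i.
  move=> /(dE _ _ _ _ ha hb) [i [hi ->]] /(dE _ _ _ _ ha hb) [i' [hi' ->]].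
  rewrite !val_irat; have [h3 h4] := E_indexP hi; have [h3' h4'] := E_indexP hi'.
  have hh := hp_le kj; split; rewrite leNgt; apply/negP.
    by move=> /h3 h; apply: h4'; apply: E_le h _; lra.
  by move=> /h3'.
- by move=> s s0; apply/DE => //; exists (s / 2); split; [lra|apply: E_refl; lra].
- by move=> s /(DE _ _ _ ha hb) [t [ts h]]; apply/DE => //; exists t; split=> // /E_sym.
- move=> s /(DE _ _ _ ha hb) [t [ts h]]; rewrite ltNge; apply/negP => s0.
  by apply: h; left; lra.
- move=> c s t hc /(DE _ _ _ ha hc) [s' [hs h]] /(DE _ _ _ hc hb) [t' [ht h']].
  by apply/DE => //; exists (s' + t'); split; [lra|apply: not_E_tri h h'].
Qed.

Variable DB : set M.
Let B := MSpace M (mcar M S) DB.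
Hypothesis hB : misSpace M L B.
Hypothesis DE : forall a b s, car a -> car b -> D B a b s <-> exists t, t < s /\ ~ E a b t.

Lemma metric_B : metric B. Proof. by have /misSpaceP [] := hB. Qed.

(* The room left by [s < sigma] makes the inequalities of [isValue] strict. *)
Definition nearE a rho b sigma := exists s, s < sigma /\
  forall c, car c -> D S a c rho -> ~ E c b s.

(** All pairs of balls of which the identity maps the first into the second with room to spare: the
    conditions on enlarging [s] and shrinking [r] then follow by inclusion of balls. Testing
    elements of [A] alone keeps this arithmetical. *)
Definition code_ok a r b s := [/\ car a, car b, dpos r /\ dpos s, 0 < val r /\ 0 < val s &
  nearE a (val r) b (val s)].

Lemma code_ex : exists F, (forall z, mem M z F -> exists n a r b s, z = mftuple M n a r b s /\ code_ok a r b s) /\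
  forall a r b s, mfrel M L F a r b s <-> code_ok a r b s.
Proof.
have [|F hF] := @N_compr A (fun z => exists n a r b s, z = mftuple M n a r b s /\
    car a /\ car b /\ (dpos r /\ dpos s) /\ (0 < val r /\ 0 < val s) /\ nearE a (val r) b (val s)).
  by rewrite /car /nearE /mftuple /mqcode /val /dpos /mpair; ar.
exists F; split=> [z /hF [n [a [r [b [s [-> [h1 [h2 [h3 [h4 h5]]]]]]]]]]|a r b s].
  by exists n, a, r, b, s.
split.
  move=> [n /hF [n' [a' [r' [b' [s' [/mpair_inj [_ /mpair_inj [/mpair_inj [-> /mqcode_inj ->]
     /mpair_inj [-> /mqcode_inj ->]]]]]]]]]].
  by move=> [h1 [h2 [h3 [h4 h5]]]].
by move=> [h1 h2 h3 h4 h5]; exists (zer M); apply/hF; exists (zer M), a, r, b, s.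
Qed.

(** * The identity as a continuous function *)

Section Function.
Variable F : set M.
Hypothesis hF1 : forall z, mem M z F -> exists n a r b s, z = mftuple M n a r b s /\ code_ok a r b s.
Hypothesis hF : forall a r b s, mfrel M L F a r b s <-> code_ok a r b s.

Lemma F_continuous : misContinuous M L S B F.
Proof.
have hm := metric_B.
split; last split; last split; last split.
- move=> z /hF1 [n [a [r [b [s [-> [ha hb [hr hs] [r0 s0] _]]]]]]].
  exists n, a; apply/mexQpP; exists r; split=> //; exists b; apply/mexQpP; exists s.
  by split.
- move=> a; apply/mallQpP => r hr r0 b; apply/mallQpP => s hs s0 b'; apply/mallQpP => s' hs' s0'.
  move=> [/hF [ha hb _ _ [t [ts ht]]] /hF [_ hb' _ _ [t' [ts' ht']]]].
  apply/mrlt_rat; [by apply: regular_dA|exact: dpos_add|].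
  apply/DE => //; exists (t + t'); split; first by rewrite val_add //; lra.
  have haa := D_refl hS ha r0.
  by apply: (@not_E_tri _ _ _ a); [apply: not_E_sym; apply: ht|apply: ht'].
- move=> a; apply/mallQpP => r hr r0 b; apply/mallQpP => s hs s0 b'; apply/mallQpP => s' hs' s0'.
  move=> [hb' [/hF [ha hb _ _ [t [ts ht]]]]].
  have rd := regular_dA hm hb hb'; have rs := regular_rat hs.
  move/(mrleP (regular_add rd rs) (regular_rat hs')) => hle.
  (* A relation [<=] between reals gives rational bounds only up to an error; half of the room
     [val s - t] covers it. *)
  pose g := (val s - t) / 2.
  have [|u [v [/(DE _ hb hb') [u' [uu' hu]] /(U_rat _ hs) sv uv]]] := iffLR (U_add (val s' + g) rd rs).
    by apply: hle; apply/U_rat => //; rewrite /g; lra.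
  apply/hF; split=> //; exists (t + u'); split; first by rewrite /g in uv; lra.
  by move=> c hc /(ht _ hc) h; apply: not_E_tri h hu.
- move=> a; apply/mallQpP => r hr r0 b; apply/mallQpP => s hs s0 a'; apply/mallQpP => r' hr' r0'.
  move=> [ha' [/hF [ha hb _ _ [t [ts ht]]]]].
  have rd := regular_dA hS ha ha'; have rr := regular_rat hr'.
  move/(mrleP (regular_add rd rr) (regular_rat hr)) => hle.
  apply/hF; split=> //; exists t; split=> // c hc /D_open [w [wr hw]]; apply: ht => //.
  (* Here the error is covered by the room of [c] in the smaller ball. *)
  pose g := val r' - w.
  have [|u [v [hu /(U_rat _ hr') sv uv]]] := iffLR (U_add (val r + g) rd rr).
    by apply: hle; apply/U_rat => //; rewrite /g; lra.
  by apply: D_le (D_tri hS ha ha' hc hu hw) _; rewrite /g in uv; lra.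
- move=> X hX; have [p [hpt hr]] := point_of hS hX.
  apply/mallQpP => q hq q0.
  have [p0 [k [p00 hT]]] := T_point hS hO hpt; have [_ cp _] := hpt.
  have qp : 0 < val q * p0 by apply: mulr_gt0.
  (* For the distance [val q / 4], [not_E_near] needs [hp k3 <= p0 / 2] and
     [4 * hp k3 < val q / 4 * p0]. Two further halvings make [2 * hp i < hp k3], so that the ball of
     radius [hp k3] about [p i] contains the point. *)
  have [k1 hk1] := @archimedean A (p0 / 2) ltac:(lra).
  have [k2 hk2] := @archimedean A (val q * p0 / 16) ltac:(lra).
  have [k3 [l1 l2]] := N_join k1 k2; have [i [l3 l4]] := N_join k (succ (succ k3)).
  have [s [hs sq]] := rat_of (A := A) (val q / 2).
  have h0 := hp_gt0 k3; have hi : 2 * hp i < hp k3.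
    by have := hp_le l4; rewrite !hpS; lra.
  exists (p i); apply/mexQpP; exists (hrat k3).
  rewrite val_hrat; split=> //; first exact: dpos_hrat.
  exists (p i); apply/mexQpP; exists s; split=> //; first by rewrite sq; lra.
  split; last split.
  + apply/hF; split=> //; first by split=> //; apply: dpos_hrat.
      by rewrite val_hrat sq; split=> //; lra.
    exists (val q / 4); split; first by rewrite sq; lra.
    move=> c hc; rewrite val_hrat => hD; apply: not_E_sym.
    have m1 := hp_le l1; have m2 := hp_le l2.
    by apply: not_E_near (hT i l3) hD _ _ _ _ => //; lra.
  + apply/(mrlt_dP hS hpt (const_point hS (cp i)) hr (represents_const (p i)) (dpos_hrat k3)).
    exists (2 * hp i), i; rewrite val_hrat; split=> // j hj.
    by apply: D_sym => //; apply: point_cauchy.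
  + by apply/mqltP => //; rewrite sq; lra.
Qed.

(* The value at [x] is a subsequence of [x] that converges rapidly for [d']. *)
Lemma value_ex x p : is_point S p -> represents x p ->
  exists u y, [/\ is_point B u, represents (mpset M y) u, misPoint M L B y,
    misValue M L S B F x (mpset M y) &
    forall q, 0 < q -> exists k, forall i j, io k <= io i -> io k <= io j -> ~ E (u i) (p j) q].
Proof.
move=> hpt hx; have [Afp cp _] := hpt; have hm := metric_B.
(* [K] is the least index from which on the sequence stays within [hp n / 4] of [p K] for [d'].
   Minimality makes the choice arithmetical, and [hp n / 4 + hp n / 8 < hp n] makes the subsequence
   rapid. *)
pose R n K := (forall i, io K <= io i -> ~ E (p K) (p i) (hp n / 4)) /\
  forall K', io K' < io K -> ~ (forall i, io K' <= io i -> ~ E (p K') (p i) (hp n / 4)).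
have [|||h [Afh hR]] := @Af_choice A R; first by rewrite /R; ar.
- move=> n; have [|k hk] := @E_cauchy A S O hS hO p (hp n / 4) hpt.
    by have := @hp_gt0 A n; lra.
  apply: (@N_least A (fun K => forall i, io K <= io i -> ~ E (p K) (p i) (hp n / 4))); first by ar.
  by exists k => i; apply: hk.
- move=> n K K' [h1 h2] [h3 h4]; apply: io_inj.
  by have [/h4|/h2|] := ltgtP (io K) (io K').
have hE n i : io (h n) <= io i -> ~ E (p (h n)) (p i) (hp n / 4).
  by move=> hi; have [hh _] := (hR n (h n)).2 erefl; apply: hh.
pose u n := p (h n).
have hu : is_point B u.
  split; first by rewrite /u; ar.
    by move=> n; apply: cp.
  move=> n; apply/DE; rewrite /u => //; have [i [h1 h2]] := N_join (h n) (h (succ n)).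
  exists (hp n / 4 + hp (succ n) / 4); split; first by rewrite hpS; have := @hp_gt0 A n; lra.
  by apply: not_E_tri (hE _ _ h1) _; apply: not_E_sym; apply: hE.
have [y [hy hyu]] := set_of_point hm hu.
have close q : 0 < q -> exists k, forall i j, io k <= io i -> io k <= io j -> ~ E (u i) (p j) q.
  move=> q0; have [k1 hk1] := @archimedean A q q0.
  have [k2 hk2] := @E_cauchy A S O hS hO p (q / 2) hpt ltac:(lra).
  have [k [l1 l2]] := N_join k1 k2; exists k => i j hi hj.
  have [j' [m1 m2]] := N_join (h i) k2.
  have e1 := hE _ _ m1; have e2 := hk2 j' j m2 (le_trans l2 hj).
  apply: not_E_le (not_E_tri e1 e2) _.
  by have := hp_le (le_trans l1 hi); lra.
exists u, y; split=> //.
move=> a; apply/mallQpP => r hr r0 b; apply/mallQpP => s hs s0.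
move=> [/hF [ha hb _ _ [t [ts ht]]]].
move=> /(mrlt_dP hS hpt (const_point hS ha) hx (represents_const a) hr) [w [k [wr hk]]].
apply/(mrlt_dP hm hu (const_point hm hb) hyu (represents_const b) hs).
(* The room in [nearE] is spent here: a third of it on the passage from [p i] to [u j], and what
   remains keeps the bound strict at the limit. *)
have [k' hk'] := close ((val s - t) / 3) ltac:(lra).
have [i [l1 l2]] := N_join k k'.
exists (t + (val s - t) / 2), k'; split; first by lra.
move=> j hj; apply/(DE _ (cp (h j)) hb); exists ((val s - t) / 3 + t); split; first by lra.
apply: not_E_tri (hk' j i hj l2) _; apply: ht => //.
by apply: D_sym => //; apply: D_le (hk i l1) _; apply: ltW.
Qed.

End Function.

Lemma cover_lebesgue : mAtsuji M L S ->
  exists R, mRealPos M L R /\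
    mallP M L S (fun x => exists n, mallP M L S (fun y =>
        mrlt M L (mdP M L S x y) (mrset M R) -> minOpen M L S O n y)).
Proof.
move=> hA; have [F [hF1 hF]] := code_ex; have hm := metric_B.
have [E0 [hE0 [_ hE1]]] := @const_real A (1 / 2) ltac:(lra).
have [R [hR huc]] := hA _ _ hB F (F_continuous hF1 hF) E0 hE0.
exists R; split=> // X hX; have [p [hpt hp1]] := point_of hS hX; have [_ cp _] := hpt.
have [i0 hi0] := @E_cauchy A S O hS hO p (1 / 16) hpt ltac:(lra).
(* [n] must serve all [y], so it is chosen from [x] alone, at a term beyond which [x] moves by at
   most [1 / 16] for [d']. *)
have [n hn] := @Lf_ex A S O hS hO (p i0) (15 / 16) (cp i0) ltac:(lra).
exists n => Y hY hXY; have [g [hgt hg1]] := point_of hS hY; have [_ cg _] := hgt.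
have [u [y1 [hu hu1 hy1 hv1 close1]]] := value_ex hF hpt hp1.
have [v [y2 [hv hv2 hy2 hv3 close2]]] := value_ex hF hgt hg1.
have := huc X hX Y hY hXY y1 hy1 y2 hy2 (conj hv1 hv3).
move=> /(mrltP (regular_dP hm hu hv hu1 hv2) (mRealP hE0.1)).
move=> [s [/(U_dP hm s hu hv hu1 hv2) [t [k [ts huv]]] /hE1 hs]].
have [k1 hk1] := close1 (1 / 16) ltac:(lra); have [k2 hk2] := close2 (1 / 16) ltac:(lra).
have [a [a1 a2]] := N_join k1 k2; have [b [b1 b2]] := N_join a k.
have [c [c1 c2]] := N_join i0 b.
have [_ cu _] := hu; have [_ cv _] := hv.
have [t' [tt' ht']] := iffLR (DE t (cu c) (cv c)) (huv c (le_trans b2 c2)).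
(* Along [p i0], [p c], [u c], [v c], [g j] the distances [d'] add up to less than [3 / 16 + 1 / 2].
   This is less than [15 / 16 - 1 / 8], so [F_n] cannot fall to [1 / 8]. *)
have key j : io k2 <= io j -> Lf n (g j) (1 / 8).
  move=> hj; apply: contrapT => hnl.
  have hc1 : io k1 <= io c by apply: le_trans a1 (le_trans b1 c2).
  have hc2 : io k2 <= io c by apply: le_trans a2 (le_trans b1 c2).
  have e1 := not_E_tri (hi0 i0 c (lexx _) c1) (not_E_sym (hk1 c c hc1 hc1)).
  have e2 := not_E_tri (not_E_tri e1 ht') (hk2 c j hc2 hj).
  by apply: e2; right; exists n, (15 / 16), (1 / 8); split; [lra|left].
(* A bound on terms of [y] has to become membership of the limit. As [phi > p1] along a tail,
   [F_n(g j) > 1 / 8] gives room [p1 / 8] inside some ball; half of it covers the [2 * hp j] by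
   which later terms may differ. *)
have [p1 [k3 [p10 hT]]] := T_point hS hO hgt.
have [k4 hk4] := @archimedean A (p1 / 32) ltac:(lra).
have [d [d1 d2]] := N_join k2 k3; have [j [j1 j2]] := N_join d k4.
have [|[t1 [t10 [hnT hPhi]]]] := key j (le_trans d1 j1); first by lra.
have pt := not_T_lt (hT j (le_trans d2 j1)) hnT.
have {hPhi} [_ [m [e [r [hb hD]]]]] : Phi S O n (g j) (p1 / 8) by apply: Phi_le hPhi _; lra.
have he := ball_car hO hb; have hr := D_gt0 hS (cg _) he hD.
apply/(minOpenP hS hO n hgt hg1); exists m, e, r, (r - p1 / 16), j; split=> //; try lra.
move=> i hi; apply: D_le (D_tri hS (cg _) (cg _) he _ hD) (_ : 2 * hp j + _ <= _).
  by apply: D_sym => //; apply: point_cauchy.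
by have := hp_le j2; lra.
Qed.

End Target.

Theorem theorem6p7 : proves ACA0 Atsuji_implies_Lebesgue.
Proof.
apply: (completeness ACA0 ACA0_subst) => M HM e r; rewrite eval_main deep_rocq.
have [Q [io [[h0 [h1 [hD hM]]] [hlt hfrac]]]] := fraction_field M r HM.
pose A := Aca r HM h0 h1 hD hM hlt hfrac.
move=> C DC hS hA O hO.
have [_ hm] := iffLR (@misSpaceP A _) hS.
have [DB [hB DE]] := @target_space A (MSpace M C DC) O.
exact: (cover_lebesgue hm hO hB DE hA).
Qed.
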